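(* Let $f:D_1\to D_2$ be a continuous Kobayashi isometry between two bounded domains in $\mathbf{C}^n$. Let $p^0\in\partial D_1$ and $q^0\in\partial D_2$. Assume that the boundaries $\partial D_1$ and $\partial D_2$ are both $C^2$-smooth strongly pseudoconvex near $p^0$ and $q^0$ respectively. Suppose that $q^0$ belongs to the cluster set of $p^0$ under $f$. Then $f$ extends as a continuous mapping to a neighbourhood of $p^0$ in $\overline{D}_1$.
   Context: Let $\Delta$ be the open unit disc in $\mathbf{C}$. For a domain $D\subset\mathbf{C}^n$ the infinitesimal Kobayashi metric is $F^K_D(z,\xi)=\inf\{1/\alpha:\alpha>0,\ \exists g:\Delta\to D\text{ holomorphic},\ g(0)=z,\ g'(0)=\alpha\xi\}$, and the Kobayashi distance $d_D(p,q)$ is the infimum of $\int_0^1F^K_D(\gamma(t),\dot\gamma(t))\,dt$ over piecewise $C^1$ curves $\gamma:[0,1]\to D$ joining $p$ to $q$. A continuous (i.e. $C^0$-) Kobayashi isometry $f:D_1\to D_2$ is a bijection with $d_{D_2}(f(x),f(y))=d_{D_1}(x,y)$ for all $x,y\in D_1$; it is not assumed holomorphic. The point $q^0$ belongs to the cluster set of $p^0$ under $f$ if there is a sequence $p^j\in D_1$ with $p^j\to p^0$ and $f(p^j)\to q^0$. No assumptions are made on the domains away from $p^0$, $q^0$ other than boundedness. *)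

(* Defs.v *)
From HB Require Import structures.
From mathcomp Require Import all_boot all_order all_algebra.
From mathcomp Require Import complex.
From mathcomp Require Import all_classical all_reals all_analysis.

Set Implicit Arguments.
Unset Strict Implicit.
Unset Printing Implicit Defensive.

Import Order.TTheory GRing.Theory Num.Theory.
Import numFieldNormedType.Exports.

Local Open Scope classical_set_scope.
Local Open Scope ring_scope.
Local Open Scope complex_scope.

(* [R[i]] carries in the library a module structure over R; going through this
   alias selects instead its structure of normed module over itself, so that
   [derivable] and [derive1] denote complex differentiation on [cplx R]. *)
Definition cplx (R : realType) : numClosedFieldType := R[i].

Notation "''Cn[' R ]_ n" := 'rV[cplx R]_n
  (at level 8, n at level 2, format "''Cn[' R ]_ n") : type_scope.

Definition ofreal (R : realType) (x : R) : cplx R := x%:C.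
Definition re (R : realType) (z : cplx R) : R := complex.Re (z : R[i]).
Definition im (R : realType) (z : cplx R) : R := complex.Im (z : R[i]).

Definition boundary (T : topologicalType) (D : set T) : set T :=
  closure D `\` interior D.

Definition is_domain (T : topologicalType) (D : set T) : Prop :=
  [/\ open D, connected D & D !=set0].

Definition holomorphic_disc (R : realType) (n : nat) (D : set 'Cn[R]_n)
    (g : cplx R -> 'Cn[R]_n) : Prop :=
  forall z : cplx R, `|z| < 1 -> derivable g z 1 /\ D (g z).

Definition kobayashi_metric (R : realType) (n : nat) (D : set 'Cn[R]_n)
    (z xi : 'Cn[R]_n) : \bar R :=
  ereal_inf [set (alpha^-1)%:E | alpha in [set alpha : R |
    0 < alpha /\
    exists g : cplx R -> 'Cn[R]_n,
      [/\ holomorphic_disc D g, g 0 = z & derive1 g 0 = ofreal alpha *: xi]]].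

Definition re_coord (R : realType) (n : nat) (gamma : R -> 'Cn[R]_n)
  (j : 'I_n) : R -> R := fun t => re (gamma t 0 j).
Definition im_coord (R : realType) (n : nat) (gamma : R -> 'Cn[R]_n)
  (j : 'I_n) : R -> R := fun t => im (gamma t 0 j).

Definition velocity (R : realType) (n : nat) (gamma : R -> 'Cn[R]_n)
    (t : R) : 'Cn[R]_n :=
  \row_j ((derive1 (re_coord gamma j) t +i* derive1 (im_coord gamma j) t) : cplx R).

Definition C1_curve (R : realType) (n : nat) (sigma : R -> 'Cn[R]_n) : Prop :=
  (forall (t : R) (j : 'I_n),
     derivable (re_coord sigma j) t 1 /\ derivable (im_coord sigma j) t 1) /\
  continuous (velocity sigma).

(* The subdivision is 0 = t_0 < t_1 < ... < t_k = 1 with s = [t_1; ...; t_k];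
   being C^1 on the closed interval [t_i, t_(i+1)] (one-sided derivatives at
   the endpoints) is expressed by the existence of a C^1 extension to R. *)
Definition piecewise_C1 (R : realType) (n : nat) (gamma : R -> 'Cn[R]_n)
    : Prop :=
  {within `[0, 1], continuous gamma} /\
  exists s : seq R,
    [/\ path <%R 0 s, last 0 s = 1 &
      forall i : nat, (i < size s)%N ->
        exists sigma : R -> 'Cn[R]_n, C1_curve sigma /\
          forall t : R, nth 0 (0 :: s) i <= t <= nth 0 s i ->
            gamma t = sigma t].

(* [velocity gamma] takes irrelevant values at the finitely many subdivision
   points; they do not affect the integral. *)
Definition kobayashi_length (R : realType) (n : nat) (D : set 'Cn[R]_n)
    (gamma : R -> 'Cn[R]_n) : \bar R :=
  (\int[@lebesgue_measure R]_(t in `[0%R, 1%R])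
    kobayashi_metric D (gamma t) (velocity gamma t))%E.

Definition kobayashi_dist (R : realType) (n : nat) (D : set 'Cn[R]_n)
    (p q : 'Cn[R]_n) : \bar R :=
  ereal_inf [set kobayashi_length D gamma | gamma in [set gamma |
    [/\ piecewise_C1 gamma,
        forall t : R, 0 <= t <= 1 -> D (gamma t),
        gamma 0 = p & gamma 1 = q]]].

Definition kobayashi_isometry (R : realType) (n : nat)
    (D1 D2 : set 'Cn[R]_n) (f : 'Cn[R]_n -> 'Cn[R]_n) : Prop :=
  set_bij D1 D2 f /\
  forall x y : 'Cn[R]_n, D1 x -> D1 y ->
    kobayashi_dist D2 (f x) (f y) = kobayashi_dist D1 x y.

(* The real coordinates of z are (x_j, y_j), z_j = x_j + i y_j; [b = false]
   selects the x_j-direction and [b = true] the y_j-direction. *)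
Definition real_dir (R : realType) (n : nat) (b : bool) (j : 'I_n)
    : 'Cn[R]_n :=
  (if b then ('i : cplx R) else 1) *: delta_mx 0 j.

Definition real_line (R : realType) (n : nat) (b : bool) (j : 'I_n)
    (rho : 'Cn[R]_n -> R) (z : 'Cn[R]_n) : R -> R :=
  fun t => rho (z + ofreal t *: real_dir R b j).

Definition partial (R : realType) (n : nat) (b : bool) (j : 'I_n)
    (rho : 'Cn[R]_n -> R) : 'Cn[R]_n -> R :=
  fun z => derive1 (real_line b j rho z) 0.

Notation d_x := (partial false).
Notation d_y := (partial true).

Definition C1_on (R : realType) (n : nat) (U : set 'Cn[R]_n)
    (rho : 'Cn[R]_n -> R) : Prop :=
  (forall z, U z -> {for z, continuous rho}) /\
  forall (b : bool) (j : 'I_n) (z : 'Cn[R]_n), U z ->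
    derivable (real_line b j rho z) 0 1 /\
    {for z, continuous (partial b j rho)}.

Definition C2_on (R : realType) (n : nat) (U : set 'Cn[R]_n)
    (rho : 'Cn[R]_n -> R) : Prop :=
  C1_on U rho /\ forall (b : bool) (j : 'I_n), C1_on U (partial b j rho).

(* d/dz_j = (d/dx_j - i d/dy_j) / 2 *)
Definition d_z (R : realType) (n : nat) (j : 'I_n) (rho : 'Cn[R]_n -> R)
    (z : 'Cn[R]_n) : cplx R :=
  2^-1 * (d_x j rho z -i* d_y j rho z : cplx R).

(* d^2/dz_j dzbar_k = (d/dx_j - i d/dy_j) (d/dx_k + i d/dy_k) / 4 *)
Definition d_z_zbar (R : realType) (n : nat) (j k : 'I_n)
    (rho : 'Cn[R]_n -> R) (z : 'Cn[R]_n) : cplx R :=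
  4^-1 * (((d_x j (d_x k rho) z + d_y j (d_y k rho) z)
           +i* (d_x j (d_y k rho) z - d_y j (d_x k rho) z)) : cplx R).

Definition levi_form (R : realType) (n : nat) (rho : 'Cn[R]_n -> R)
    (z v : 'Cn[R]_n) : cplx R :=
  \sum_(j < n) \sum_(k < n) d_z_zbar j k rho z * v 0 j * Num.conj (v 0 k).

Definition complex_tangent (R : realType) (n : nat) (rho : 'Cn[R]_n -> R)
    (z v : 'Cn[R]_n) : Prop :=
  \sum_(j < n) d_z j rho z * v 0 j = 0.

(* Since rho is real valued, d rho <> 0 at z iff some d_z j rho z is nonzero.
   In [0 < levi_form rho z v] the order is that of [cplx R], that is, the
   (real) number [levi_form rho z v] is positive. *)
Definition C2_strongly_pseudoconvex_near (R : realType) (n : nat)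
    (D : set 'Cn[R]_n) (p : 'Cn[R]_n) : Prop :=
  exists (U : set 'Cn[R]_n) (rho : 'Cn[R]_n -> R),
    [/\ open U, U p, C2_on U rho,
        D `&` U = [set z | U z /\ rho z < 0] /\
        boundary D `&` U = [set z | U z /\ rho z = 0] &
        forall z, boundary D z -> U z ->
          (exists j : 'I_n, d_z j rho z != 0) /\
          forall v : 'Cn[R]_n, v != 0 -> complex_tangent rho z v ->
            0 < levi_form rho z v].

Definition in_cluster_set (R : realType) (n : nat) (D : set 'Cn[R]_n)
    (f : 'Cn[R]_n -> 'Cn[R]_n) (p q : 'Cn[R]_n) : Prop :=
  exists u : nat -> 'Cn[R]_n,
    [/\ forall j, D (u j), u @ \oo --> p & (f \o u) @ \oo --> q].

Definition extends_continuously_near (R : realType) (n : nat)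
    (D : set 'Cn[R]_n) (f : 'Cn[R]_n -> 'Cn[R]_n) (p : 'Cn[R]_n) : Prop :=
  exists (U : set 'Cn[R]_n) (F : 'Cn[R]_n -> 'Cn[R]_n),
    [/\ open U, U p,
        {within U `&` closure D, continuous F} &
        forall z, D z -> U z -> F z = f z].

(* Main.v *)
(* Near a strongly pseudoconvex boundary point with defining function rho, the
   distance d(x, y) is at least - ln (- rho x) / 2 - ln (- rho y) / 2 - A for
   x, y a fixed distance apart, while points within s of each other are joined
   through points at depth about s, whence
     d(x, y) <= ln ((s - rho x) / - rho x) / 2 + ln ((s - rho y) / - rho y) / 2 + A.
   The lower bound rests on holomorphic polynomials peaking at interior points
   near the boundary: composed with a disc they are controlled by Harnack's
   inequality, which keeps large parts of the disc near its centre.  Holding one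
   of the two points fixed gives - rho2 (f p) <= const * (- rho1 p); if p, q are
   within s of each other and of depth at most s, the upper bound for d(p, q)
   then contradicts the lower bound for d(f p, f q) when s is small, unless f p
   and f q are close.  So f is Cauchy at the boundary points near p0, as soon as
   f maps points near p0 to points near q0, and this follows by moving along the
   curves of the upper bound from the points of the cluster sequence. *)
From mathcomp Require Import all_boot all_order all_algebra.
From mathcomp Require Import complex.
From mathcomp Require Import all_classical all_reals all_analysis.
From mathcomp Require Import measurable_realfun.
From mathcomp Require Import ring lra.
Require Import Defs.

Set Implicit Arguments.
Unset Strict Implicit.
Unset Printing Implicit Defensive.

Import Order.TTheory GRing.Theory Num.Theory.
Import numFieldNormedType.Exports.

Local Open Scope classical_set_scope.
Local Open Scope ring_scope.
Local Open Scope complex_scope.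

(** Every logarithm must carry the exact coefficient 1/2 in both bounds, because they are compared
    up to additive constants only. This dictates the estimates of the metric. From above, explicit
    discs in the normal direction give [1 / (2 (d + t))] up to a bounded error. From below, a disc
    centred at depth [d] is known to stay near the boundary point only on the radius [1 - A sqrt d];
    the density [1 / (2 v)] thus loses a factor [1 + k sqrt v], which changes its primitive
    [ln v / 2] by a term bounded near 0. Peak polynomials are centred at interior points so that
    their value at the centre is comparable to the depth there. A second obstacle is that
    measurability of the metric along a curve is not established; lengths are compared only through
    measurable functions below or above the integrand. The complex analysis rests on one minimum
    principle for real parts, proved by bisection of rectangles. The inequalities of Caratheodory,
    Cauchy and Harnack follow from it by algebra and the mean value theorem. *)

Section ComplexNorm.
Variables (R : realType).
Implicit Types (a b : R) (z w : cplx R).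

Lemma reD z w : re (z + w) = re z + re w. Proof. by case: z; case: w. Qed.
Lemma imD z w : im (z + w) = im z + im w. Proof. by case: z; case: w. Qed.
Lemma reN z : re (- z) = - re z. Proof. by case: z. Qed.
Lemma imN z : im (- z) = - im z. Proof. by case: z. Qed.
Lemma reB z w : re (z - w) = re z - re w. Proof. by rewrite reD reN. Qed.
Lemma imB z w : im (z - w) = im z - im w. Proof. by rewrite imD imN. Qed.
Lemma reM z w : re (z * w) = re z * re w - im z * im w.
Proof. by case: z; case: w. Qed.
Lemma imM z w : im (z * w) = re z * im w + im z * re w.
Proof. by case: z; case: w. Qed.
Lemma re_ofreal a : re (ofreal a) = a. Proof. by []. Qed.
Lemma im_ofreal a : im (ofreal a) = 0. Proof. by []. Qed.
Lemma re0 : re (0 : cplx R) = 0. Proof. by []. Qed.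
Lemma re1 : re (1 : cplx R) = 1. Proof. by []. Qed.
Lemma im1 : im (1 : cplx R) = 0. Proof. by []. Qed.
Lemma re_i : re ('i : cplx R) = 0. Proof. by rewrite -complexiE. Qed.
Lemma im_i : im ('i : cplx R) = 1. Proof. by rewrite -complexiE. Qed.
Lemma cplx_eq z w : re z = re w -> im z = im w -> z = w.
Proof. by case: z => a b; case: w => c d; rewrite /re /im /= => -> ->. Qed.
Lemma re_sum (I : Type) (s : seq I) (F : I -> cplx R) :
  re (\sum_(i <- s) F i) = \sum_(i <- s) re (F i).
Proof. exact: (big_morph _ reD re0). Qed.

Lemma ofrealD a b : ofreal (a + b) = ofreal a + ofreal b.
Proof. by apply: cplx_eq; rewrite ?reD ?imD ?re_ofreal ?im_ofreal ?addr0. Qed.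
Lemma ofrealN a : ofreal (- a) = - ofreal a.
Proof. by apply: cplx_eq; rewrite ?reN ?imN ?re_ofreal ?im_ofreal ?oppr0. Qed.
Lemma ofrealB a b : ofreal (a - b) = ofreal a - ofreal b.
Proof. by rewrite ofrealD ofrealN. Qed.
Lemma ofrealM a b : ofreal (a * b) = ofreal a * ofreal b.
Proof. by apply: cplx_eq; rewrite ?reM ?imM ?re_ofreal ?im_ofreal; ring. Qed.
Lemma ofreal0 : ofreal 0 = 0 :> cplx R. Proof. by []. Qed.
Lemma ofreal1 : ofreal 1 = 1 :> cplx R. Proof. by []. Qed.
Lemma ofreal_eq0 a : (ofreal a == 0 :> cplx R) = (a == 0).
Proof. by apply/eqP/eqP => [[]|->]. Qed.
Lemma ofrealV a : ofreal a^-1 = (ofreal a)^-1 :> cplx R.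
Proof.
have [->|a0] := eqVneq a 0; first by rewrite invr0 ofreal0 invr0.
apply: (mulIf (x := ofreal a)); first by rewrite ofreal_eq0.
by rewrite mulVf ?ofreal_eq0// -ofrealM mulVf.
Qed.
Lemma ofreal_le a b : (ofreal a <= ofreal b :> cplx R) = (a <= b).
Proof. by rewrite /ofreal lecR. Qed.
Lemma ofreal_lt a b : (ofreal a < ofreal b :> cplx R) = (a < b).
Proof. by rewrite /ofreal ltcR. Qed.

Lemma ge0_ofreal z : 0 <= z -> z = ofreal (re z).
Proof. by case: z => x y; rewrite lecE /= => /andP[/eqP -> _]. Qed.
End ComplexNorm.

(** The norm of a normed module over [cplx R] takes its values in [cplx R]. Passing to its real part
    moves every estimate to the ordered field [R], where [lra] and [nra] apply; on row vectors it is
    the maximum norm. *)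
Definition nrm (R : realType) (V : normedModType (cplx R)) (v : V) : R := re `|v|.

Section Nrm.
Variables (R : realType) (V : normedModType (cplx R)).
Implicit Types (u v w : V).

Lemma normE v : `|v| = ofreal (nrm v).
Proof. exact/ge0_ofreal/normr_ge0. Qed.
Lemma nrm_ge0 v : 0 <= nrm v.
Proof. by rewrite -ofreal_le -normE normr_ge0. Qed.
Lemma nrmD u v : nrm (u + v) <= nrm u + nrm v.
Proof. by rewrite -ofreal_le ofrealD -!normE ler_normD. Qed.
Lemma nrmN v : nrm (- v) = nrm v.
Proof. by rewrite /nrm normrN. Qed.
Lemma nrm0 : nrm (0 : V) = 0.
Proof. by rewrite /nrm normr0. Qed.
Lemma nrm_eq0 v : (nrm v == 0) = (v == 0).
Proof. by rewrite -ofreal_eq0 -normE normr_eq0. Qed.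
Lemma nrm_gt0 v : (0 < nrm v) = (v != 0).
Proof. by rewrite lt_neqAle nrm_ge0 andbT eq_sym nrm_eq0. Qed.
Lemma nrmB u v : nrm (u - v) <= nrm u + nrm v.
Proof. by rewrite (le_trans (nrmD _ _))// nrmN. Qed.
Lemma nrmBC u v : nrm (u - v) = nrm (v - u).
Proof. by rewrite -nrmN opprB. Qed.
Lemma nrm_tri w u v : nrm (u - v) <= nrm (u - w) + nrm (w - v).
Proof. by rewrite (le_trans _ (nrmD _ _))// addrA subrK. Qed.
Lemma nrm_sub u v : nrm u - nrm v <= nrm (u - v).
Proof. by rewrite lerBlDr (le_trans _ (nrmD _ _))// subrK. Qed.
Lemma nrm_sub2 u v : `|nrm u - nrm v| <= nrm (u - v).
Proof. by rewrite ler_norml nrm_sub andbT lerNl opprB nrmBC nrm_sub. Qed.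

Lemma nbhs_nrmP (v : V) (A : set V) :
  nbhs v A <-> exists2 e : R, 0 < e & forall u, nrm (u - v) < e -> A u.
Proof.
split.
  move=> /nbhs_ballP [e /= e0 eA]; have e1 := ge0_ofreal (ltW e0).
  exists (re e); first by rewrite -ofreal_lt -e1.
  by move=> u h; apply: eA; rewrite -ball_normE /ball_ /= e1 normE ofreal_lt nrmBC.
move=> [e e0 eA]; apply/nbhs_ballP; exists (ofreal e); first by rewrite /= -ofreal0 ofreal_lt.
by move=> u; rewrite -ball_normE /ball_ /= normE ofreal_lt nrmBC; apply: eA.
Qed.

Lemma open_nrmP (A : set V) : open A <->
  forall v, A v -> exists2 e : R, 0 < e & forall u, nrm (u - v) < e -> A u.
Proof.
rewrite openE; split=> [h v /h /nbhs_nrmP //|h v /h ?]; exact/nbhs_nrmP.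
Qed.

Lemma closure_nrmP (A : set V) v : closure A v <->
  forall e : R, 0 < e -> exists2 u, A u & nrm (u - v) < e.
Proof.
split=> [h e e0|h B /nbhs_nrmP[e e0 eB]].
  have /h[u [Au]] : nbhs v [set u | nrm (u - v) < e] by apply/nbhs_nrmP; exists e.
  by exists u.
by have [u Au uv] := h e e0; exists u; split=> //; exact: eB.
Qed.
End Nrm.

Section NrmC.
Variables (R : realType).
Implicit Types (a b : R) (z w : cplx R).

Lemma nrmZ (V : normedModType (cplx R)) z (v : V) : nrm (z *: v) = nrm z * nrm v.
Proof. by apply: (complexI (R := R)); rewrite -/(ofreal _) -normE normrZ !normE -ofrealM. Qed.
Lemma nrmM z w : nrm (z * w) = nrm z * nrm w.
Proof. by rewrite -nrmZ. Qed.
Lemma nrm_ofreal a : nrm (ofreal a) = `|a|.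
Proof. by rewrite /nrm /ofreal normc_def /= expr0n addr0 sqrtr_sqr. Qed.
Lemma nrm1 : nrm (1 : cplx R) = 1.
Proof. by rewrite -[1]/(ofreal 1) nrm_ofreal normr1. Qed.
Lemma sqr_nrm z : nrm z ^+ 2 = re z ^+ 2 + im z ^+ 2.
Proof.
by case: z => a b; rewrite /nrm normc_def /= sqr_sqrtr// addr_ge0 ?sqr_ge0.
Qed.
Lemma re_le_nrm z : `|re z| <= nrm z.
Proof.
by rewrite -(ler_pXn2r (n := 2)) ?nnegrE ?nrm_ge0// sqr_nrm real_normK ?num_real// lerDl sqr_ge0.
Qed.
Lemma im_le_nrm z : `|im z| <= nrm z.
Proof.
by rewrite -(ler_pXn2r (n := 2)) ?nnegrE ?nrm_ge0// sqr_nrm real_normK ?num_real// lerDr sqr_ge0.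
Qed.
Lemma nrm_le_reim z : nrm z <= `|re z| + `|im z|.
Proof.
rewrite -(ler_pXn2r (n := 2)) ?nnegrE ?nrm_ge0 ?addr_ge0// sqr_nrm.
have := @real_normK R (re z) (num_real _); have := @real_normK R (im z) (num_real _).
by have := normr_ge0 (re z); have := normr_ge0 (im z); nra.
Qed.
Lemma nrmV z : nrm z^-1 = (nrm z)^-1.
Proof. by rewrite /nrm normfV normE -ofrealV re_ofreal. Qed.
Lemma nrm_conj z : nrm (Num.conj z) = nrm z.
Proof. by rewrite /nrm norm_conjC. Qed.

Lemma nrm_coord n (v : 'Cn[R]_n) j : nrm (v 0 j) <= nrm v.
Proof.
rewrite -ofreal_le -!normE [leRHS]/Num.norm /= mx_normE -[leLHS]nngE num_le.
exact: (le_bigmax _ _ (0, j)).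
Qed.

Lemma nrm_le_coord n (v : 'Cn[R]_n) a :
  0 <= a -> (forall j, nrm (v 0 j) <= a) -> nrm v <= a.
Proof.
move=> a0 h; rewrite -ofreal_le -normE.
have [->|/mx_norm_neq0[[i j] /= E]] := eqVneq `|v| 0.
  by rewrite -ofreal0 ofreal_le.
by rewrite [leLHS]E (ord1 i) normE ofreal_le h.
Qed.

End NrmC.

(** * Derivatives as first-order expansions, over the reals and over the complex numbers *)

Section DeriveNear.
Variables (K : numFieldType) (W : normedModType K).

(** Multiplying the difference quotient by [h] gives a condition that holds trivially at [h = 0],
    hence a statement on full neighbourhoods that serves real and complex differentiation alike. *)
Lemma is_derive1P (g : K -> W) (z : K) (d : W) :
  is_derive z 1 g d <->
  forall e : K, 0 < e -> \forall h \near (0 : K), `|g (z + h) - g z - h *: d| <= e * `|h|.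
Proof.
split.
  move=> dg e e0.
  have /cvgrPdist_le /(_ _ e0) : h^-1 *: (g (h *: 1 + z) - g z) @[h --> 0^'] --> d.
    by have := @ex_derive _ _ _ _ _ _ _ dg; rewrite -[in X in _ -> X](@derive_val _ _ _ _ _ _ _ dg).
  rewrite near_withinE => H; apply: filterS H => h H.
  have [->|h0] := eqVneq h 0; first by rewrite addr0 subrr sub0r scale0r oppr0 !normr0 mulr0.
  have {}H : `|d - h^-1 *: (g (h *: 1 + z) - g z)| <= e by exact: H.
  rewrite -normrN opprB.
  have -> : h *: d - (g (z + h) - g z) = h *: (d - h^-1 *: (g (h *: 1 + z) - g z)).
    by rewrite scalerBr scalerA divff// scale1r [h *: 1]mulr1 (addrC h).
  by rewrite normrZ mulrC ler_wpM2r.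
move=> H.
have C : h^-1 *: (g (h *: 1 + z) - g z) @[h --> 0^'] --> d.
  apply/cvgrPdist_le => e e0; rewrite near_withinE.
  apply: filterS (H e e0) => h Hh h0.
  have hn : 0 < `|h| by rewrite normr_gt0.
  rewrite -(ler_pM2l hn) -normrZ scalerBr scalerA divff// scale1r [h *: 1]mulr1 (addrC h).
  by rewrite -normrN opprB mulrC.
split; first by apply/cvg_ex; exists d.
exact/cvg_lim.
Qed.
End DeriveNear.

Section RealDerive.
Variable R : realType.

Lemma rderP (g : R -> R) (t d : R) :
  is_derive t 1 g d <->
  forall e : R, 0 < e -> exists2 k : R, 0 < k &
    forall h, `|h| < k -> `|g (t + h) - g t - h * d| <= e * `|h|.
Proof.
rewrite is_derive1P; split=> H e e0; have {}H := H e e0.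
  have [k /= k0 kH] := (nbhs_ballP _ _).1 H.
  exists k => // h hk; apply: kH; rewrite /ball /= sub0r normrN //.
have [k k0 kH] := H; apply/nbhs_ballP; exists k => //= h.
by rewrite /ball /= sub0r normrN; exact: kH.
Qed.

Lemma cderP (W : normedModType (cplx R)) (g : cplx R -> W) (z : cplx R) (d : W) :
  is_derive z 1 g d <->
  forall e : R, 0 < e -> exists2 k : R, 0 < k &
    forall h, nrm h < k -> nrm (g (z + h) - g z - h *: d) <= e * nrm h.
Proof.
rewrite is_derive1P; split.
  move=> H e e0.
  have /nbhs_nrmP [k k0 kH] := H (ofreal e) (etrans (@ofreal_lt R 0 e) e0).
  exists k => // h hk; rewrite -ofreal_le ofrealM -!normE; apply: kH.
  by rewrite subr0.
move=> H e e0; have ee := ge0_ofreal (ltW e0).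
have [|k k0 kH] := H (re e); first by rewrite -ofreal_lt -ee.
apply/nbhs_nrmP; exists k => // h; rewrite subr0 => hk.
by rewrite ee !normE -ofrealM ofreal_le kH.
Qed.

Lemma continuous_nrmP (V W : normedModType (cplx R)) (g : V -> W) x :
  {for x, continuous g} <->
  forall e : R, 0 < e -> exists2 k : R, 0 < k &
    forall y, nrm (y - x) < k -> nrm (g y - g x) < e.
Proof.
split=> [c e e0|H A /nbhs_nrmP[e e0 eA]].
  have /nbhs_nrmP[k k0 kH] : nbhs x (g @^-1` [set u | nrm (u - g x) < e]).
    by apply: c; apply/nbhs_nrmP; exists e.
  by exists k.
by have [k k0 kH] := H e e0; apply/nbhs_nrmP; exists k => // y /kH /eA.
Qed.

Lemma continuous_nrm_absP (V : normedModType (cplx R)) (g : V -> R) x :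
  {for x, continuous g} <->
  forall e : R, 0 < e -> exists2 k : R, 0 < k &
    forall y, nrm (y - x) < k -> `|g y - g x| < e.
Proof.
split=> [c e e0|H A /nbhs_ballP[e /= e0 eA]].
  have /nbhs_nrmP[k k0 kH] : nbhs x (g @^-1` [set u | `|u - g x| < e]).
    by apply: c; apply/nbhs_ballP; exists e => //= y; rewrite /ball /= distrC.
  by exists k.
have [k k0 kH] := H e e0; apply/nbhs_nrmP; exists k => // y /kH h; apply: eA.
by rewrite /ball /= distrC.
Qed.

Lemma continuous_abs_nrmP (W : normedModType (cplx R)) (g : R -> W) x :
  {for x, continuous g} <->
  forall e : R, 0 < e -> exists2 k : R, 0 < k &
    forall y, `|y - x| < k -> nrm (g y - g x) < e.
Proof.
split=> [c e e0|H A /nbhs_nrmP[e e0 eA]].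
  have /nbhs_ballP[k /= k0 kH] : nbhs x (g @^-1` [set u | nrm (u - g x) < e]).
    by apply: c; apply/nbhs_nrmP; exists e.
  by exists k => // y yx; apply: kH; rewrite /ball /= distrC.
have [k k0 kH] := H e e0; apply/nbhs_ballP; exists k => //= y.
by rewrite /ball /= distrC => /kH /eA.
Qed.

Lemma continuous_absP (g : R -> R) x :
  {for x, continuous g} <->
  forall e : R, 0 < e -> exists2 k : R, 0 < k &
    forall y, `|y - x| < k -> `|g y - g x| < e.
Proof.
split=> [c e e0|H A /nbhs_ballP[e /= e0 eA]].
  have /nbhs_ballP[k /= k0 kH] : nbhs x (g @^-1` [set u | `|u - g x| < e]).
    by apply: c; apply/nbhs_ballP; exists e => //= y; rewrite /ball /= distrC.
  by exists k => // y yx; apply: kH; rewrite /ball /= distrC.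
have [k k0 kH] := H e e0; apply/nbhs_ballP; exists k => //= y.
rewrite /ball /= distrC => /kH h; apply: eA; by rewrite /ball /= distrC.
Qed.

Lemma rder_continuous (g : R -> R) (t d : R) :
  is_derive t 1 g d -> {for t, continuous g}.
Proof. by move=> [dg _]; apply/differentiable_continuous/derivable1_diffP. Qed.

Lemma cder_continuous (W : normedModType (cplx R)) (g : cplx R -> W) (z : cplx R) (d : W) :
  is_derive z 1 g d -> {for z, continuous g}.
Proof. by move=> [dg _]; apply/differentiable_continuous/derivable1_diffP. Qed.

Lemma mvt_bound (g d : R -> R) (a b M : R) : a <= b ->
  (forall t, a <= t <= b -> is_derive t 1 g (d t)) ->
  (forall t, a <= t <= b -> `|d t| <= M) -> `|g b - g a| <= M * (b - a).
Proof.
move=> ab dg dM.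
have H1 c : c \in `]a, b[ -> is_derive c 1 g (d c).
  by rewrite in_itv /= => /andP[ac cb]; apply: dg; rewrite (ltW ac) ltW.
have H2 : {within `[a, b], continuous g}.
  by apply: derivable_within_continuous => t /[!in_itv] /= h; have [] := dg t h.
have [c cI ->] := MVT_segment ab H1 H2.
rewrite normrM (ger0_norm (x := b - a)) ?subr_ge0// ler_wpM2r ?subr_ge0//.
by apply: dM; move: cI; rewrite in_itv.
Qed.

Lemma mvt_const (g : R -> R) (a b : R) : a <= b ->
  (forall t, a <= t <= b -> is_derive t 1 g 0) -> g b = g a.
Proof.
move=> ab h; apply/eqP; rewrite -subr_eq0 -normr_le0.
by rewrite (le_trans (mvt_bound (M := 0) ab h _)) ?mul0r// => *; rewrite normr0.
Qed.

Lemma primitive_ex (f : R -> R) (a b : R) : a < b -> continuous f ->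
  exists F : R -> R, forall x, a <= x <= b -> is_derive x 1 F (f x).
Proof.
(* Integrating from [a - 1], inside an interval that ends at [b + 1], makes [a] and [b] interior
   points, where the derivative is two-sided. *)
move=> ab cf; pose F x := (\int[@lebesgue_measure R]_(t in [set` `[a - 1, x]]) f t)%R.
exists F => x /andP[ax xb].
have xb1 : x < b + 1 by lra.
have ax1 : a - 1 < x by lra.
have [|d1 d2] := @continuous_FTC1_closed R f (a - 1) x (b + 1) xb1 _ ax1 (cf x).
  apply: continuous_compact_integrable; first exact: segment_compact.
  exact: continuous_subspaceT.
by rewrite derive1E in d2; exact: DeriveDef d1 d2.
Qed.
End RealDerive.

(** * Goursat's theorem for closed forms on a rectangle *)

Section Goursat.
Variable R : realType.

(** With [F] a primitive of [P] in the first variable and [G] one of [Q] in the second, this is the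
    integral of [P dx + Q dy] counterclockwise along the boundary of the rectangle, written without
    integrals. *)
Definition rect_circulation (F G : R -> R -> R) (a b c d : R) : R :=
  (F b c - F a c) + (G b d - G b c) - (F b d - F a d) - (G a d - G a c).

Definition in_rect (x1 x2 y1 y2 x y : R) : Prop := x1 <= x <= x2 /\ y1 <= y <= y2.

(* [P dx + Q dy] has a first-order expansion at (x0, y0) with dP/dy = dQ/dx. *)
Definition closed_form_at (P Q : R -> R -> R) (x1 x2 y1 y2 x0 y0 : R) : Prop :=
  exists a b c : R, forall e : R, 0 < e -> exists2 k : R, 0 < k &
    forall x y, in_rect x1 x2 y1 y2 x y -> `|x - x0| < k -> `|y - y0| < k ->
    `|P x y - P x0 y0 - a * (x - x0) - b * (y - y0)| <= e * (`|x - x0| + `|y - y0|) /\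
    `|Q x y - Q x0 y0 - b * (x - x0) - c * (y - y0)| <= e * (`|x - x0| + `|y - y0|).

Lemma primitive_affine (F p : R -> R) (a b x0 p0 q e : R) : a <= b ->
  (forall x, a <= x <= b -> is_derive x 1 F (p x)) ->
  (forall x, a <= x <= b -> `|p x - p0 - q * (x - x0)| <= e) ->
  `|F b - F a - (p0 * (b - a) + q / 2 * ((b - x0) ^+ 2 - (a - x0) ^+ 2))| <= e * (b - a).
Proof.
move=> ab dF pe.
pose H x := F x - (p0 * x + q / 2 * (x - x0) ^+ 2).
have := @mvt_bound R H (fun x => p x - p0 - q * (x - x0)) a b e ab _ pe.
have -> : H b - H a = F b - F a - (p0 * (b - a) + q / 2 * ((b - x0) ^+ 2 - (a - x0) ^+ 2)).
  by rewrite /H; ring.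
apply=> t /dF dt; rewrite /H.
by apply: is_derive_eq; rewrite /GRing.scale /=; field.
Qed.

(** The affine parts of [P] and [Q] share the cross coefficient [q], so their circulation vanishes
    exactly; what remains are the errors on the four sides, at most [e] times their lengths. *)
Lemma rect_circulation_local (P Q F G : R -> R -> R) (a b c d x0 y0 p q r p0 q0 e : R) :
  a <= b -> c <= d ->
  (forall x y, in_rect a b c d x y -> is_derive x 1 (F^~ y) (P x y)) ->
  (forall x y, in_rect a b c d x y -> is_derive y 1 (G x) (Q x y)) ->
  (forall x y, in_rect a b c d x y ->
     `|P x y - p0 - p * (x - x0) - q * (y - y0)| <= e /\
     `|Q x y - q0 - q * (x - x0) - r * (y - y0)| <= e) ->
  `|rect_circulation F G a b c d| <= 2 * e * ((b - a) + (d - c)).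
Proof.
move=> ab cd dF dG H.
have FF y : c <= y <= d -> `|F b y - F a y - ((p0 + q * (y - y0)) * (b - a)
    + p / 2 * ((b - x0) ^+ 2 - (a - x0) ^+ 2))| <= e * (b - a).
  move=> yI; apply: (primitive_affine (F := F^~ y) (p := P^~ y)) => // x xI; first exact: dF.
  have [h _] := H x y (conj xI yI).
  by rewrite (_ : _ - _ = P x y - p0 - p * (x - x0) - q * (y - y0))//; ring.
have GG x : a <= x <= b -> `|G x d - G x c - ((q0 + q * (x - x0)) * (d - c)
    + r / 2 * ((d - y0) ^+ 2 - (c - y0) ^+ 2))| <= e * (d - c).
  move=> xI; apply: (primitive_affine (F := G x) (p := Q x)) => // y yI; first exact: dG.
  have [_ h] := H x y (conj xI yI).
  by rewrite (_ : _ - _ = Q x y - q0 - q * (x - x0) - r * (y - y0))//; ring.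
have := FF c; have := FF d; have := GG a; have := GG b.
rewrite !lexx ab cd /= => /(_ isT) + /(_ isT) + /(_ isT) + /(_ isT).
rewrite /rect_circulation !ler_norml => /andP[? ?] /andP[? ?] /andP[? ?] /andP[? ?].
by apply/andP; split; nra.
Qed.

Lemma half_pow_small (T k : R) : 0 <= T -> 0 < k -> exists j, T / 2 ^+ j < k.
Proof.
move=> T0 k0; exists (Num.bound (T / k)).
have : T / k < (Num.bound (T / k))%:R by apply: archi_boundP; rewrite divr_ge0// ltW.
rewrite ltr_pdivrMr// => h; rewrite ltr_pdivrMr ?exprn_gt0//.
rewrite (lt_le_trans h)// mulrC ler_pM2l// -natrX ler_nat ltnW// ltn_expl//.
Qed.

Section Bisection.
Variables (P Q F G : R -> R -> R) (x1 x2 y1 y2 : R).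
Hypotheses (x12 : x1 <= x2) (y12 : y1 <= y2).
Hypothesis dF : forall x y, in_rect x1 x2 y1 y2 x y -> is_derive x 1 (F^~ y) (P x y).
Hypothesis dG : forall x y, in_rect x1 x2 y1 y2 x y -> is_derive y 1 (G x) (Q x y).
Hypothesis PQ : forall x y, in_rect x1 x2 y1 y2 x y -> closed_form_at P Q x1 x2 y1 y2 x y.

Let L k := (x2 - x1) / 2 ^+ k.
Let M k := (y2 - y1) / 2 ^+ k.
Let W k (s : R * R) := rect_circulation F G s.1 (s.1 + L k) s.2 (s.2 + M k).
Let nested k (s t : R * R) :=
  [/\ s.1 <= t.1, t.1 + L k.+1 <= s.1 + L k, s.2 <= t.2, t.2 + M k.+1 <= s.2 + M k
    & `|W k s| <= 4 * `|W k.+1 t|].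

Let L_ge0 k : 0 <= L k. Proof. by rewrite divr_ge0 ?exprn_ge0 ?subr_ge0. Qed.
Let M_ge0 k : 0 <= M k. Proof. by rewrite divr_ge0 ?exprn_ge0 ?subr_ge0. Qed.
Let LS k : L k = 2 * L k.+1. Proof. by rewrite /L exprS; field; rewrite expf_neq0. Qed.
Let MS k : M k = 2 * M k.+1. Proof. by rewrite /M exprS; field; rewrite expf_neq0. Qed.

(** The circulation is the sum of those of the four quarters, so one quarter carries at least a
    fourth of it in absolute value. *)
Let bisect k s : exists t, nested k s t.
Proof.
have l0 := L_ge0 k.+1; have m0 := M_ge0 k.+1.
case: s => a c; set l := L k.+1 in l0; set m := M k.+1 in m0.
have E : W k (a, c) = W k.+1 (a, c) + W k.+1 (a + l, c) + W k.+1 (a, c + m) + W k.+1 (a + l, c + m).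
  rewrite /W /= LS MS -/l -/m /rect_circulation.
  have -> : a + 2 * l = a + l + l by ring.
  have -> : c + 2 * m = c + m + m by ring.
  by ring.
have [h1|h1] := leP `|W k (a, c)| (4 * `|W k.+1 (a, c)|).
  by exists (a, c); split => //=; rewrite ?(LS k) ?(MS k) -/l -/m; lra.
have [h2|h2] := leP `|W k (a, c)| (4 * `|W k.+1 (a + l, c)|).
  by exists (a + l, c); split => //=; rewrite ?(LS k) ?(MS k) -/l -/m; lra.
have [h3|h3] := leP `|W k (a, c)| (4 * `|W k.+1 (a, c + m)|).
  by exists (a, c + m); split => //=; rewrite ?(LS k) ?(MS k) -/l -/m; lra.
have [h4|h4] := leP `|W k (a, c)| (4 * `|W k.+1 (a + l, c + m)|).
  by exists (a + l, c + m); split => //=; rewrite ?(LS k) ?(MS k) -/l -/m; lra.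
exfalso; move: h1 h2 h3 h4; rewrite E; set u1 := W _ _; set u2 := W _ _; set u3 := W _ _.
set u4 := W _ _; have := ler_normD (u1 + u2 + u3) u4.
by have := ler_normD (u1 + u2) u3; have := ler_normD u1 u2; lra.
Qed.

Lemma nested_limit (u l : nat -> R) : (forall k, u k <= u k.+1) ->
  (forall k, u k.+1 + l k.+1 <= u k + l k) -> (forall k, 0 <= l k) ->
  exists x, forall k, u k <= x <= u k + l k.
Proof.
move=> u1 u2 l0.
have U k j : u k <= u (k + j)%N.
  by elim: j => [|j IH]; rewrite ?addn0// addnS (le_trans IH).
have V k j : u (k + j)%N + l (k + j)%N <= u k + l k.
  by elim: j => [|j IH]; rewrite ?addn0// addnS (le_trans _ IH).
have B i k : u i <= u k + l k.
  have [ik|/ltnW ki] := leqP i k.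
    by rewrite -(subnKC ik) (le_trans (U i (k - i)%N))// lerDl.
  rewrite -(subnKC ki) (le_trans _ (V k (i - k)%N))// lerDl //.
exists (sup (range u)) => k; apply/andP; split.
  apply: ub_le_sup; last by exists k.
  by exists (u 0%N + l 0%N) => _ [i _ <-].
by apply: ge_sup; [exists (u 0%N), 0%N | move=> _ [i _ <-]].
Qed.

(** The [j]-th nested rectangle keeps at least [4^-j] of the circulation, while the affine
    approximation at the common point of the rectangles bounds it by a constant times [e 4^-j], for
    any [e] given in advance. *)
Theorem goursat : rect_circulation F G x1 x2 y1 y2 = 0.
Proof.
have [f Hf] := choice (fun ks : nat * (R * R) => bisect ks.1 ks.2).
have [s [s0 N]] : exists s : nat -> R * R, s 0%N = (x1, y1) /\ forall k, nested k (s k) (s k.+1).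
  pose s := fix s k := if k is j.+1 then f (j, s j) else (x1, y1).
  by exists s; split => // k; exact: (Hf (k, s k)).
have [x0 Hx] : exists x, forall k, (s k).1 <= x <= (s k).1 + L k.
  by apply: nested_limit => // k; have [] := N k.
have [y0 Hy] : exists y, forall k, (s k).2 <= y <= (s k).2 + M k.
  by apply: nested_limit => // k; have [] := N k.
have L0 : x1 + L 0 = x2 by rewrite /L expr0 divr1; ring.
have M0 : y1 + M 0 = y2 by rewrite /M expr0 divr1; ring.
have B k : [/\ x1 <= (s k).1, (s k).1 + L k <= x2, y1 <= (s k).2 & (s k).2 + M k <= y2].
  elim: k => [|k [b1 b2 b3 b4]]; first by rewrite s0 /= L0 M0.
  have [h1 h2 h3 h4 _] := N k.
  by split; [exact: le_trans b1 h1|exact: le_trans h2 b2|exact: le_trans b3 h3|exact: le_trans h4 b4].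
have I0 : in_rect x1 x2 y1 y2 x0 y0.
  by have := Hx 0%N; have := Hy 0%N; rewrite /in_rect s0 /= L0 M0.
have WW k : `|W 0 (x1, y1)| <= 4 ^+ k * `|W k (s k)|.
  elim: k => [|k IH]; first by rewrite s0 expr0 mul1r.
  have [_ _ _ _ h] := N k; by rewrite (le_trans IH)// exprS (mulrC 4) -mulrA ler_wpM2l ?exprn_ge0.
apply/eqP; rewrite -normr_eq0 -[_ == 0]negbK; apply/negP => w0.
have w_gt0 : 0 < `|W 0 (x1, y1)|.
  by rewrite /W /= L0 M0 lt_neqAle normr_ge0 eq_sym w0.
set w := `|W 0 (x1, y1)| in w_gt0 WW.
set T := (x2 - x1) + (y2 - y1).
have T0 : 0 <= T by rewrite addr_ge0 ?subr_ge0.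
have [p [q [r H]]] := PQ I0.
(* With this [e] the final bound [2 e T^2] is smaller than [w]. *)
have e0 : 0 < w / (4 * T ^+ 2 + 1).
  by rewrite divr_gt0// ltr_wpDl// mulr_ge0 ?sqr_ge0.
have [k k0 Hk] := H _ e0.
have [j jk] : exists j, T / 2 ^+ j < k.
  exact: half_pow_small.
have [Bx1 Bx2 By1 By2] := B j.
have inB x y : in_rect (s j).1 ((s j).1 + L j) (s j).2 ((s j).2 + M j) x y -> in_rect x1 x2 y1 y2 x y.
  move=> [/andP[a1 a2] /andP[a3 a4]]; split; apply/andP; split.
  - exact: le_trans Bx1 a1.
  - exact: le_trans a2 Bx2.
  - exact: le_trans By1 a3.
  - exact: le_trans a4 By2.
have LM : L j + M j = T / 2 ^+ j by rewrite /L /M -mulrDl.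
have Hj : `|W j (s j)| <= 2 * (w / (4 * T ^+ 2 + 1) * (T / 2 ^+ j))
     * (((s j).1 + L j - (s j).1) + ((s j).2 + M j - (s j).2)).
  apply: (rect_circulation_local (P := P) (Q := Q) (x0 := x0) (y0 := y0) (p := p) (q := q) (r := r)
     (p0 := P x0 y0) (q0 := Q x0 y0)); rewrite ?lerDl //.
  - by move=> x y /inB; exact: dF.
  - by move=> x y /inB; exact: dG.
  move=> x y xyI; have xyB := inB _ _ xyI; have [xI yI] := xyI; have := Hx j; have := Hy j => yJ xJ.
  have ax : `|x - x0| <= L j by rewrite ler_norml; lra.
  have ay : `|y - y0| <= M j by rewrite ler_norml; lra.
  have [|||h1 h2] := Hk x y => //.
  - by apply: le_lt_trans jk; rewrite -LM (le_trans ax)// lerDl.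
  - by apply: le_lt_trans jk; rewrite -LM (le_trans ay)// lerDr.
  split; [apply: (le_trans h1)|apply: (le_trans h2)]; by rewrite ler_pM2l// -LM lerD.
have := WW j; suff : 4 ^+ j * `|W j (s j)| < w by lra.
have LM' : ((s j).1 + L j - (s j).1) + ((s j).2 + M j - (s j).2) = T / 2 ^+ j.
  by rewrite -LM; ring.
rewrite LM' in Hj.
have p4 : 0 < 4 ^+ j :> R by rewrite exprn_gt0.
have : 4 ^+ j * `|W j (s j)| <= 2 * (w / (4 * T ^+ 2 + 1)) * T ^+ 2.
  rewrite (le_trans (ler_wpM2l (ltW p4) Hj))// le_eqVlt; apply/orP; left; apply/eqP.
  rewrite (_ : 4 ^+ j = 2 ^+ j * 2 ^+ j :> R); last by rewrite -exprMn -natrM.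
  field; rewrite expf_neq0//= lt0r_neq0// ltr_wpDl// mulr_ge0 ?sqr_ge0//.
move=> h; apply: (le_lt_trans h).
have T20 := sqr_ge0 T.
have A0 : 0 < 4 * T ^+ 2 + 1 by rewrite ltr_wpDl ?mulr_ge0.
rewrite (_ : _ * _ = 2 * w * T ^+ 2 / (4 * T ^+ 2 + 1)); last by ring.
by rewrite ltr_pdivrMr//; nra.
Qed.
End Bisection.
End Goursat.

(** * The complex exponential in polar form *)

Section PolarExp.
Variable R : realType.
Implicit Types (s t : R).

(** This is [exp (s + i t)]. In the coordinates [(s, t)] a circle about 0 is a segment and an
    annulus is a rectangle. *)
Definition pexp s t : cplx R := (expR s * cos t) +i* (expR s * sin t).

Lemma re_pexp s t : re (pexp s t) = expR s * cos t. Proof. by []. Qed.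
Lemma im_pexp s t : im (pexp s t) = expR s * sin t. Proof. by []. Qed.

Lemma nrm_pexp s t : nrm (pexp s t) = expR s.
Proof.
apply/eqP; rewrite -(eqrXn2 (n := 2)) ?nrm_ge0 ?expR_ge0// sqr_nrm re_pexp im_pexp.
by rewrite !exprMn -mulrDr cos2Dsin2 mulr1.
Qed.

Lemma pexpD s t s' t' : pexp (s + s') (t + t') = pexp s t * pexp s' t'.
Proof.
by apply: cplx_eq; rewrite ?reM ?imM !re_pexp !im_pexp expRD ?cosD ?sinD; ring.
Qed.

Lemma pexp_2pi s : pexp s (pi *+ 2) = pexp s 0.
Proof. by apply: cplx_eq; rewrite ?re_pexp ?im_pexp ?cos2pi ?sin2pi ?cos0 ?sin0. Qed.

Lemma pexp_near0 (e : R) : 0 < e -> exists2 k : R, 0 < k & forall h l, `|h| < k -> `|l| < k ->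
  nrm (pexp h l - 1 - (h +i* l : cplx R)) <= e * (`|h| + `|l|).
Proof.
move=> e0; have e4 : 0 < Num.min (e / 8) 1 by rewrite lt_min ltr01 divr_gt0.
set m := Num.min (e / 8) 1 in e4.
have m1 : m <= 1 by rewrite ge_min lexx orbT.
have me : m <= e / 8 by rewrite ge_min lexx.
clearbody m.
have [k1 k10 H1] := (rderP (@expR R) 0 (expR 0)).1 (is_derive_expR 0) m e4.
have [k2 k20 H2] := (rderP (@cos R) 0 (- sin 0)).1 (is_derive_cos 0) m e4.
have [k3 k30 H3] := (rderP (@sin R) 0 (cos 0)).1 (is_derive_sin 0) m e4.
exists (Num.min (Num.min k1 m) (Num.min k2 k3)); first by rewrite !lt_min k10 k20 k30 e4.
move=> h l; rewrite !lt_min => /andP[/andP[hk1 hm] _] /andP[_ /andP[lk2 lk3]].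
have := H1 h hk1; have := H2 l lk2; have := H3 l lk3.
rewrite !add0r expR0 cos0 sin0 oppr0 !mulr0 !mulr1 ?subr0 ?addr0 => S C E.
rewrite (le_trans (nrm_le_reim _))// !reB !imB re_pexp im_pexp re1 im1 subr0.
rewrite [re (_ +i* _)]/= [im (_ +i* _)]/=.
have eb : `|expR h| <= 3.
  rewrite (_ : expR h = (expR h - 1 - h) + h + 1); last by ring.
  rewrite (le_trans (ler_normD _ _))// normr1 (le_trans (y := m * `|h| + `|h| + 1))//.
    by rewrite lerD2r (le_trans (ler_normD _ _))// lerD2r.
  by have := normr_ge0 h; nra.
have A : `|expR h * cos l - 1 - h| <= m * `|h| + 3 * (m * `|l|).
  rewrite (_ : _ - _ - _ = (expR h - 1 - h) + expR h * (cos l - 1)); last by ring.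
  rewrite (le_trans (ler_normD _ _))// lerD// normrM ler_pM//.
have B : `|expR h * sin l - l| <= 3 * (m * `|l|) + 2 * m * `|l|.
  rewrite (_ : _ - _ = expR h * (sin l - l) + (expR h - 1) * l); last by ring.
  rewrite (le_trans (ler_normD _ _))//; apply: lerD; rewrite normrM.
    by apply: ler_pM.
  apply: ler_pM => //.
  rewrite (_ : expR h - 1 = (expR h - 1 - h) + h); last by ring.
  by rewrite (le_trans (ler_normD _ _))//; have := normr_ge0 h; nra.
rewrite (le_trans (lerD A B))//.
by have := normr_ge0 h; have := normr_ge0 l; nra.
Qed.

(** Multiplicativity carries the expansion at 0 to every point. *)
Lemma pexp_diff s0 t0 (e : R) : 0 < e -> exists2 k : R, 0 < k & forall s t,
  `|s - s0| < k -> `|t - t0| < k ->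
  nrm (pexp s t - pexp s0 t0 - pexp s0 t0 * ((s - s0) +i* (t - t0) : cplx R))
    <= e * (`|s - s0| + `|t - t0|).
Proof.
move=> e0; have E0 := expR_gt0 s0.
have [k k0 H] := pexp_near0 (divr_gt0 e0 E0).
exists k => // s t hs ht; have {}H := H _ _ hs ht.
have -> : pexp s t = pexp s0 t0 * pexp (s - s0) (t - t0).
  by rewrite -pexpD; congr pexp; ring.
rewrite -[X in _ - X - _]mulr1 -mulrBr -mulrBr nrmM nrm_pexp.
by rewrite -ler_pdivlMl// mulrA (mulrC _ e).
Qed.

Lemma pexp_continuous s0 t0 (e : R) : 0 < e -> exists2 k : R, 0 < k & forall s t,
  `|s - s0| < k -> `|t - t0| < k -> nrm (pexp s t - pexp s0 t0) < e.
Proof.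
move=> e0; have [k k0 H] := pexp_diff s0 t0 (@ltr01 R).
pose A := 1 + expR s0; have A0 : 0 < A by rewrite addr_gt0 ?expR_gt0.
exists (Num.min k (e / (4 * A))); first by rewrite lt_min k0 divr_gt0// mulr_gt0.
move=> s t; rewrite !lt_min => /andP[sk se] /andP[tk te].
rewrite (le_lt_trans (y := A * (`|s - s0| + `|t - t0|)))//; last first.
  move: se te; rewrite !ltr_pdivlMr ?mulr_gt0//; nra.
rewrite -[X in nrm X](subrK (pexp s0 t0 * ((s - s0) +i* (t - t0) : cplx R))).
rewrite (le_trans (nrmD _ _))// mulrDl lerD ?H// nrmM nrm_pexp ler_wpM2l ?expR_ge0//.
exact: nrm_le_reim.
Qed.
End PolarExp.

(** * The minimum principle for the real part of a holomorphic function *)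

Section MinPrinciple.
Variable R : realType.

Lemma clamp_bounds (a b x : R) : a <= b -> a <= Num.min (Num.max x a) b <= b.
Proof. by move=> ab; rewrite ge_min lexx orbT andbT le_min ab le_max lexx orbT. Qed.

Lemma clamp_id (a b x : R) : a <= x <= b -> Num.min (Num.max x a) b = x.
Proof. by move=> /andP[ax xb]; rewrite max_l// min_l. Qed.

Lemma primitive_ex_within (u : R -> R) (a b : R) : a < b ->
  (forall t, a <= t <= b -> {for t, continuous u}) ->
  exists F : R -> R, forall x, a <= x <= b -> is_derive x 1 F (u x).
Proof.
move=> ab cu; pose c x := Num.min (Num.max x a) b.
have [|F HF] := @primitive_ex R (u \o c) a b ab.
  move=> x; apply: continuous_comp; last exact/cu/clamp_bounds/ltW.
  by apply: continuous_min; [apply: continuous_max|]; try exact: cvg_id; exact: cvg_cst.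
by exists F => x xI; have := HF x xI; rewrite /= /c clamp_id.
Qed.

Lemma deriv_ge (g d : R -> R) (a b M : R) : a <= b ->
  (forall t, a <= t <= b -> is_derive t 1 g (d t)) ->
  (forall t, a <= t <= b -> M <= d t) -> M * (b - a) <= g b - g a.
Proof.
move=> ab dg dM.
have H1 c : c \in `]a, b[ -> is_derive c 1 g (d c).
  by rewrite in_itv /= => /andP[ac cb]; apply: dg; rewrite (ltW ac) ltW.
have H2 : {within `[a, b], continuous g}.
  by apply: derivable_within_continuous => t /[!in_itv] /= h; have [] := dg t h.
have [c + ->] := MVT_segment ab H1 H2; rewrite in_itv /= => cI.
by rewrite ler_wpM2r ?subr_ge0// dM.
Qed.

(* Goursat's theorem for U dt + V ds in the coordinates z = exp (s + it): the
   mean of Re G over a circle does not depend on the radius. *)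
Theorem min_principle (G : cplx R -> cplx R) (r : R) : 0 < r ->
  (forall z : cplx R, z != 0 -> nrm z <= r -> exists d : cplx R, is_derive z 1 G d) ->
  {for (0 : cplx R), continuous G} ->
  (forall z : cplx R, nrm z = r -> 0 <= re (G z)) -> 0 <= re (G 0).
Proof.
move=> r0 dG cG Gr; rewrite leNgt; apply/negP => G0.
pose e := - re (G 0) / 2; have e0 : 0 < e by rewrite /e; lra.
have [k k0 Hk] := (continuous_nrmP _ _).1 cG e e0.
(* The inner circle, of radius [exp x1], is smaller than the outer one and so small that [Re G]
   stays below [- e] on it. *)
pose x2 := ln r; pose x1 := Num.min (ln (k / 2)) (ln (r / 2)).
have k20 : 0 < k / 2 by lra.
have r20 : 0 < r / 2 by lra.
have ex2 : expR x2 = r by rewrite lnK.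
have ex1 : expR x1 < k.
  by rewrite (@le_lt_trans _ _ (k / 2)) //; [rewrite -(lnK k20) ler_expR ge_min lexx|lra].
have x12 : x1 < x2.
  by rewrite (@le_lt_trans _ _ (ln (r / 2)))// ?ge_min ?lexx ?orbT// ltr_ln ?posrE//; lra.
have pi0 : 0 < pi *+ 2 :> R by rewrite pmulrn_lgt0 ?pi_gt0.
pose U s t := re (G (pexp s t)); pose V s t := im (G (pexp s t)).
have pn s t : pexp s t != 0 :> cplx R by rewrite -nrm_gt0 nrm_pexp expR_gt0.
have pr s t : s <= x2 -> nrm (pexp s t) <= r by move=> h; rewrite nrm_pexp -ex2 ler_expR.
have GC s0 t0 : s0 <= x2 -> forall e' : R, 0 < e' -> exists2 l : R, 0 < l & forall s t,
   `|s - s0| < l -> `|t - t0| < l -> nrm (G (pexp s t) - G (pexp s0 t0)) < e'.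
  move=> h e' e'0; have [d /cder_continuous/continuous_nrmP Hd] := dG _ (pn s0 t0) (pr _ t0 h).
  have [l l0 Hl] := Hd _ e'0; have [l' l'0 Hl'] := pexp_continuous s0 t0 l0.
  by exists l' => // s t hs ht; exact/Hl/Hl'.
have PQ x y : in_rect x1 x2 0 (pi *+ 2) x y -> closed_form_at V U x1 x2 0 (pi *+ 2) x y.
  move=> [/andP[_ xx2] _]; have [d Hd] := dG _ (pn x y) (pr _ y xx2).
  (* [D] is the derivative of [G (pexp s t)] with respect to [s + i t]; the Cauchy-Riemann equations
     make [re D] the common cross coefficient of [V ds + U dt]. *)
  pose D := pexp x y * d; exists (im D), (re D), (- im D) => e' e'0.
  pose N := 1 + nrm d; have N0 : 0 < N by rewrite /N; have := nrm_ge0 d; lra.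
  pose X := 1 + expR x; have X0 : 0 < X by rewrite /X addr_gt0 ?expR_gt0.
  have e1 : 0 < e' / (2 * X) by rewrite divr_gt0// mulr_gt0.
  have e2 : 0 < e' / (2 * N) by rewrite divr_gt0// mulr_gt0.
  have [l l0 Hl] := (cderP _ _ _).1 Hd _ e1.
  have [l1 l10 Hl1] := pexp_continuous x y l0.
  have [l2 l20 Hl2] := pexp_diff x y (ltr01 : 0 < 1 :> R).
  have [l3 l30 Hl3] := pexp_diff x y e2.
  exists (Num.min l1 (Num.min l2 l3)); first by rewrite !lt_min l10 l20 l30.
  move=> s t _; rewrite !lt_min => /andP[s1 /andP[s2 s3]] /andP[t1 /andP[t2 t3]].
  set h := pexp s t - pexp x y.
  set w := ((s - x) +i* (t - y) : cplx R).
  have T0 : 0 <= `|s - x| + `|t - y| by rewrite addr_ge0.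
  have hX : nrm h <= X * (`|s - x| + `|t - y|).
    rewrite -[X in nrm X](subrK (pexp x y * w)) (le_trans (nrmD _ _))// mulrDl lerD ?Hl2//.
    by rewrite nrmM nrm_pexp ler_wpM2l ?expR_ge0// nrm_le_reim.
  have main : nrm (G (pexp s t) - G (pexp x y) - D * w) <= e' * (`|s - x| + `|t - y|).
    have -> : G (pexp s t) - G (pexp x y) - D * w =
        (G (pexp x y + h) - G (pexp x y) - h *: d) + d * (h - pexp x y * w).
      have -> : pexp x y + h = pexp s t by rewrite /h; ring.
      by rewrite /D /GRing.scale /=; ring.
    rewrite (le_trans (nrmD _ _))// nrmM.
    have A1 := Hl h (Hl1 _ _ s1 t1); have A2 := Hl3 _ _ s3 t3.
    rewrite -/h -/w in A2.
    have B1 : e' / (2 * X) * nrm h <= e' / 2 * (`|s - x| + `|t - y|).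
      rewrite (le_trans (ler_wpM2l (ltW e1) hX))// le_eqVlt; apply/orP; left; apply/eqP.
      by field; rewrite lt0r_neq0.
    have B2 : nrm d * nrm (h - pexp x y * w) <= e' / 2 * (`|s - x| + `|t - y|).
      rewrite (le_trans (ler_pM (nrm_ge0 _) (nrm_ge0 _) _ A2) (y := N * _))//.
        by rewrite /N lerDr.
      rewrite le_eqVlt; apply/orP; left; apply/eqP.
      by field; rewrite lt0r_neq0.
    by rewrite (le_trans (lerD A1 (lexx _)))// (le_trans (lerD B1 B2))// -mulrDl -splitr.
  split.
    rewrite (_ : _ - _ = im (G (pexp s t) - G (pexp x y) - D * w)).
      exact: le_trans (im_le_nrm _) main.
    by rewrite !imB imM /=; rewrite /V; ring.
  rewrite (_ : _ - _ = re (G (pexp s t) - G (pexp x y) - D * w)).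
    exact: le_trans (re_le_nrm _) main.
  by rewrite !reB reM /=; rewrite /U; ring.
have CV x y : x <= x2 -> {for x, continuous (V^~ y)}.
  move=> h; apply/continuous_absP => e' /(GC x y h)[l l0 Hl]; exists l => // s hs.
  by rewrite (le_lt_trans _ (Hl s y hs _)) ?subrr ?normr0// -imB im_le_nrm.
have CU x y : x <= x2 -> {for y, continuous (U x)}.
  move=> h; apply/continuous_absP => e' /(GC x y h)[l l0 Hl]; exists l => // t ht.
  by rewrite (le_lt_trans _ (Hl x t _ ht)) ?subrr ?normr0// -reB re_le_nrm.
have [F HF] := choice (fun y => primitive_ex_within x12
   (fun t (h : x1 <= t <= x2) => CV t y (proj2 (andP h)))).
have EH x : exists Hx : R -> R, x <= x2 -> forall y, 0 <= y <= pi *+ 2 -> is_derive y 1 Hx (U x y).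
  have [xx|xx] := leP x x2; last by exists (fun=> 0).
  by have [P HP] := primitive_ex_within pi0 (fun t _ => CU x t xx); exists P.
have [H HH] := choice EH.
have := @goursat R V U (fun x y => F y x) H x1 x2 0 (pi *+ 2) (ltW x12) (ltW pi0) _ _ PQ.
rewrite /rect_circulation.
(* The primitives [F 0] and [F (pi *+ 2)] were chosen independently, but by periodicity they have
   the same derivative: the sides [t = 0] and [t = 2 pi] cancel. *)
have -> : F (pi *+ 2) x2 - F (pi *+ 2) x1 = F 0 x2 - F 0 x1.
  have := @mvt_const R (fun x => F (pi *+ 2) x - F 0 x) x1 x2 (ltW x12) _.
  have D0 t : x1 <= t <= x2 -> is_derive t 1 (fun x => F (pi *+ 2) x - F 0 x) 0.
    move=> tI; have h1 := HF (pi *+ 2) t tI; have h2 := HF 0 t tI.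
    by apply: is_derive_eq; rewrite /V pexp_2pi subrr.
  by move=> /(_ D0); lra.
have P1 : 0 * (pi *+ 2 - 0) <= H x2 (pi *+ 2) - H x2 0.
  apply: (@deriv_ge (H x2) (U x2)) (ltW pi0) (HH x2 (lexx _)) _ => t _.
  by apply: Gr; rewrite nrm_pexp.
have P2 : e * (pi *+ 2 - 0) <= (- H x1 (pi *+ 2)) - (- H x1 0).
  apply: (@deriv_ge (fun t => - H x1 t) (fun t => - U x1 t)) (ltW pi0) _ _ => t tI.
    have h := HH x1 (ltW x12) t tI; exact: is_deriveN.
  have := Hk (pexp x1 t); rewrite subr0 nrm_pexp => /(_ ex1) h.
  have := le_lt_trans (re_le_nrm _) h; rewrite reB /U ltr_norml /e; lra.
have P3 : 0 < e * (pi *+ 2 - 0) by rewrite subr0 mulr_gt0.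
move=> HW.
have {}HW : H x2 (pi *+ 2) - H x2 0 = H x1 (pi *+ 2) - H x1 0.
  move: HW => /(_ (fun x y h => HF y x (proj1 h)) (fun x y h => HH x (proj2 (andP (proj1 h))) y (proj2 h))); lra.
lra.
Qed.
End MinPrinciple.

(** * Derivation and continuity rules for the auxiliary functions used below *)

Section FieldCalculus.
Variable K : numFieldType.
Implicit Types (phi q : K -> K) (a b c d e z : K).

Lemma derivable_quotient phi c z : z != 0 -> derivable phi z 1 ->
  derivable (fun w => (phi w - c) / w) z 1.
Proof.
move=> z0 dp; have d1 : derivable (fun w => phi w - c) z 1 := derivableB dp (derivable_cst c z 1).
have d2 : derivable (fun w : K => w^-1) z 1 by apply: (derivableV (f := id)) z0 _; exact: derivable_id.
exact: derivableM d1 d2.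
Qed.

Lemma derivable_combination phi q a b c d e z : derivable phi z 1 -> derivable q z 1 ->
  derivable (fun w => a * q w + b * (phi w + c) * (w * d) - e * phi w) z 1.
Proof.
move=> dp dq; have cst u : derivable (fun=> u : K) z 1 by exact: derivable_cst.
have d1 : derivable (fun w => a * q w) z 1 := derivableM (cst a) dq.
have d2 : derivable (fun w => b * (phi w + c)) z 1 := derivableM (cst b) (derivableD dp (cst c)).
have d3 : derivable (fun w => b * (phi w + c) * (w * d)) z 1.
  exact: derivableM d2 (derivableM (@derivable_id K K z 1) (cst d)).
exact: derivableB (derivableD d1 d3) (derivableM (cst e) dp).
Qed.

Lemma continuous_combination phi q a b c d e z :
  {for z, continuous phi} -> {for z, continuous q} ->
  {for z, continuous (fun w => a * q w + b * (phi w + c) * (w * d) - e * phi w)}.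
Proof.
move=> cphi cq.
have cc u : {for z, continuous (fun=> u : K)} by exact: cst_continuous.
have ci : {for z, continuous (fun w : K => w)} by move=> A.
have c1 := continuousM (cc a) cq.
have c2 := continuousM (continuousM (cc b) (continuousD cphi (cc c))) (continuousM ci (cc d)).
exact: continuousB (continuousD c1 c2) (continuousM (cc e) cphi).
Qed.

Lemma is_derive_subc phi z c d : is_derive z 1 phi d -> is_derive z 1 (fun w => phi w - c) d.
Proof. by move=> h; rewrite -[d]subr0; exact: is_deriveB. Qed.

Lemma is_derive_mulc phi z a d : is_derive z 1 phi d -> is_derive z 1 (fun w => a * phi w) (a * d).
Proof.
move=> h; have -> : a * d = a *: d + phi z *: 0 by rewrite scaler0 addr0.
exact: is_deriveM.
Qed.
End FieldCalculus.

(** * The inequalities of Caratheodory, Cauchy and Harnack on a disc *)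

Section Holomorphic.
Variable R : realType.
Implicit Types (phi : cplx R -> cplx R) (z d e : cplx R).

Lemma cder_shift (W : normedModType (cplx R)) (g : cplx R -> W) (c z : cplx R) (d : W) :
  is_derive (c + z) 1 g d -> is_derive z 1 (fun w => g (c + w)) d.
Proof.
move=> /cderP H; apply/cderP => e e0; have [k k0 Hk] := H e e0.
by exists k => // h hk; rewrite addrA Hk.
Qed.

Lemma cder_near (W : normedModType (cplx R)) (g g' : cplx R -> W) (z : cplx R) (d : W) (k : R) :
  0 < k -> (forall w, nrm (w - z) < k -> g' w = g w) ->
  is_derive z 1 g d -> is_derive z 1 g' d.
Proof.
move=> k0 gg /cderP H; apply/cderP => e e0; have [l l0 Hl] := H e e0.
exists (Num.min k l); first by rewrite lt_min k0.
move=> h; rewrite lt_min => /andP[hk hl]; rewrite !gg ?subrr ?nrm0//; first exact: Hl.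
by rewrite addrAC subrr add0r.
Qed.

Lemma rder_ray phi (z e d : cplx R) (t : R) :
  is_derive (z + ofreal t * e) 1 phi d ->
  is_derive t 1 (fun s => re (phi (z + ofreal s * e))) (re (d * e)).
Proof.
move=> /cderP H; apply/rderP => x x0.
pose N := 1 + nrm e; have N0 : 0 < N by rewrite /N; have := nrm_ge0 e; lra.
have [k k0 Hk] := H (x / N) (divr_gt0 x0 N0).
exists (k / N); first exact: divr_gt0.
move=> h hk; have eN : nrm e <= N by rewrite /N lerDr.
have he : nrm (ofreal h * e) <= `|h| * N by rewrite nrmM nrm_ofreal ler_wpM2l.
have /Hk {}Hk : nrm (ofreal h * e) < k.
  by apply: le_lt_trans he _; rewrite -ltr_pdivlMr.
rewrite ofrealD mulrDl addrA.
have -> : re (phi (z + ofreal t * e + ofreal h * e)) - re (phi (z + ofreal t * e)) - h * re (d * e)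
   = re (phi (z + ofreal t * e + ofreal h * e) - phi (z + ofreal t * e) - (ofreal h * e) *: d).
  rewrite !reB; congr (_ - _ - _).
  have -> : (ofreal h * e) *: d = ofreal h * (d * e) by rewrite /GRing.scale /=; ring.
  by rewrite (reM (ofreal h)) re_ofreal im_ofreal mul0r subr0.
rewrite (le_trans (re_le_nrm _))// (le_trans Hk)//.
by rewrite mulrAC ler_pdivrMr// -mulrA ler_wpM2l// ltW.
Qed.

(** Passage to the limit in the radius: were [a r > b], the radius midway between [b / a] and [r]
    would already violate the inequality. *)
Lemma ge0_of_lt_radius (r a b : R) : 0 < r -> 0 <= a ->
  (forall s, 0 < s < r -> a * s <= b) -> a * r <= b.
Proof.
move=> r0 a0 H; rewrite leNgt; apply/negP => br.
have a1 : 0 < a.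
  rewrite lt_neqAle a0 andbT eq_sym; apply/negP => /eqP az; move: br (H (r / 2)).
  rewrite az !mul0r => h1 h2; have : 0 <= b by apply: h2; lra.
  lra.
have b0 : 0 <= b.
  have /H h : 0 < r / 2 < r by lra.
  by apply: le_trans h; rewrite mulr_ge0 ?divr_ge0 ?(ltW r0).
have : a * ((r + b / a) / 2) <= b.
  have ba : b / a < r by rewrite ltr_pdivrMr// mulrC.
  apply: H; have := divr_ge0 b0 a0; lra.
have -> : a * ((r + b / a) / 2) = (a * r + b) / 2 by field; rewrite lt0r_neq0.
lra.
Qed.

Definition holo_on phi (c : cplx R) (r : R) : Prop :=
  forall z : cplx R, nrm (z - c) < r -> exists d : cplx R, is_derive z 1 phi d.

(** The minimum principle is applied to a function [G] built from [phi] in such a way that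
    [Re G = 2 (1/s - Re b) (- Re phi) >= 0] on the circle [|z| = s], where [b = a / z], whereas
    [Re (G 0) = - |d0| - (2 / s) Re (phi 0)]. Then [s] tends to [r]. *)
Lemma caratheodory0 phi (r : R) (d0 : cplx R) : 0 < r -> holo_on phi 0 r ->
  (forall z : cplx R, nrm z < r -> re (phi z) <= 0) -> is_derive (0 : cplx R) 1 phi d0 ->
  nrm d0 * r <= - 2 * re (phi 0).
Proof.
move=> r0 dphi phi0 dd0; apply: ge0_of_lt_radius => //; first exact: nrm_ge0.
move=> s /andP[s0 sr].
have [a [a1 ad]] : exists a : cplx R, nrm a = 1 /\ re (a * d0) = - nrm d0.
  have [->|d00] := eqVneq d0 0; first by exists 1; rewrite nrm1 mulr0 nrm0 oppr0.
  have nd : nrm d0 != 0 by rewrite nrm_eq0.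
  exists (- (ofreal (nrm d0) / d0)); split.
    by rewrite nrmN nrmM nrmV nrm_ofreal ger0_norm ?nrm_ge0// divff.
  by rewrite mulNr divfK// reN.
pose q z := if z == 0 then d0 else (phi z - phi 0) / z.
(* On the circle [z / s^2] is the inverse of the conjugate of [z]. The middle term therefore
   contributes the conjugate of [b], which makes the coefficient of [phi z] real and the terms in
   [phi 0] purely imaginary. *)
pose G z := a * q z + Num.conj a * (phi z + Num.conj (phi 0)) * (z * ofreal (s ^- 2)) - ofreal (2 / s) * phi z.
have cphi : {for (0 : cplx R), continuous phi} by exact: cder_continuous dd0.
have re_conj w : re (Num.conj w : cplx R) = re w by case: w.
have im_conj w : im (Num.conj w : cplx R) = - im w by case: w.
have G0 : re (G 0) = - nrm d0 - 2 / s * re (phi 0).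
  by rewrite /G /q eqxx mul0r mulr0 addr0 reB ad reM re_ofreal im_ofreal mul0r subr0.
suff : 0 <= re (G 0).
  by rewrite G0 => h; have := mulr_ge0 h (ltW s0); rewrite mulrBl mulrAC divfK ?gt_eqF//; lra.
apply: (min_principle s0).
- move=> z z0 zs.
  have [d Hd] := dphi z (eq_ind_r (fun x => nrm x < r) (le_lt_trans zs sr) (subr0 z)).
  have dp : derivable phi z 1 by case: Hd.
  have dq := derivable_quotient (c := phi 0) z0 dp.
  have nz : 0 < nrm z by rewrite nrm_gt0.
  have {}dq : derivable q z 1.
    have H := @derivableP _ _ _ _ _ _ dq.
    have := @cder_near _ _ q z _ (nrm z) nz _ H.
    case=> // w; rewrite /q; case: eqP => // ->; rewrite sub0r nrmN ltxx//.
  have dG : derivable G z 1.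
    exact: (derivable_combination (a := a) (b := Num.conj a) (c := Num.conj (phi 0))
      (d := ofreal (s ^- 2)) (e := ofreal (2 / s)) dp dq).
  exists ('D_1 G z); exact: derivableP.
- have cq : {for (0 : cplx R), continuous q}.
    apply/continuous_nrmP => x x0; have [k k0 Hk] := (cderP _ _ _).1 dd0 _ (divr_gt0 x0 (ltr0n _ 2)).
    exists k => // y; rewrite subr0 => yk; rewrite {2}/q eqxx /q; case: eqP => [_|/eqP y0].
      by rewrite subrr nrm0.
    have := Hk y yk; rewrite add0r /GRing.scale /= => h.
    have ny : 0 < nrm y by rewrite nrm_gt0.
    rewrite -(ltr_pM2r ny) -nrmM mulrBl divfK// (mulrC d0) (le_lt_trans h)// ltr_pM2r//; lra.
  exact: (continuous_combination (a := a) (b := Num.conj a) (c := Num.conj (phi 0))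
    (d := ofreal (s ^- 2)) (e := ofreal (2 / s)) cphi cq).
move=> z zs; have z0 : z != 0 by rewrite -nrm_gt0 zs.
pose b := a / z.
have nb : nrm b = s^-1 by rewrite nrmM nrmV a1 zs mul1r.
have zz : z * ofreal (s ^- 2) = (Num.conj z)^-1.
  have zc : z * Num.conj z = ofreal (s ^+ 2).
    rewrite -zs sqr_nrm; case: (z) => x y; apply: cplx_eq; rewrite ?reM ?imM /=; rewrite /re /im /=; ring.
  have cz0 : Num.conj z != 0 by rewrite conjC_eq0.
  apply: (mulIf cz0); rewrite mulVf// mulrAC zc -ofrealM divff ?expf_neq0 ?gt_eqF//.
have E : G z = (b + Num.conj b) * phi z - (b * phi 0 - Num.conj (b * phi 0)) - ofreal (2 / s) * phi z.
  rewrite /G /q (negbTE z0) zz /b !rmorphM /= fmorphV; ring.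
have rb : re b <= s^-1 by rewrite -nb (le_trans (ler_norm _))// re_le_nrm.
have : re (phi z) <= 0 by apply: phi0; rewrite zs.
rewrite E !reB !(reM _ (phi z)) !reD !imD !re_conj !im_conj re_ofreal im_ofreal => h.
have -> : (re b + re b) * re (phi z) - (im b + - im b) * im (phi z) -
   (re (b * phi 0) - re (b * phi 0)) - (2 / s * re (phi z) - 0 * im (phi z)) =
   2 * (s^-1 - re b) * (- re (phi z)) by ring.
by rewrite !mulr_ge0// ?subr_ge0// oppr_ge0.
Qed.

Lemma caratheodory phi (c : cplx R) (r : R) (d : cplx R) : 0 < r -> holo_on phi c r ->
  (forall z : cplx R, nrm (z - c) < r -> re (phi z) <= 0) -> is_derive c 1 phi d ->
  nrm d * r <= - 2 * re (phi c).
Proof.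
move=> r0 hol phi0 dd; rewrite -[X in phi X]addr0.
apply: (@caratheodory0 (fun z => phi (c + z))) => //.
- move=> z; rewrite subr0 => zr; have [|d' hd'] := hol (c + z); first by rewrite addrAC subrr add0r.
  by exists d'; exact: cder_shift.
- by move=> z zr; apply: phi0; rewrite addrAC subrr add0r.
- by apply: cder_shift; rewrite addr0.
Qed.

(** The function [phi - M] has nonpositive real part, and [- 2 Re (phi c - M) <= 4 M]. *)
Lemma cauchy_bound phi (c : cplx R) (r M : R) (d : cplx R) : 0 < r -> holo_on phi c r ->
  (forall z : cplx R, nrm (z - c) < r -> nrm (phi z) <= M) -> is_derive c 1 phi d ->
  nrm d * r <= 4 * M.
Proof.
move=> r0 hol phiM dd.
have phic : nrm (phi c) <= M by apply: phiM; rewrite subrr nrm0.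
have := @caratheodory (fun z => phi z - ofreal M) c r d r0 _ _ _.
rewrite reB re_ofreal => H; apply: (le_trans (H _ _ _)).
- move=> z /hol[d' h']; exists d'; exact: is_derive_subc.
- move=> z /phiM h; rewrite reB re_ofreal.
  by have := le_trans (ler_norm _) (re_le_nrm (phi z)); lra.
- exact: is_derive_subc.
by have := re_le_nrm (phi c); rewrite ler_norml; lra.
Qed.

(* The derivative of t |-> u(te) (r - t)^2 along a ray is nonpositive, by
   Caratheodory's inequality on the disc of centre te and radius r - t. *)
Lemma harnack phi (r : R) (l : cplx R) : holo_on phi 0 r ->
  (forall z : cplx R, nrm z < r -> re (phi z) <= 0) -> nrm l < r ->
  - re (phi l) * (r - nrm l) ^+ 2 <= - re (phi 0) * r ^+ 2.
Proof.
move=> hol phi0 lr.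
have [->|l0] := eqVneq l 0; first by rewrite nrm0 subr0.
have nl : 0 < nrm l by rewrite nrm_gt0.
pose e := l / ofreal (nrm l).
have ne : nrm e = 1 by rewrite nrmM nrmV nrm_ofreal ger0_norm ?nrm_ge0// divff// gt_eqF.
have le : ofreal (nrm l) * e = l by rewrite mulrC divfK// ofreal_eq0 gt_eqF.
have nt t : 0 <= t -> nrm (ofreal t * e) = t by move=> t0; rewrite nrmM ne mulr1 nrm_ofreal ger0_norm.
have ex t : exists d, 0 <= t <= nrm l -> is_derive (0 + ofreal t * e) 1 phi d.
  have [h|_] := boolP (0 <= t <= nrm l); last by exists 0.
  have [|d hd] := hol (0 + ofreal t * e); last by exists d.
  rewrite subr0 add0r nt; last by case/andP: h.
  by case/andP: h => _ h; exact: le_lt_trans lr.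
have [d Hd] := choice ex.
have := @deriv_ge R (fun t => re (phi (0 + ofreal t * e)) * (r - t) ^+ 2)
  (fun t => re (d t * e) * (r - t) ^+ 2 - 2 * (r - t) * re (phi (0 + ofreal t * e))) 0 (nrm l) 0 (nrm_ge0 l) _ _.
rewrite mul0r le !add0r mul0r subr0 subr_ge0 => H.
rewrite !mulNr lerN2; apply: H => t tI.
  have h := rder_ray (Hd t tI).
  by apply: is_derive_eq; rewrite /GRing.scale /=; ring.
have /andP[t0 tl] := tI; have tr : 0 < r - t by rewrite subr_gt0 (le_lt_trans tl).
have := @caratheodory phi (0 + ofreal t * e) (r - t) (d t) tr _ _ (Hd t tI).
have ball z : nrm (z - (0 + ofreal t * e)) < r - t -> nrm z < r.
  move=> h; rewrite -(subrK (0 + ofreal t * e) z) (le_lt_trans (nrmD _ _))//.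
  by rewrite {2}add0r nt//; lra.
move=> C; have {C} : nrm (d t) * (r - t) <= - 2 * re (phi (0 + ofreal t * e)).
  by apply: C => z /ball h; [apply: hol; rewrite subr0|exact: phi0].
have : - nrm (d t) <= re (d t * e).
  have := re_le_nrm (d t * e); rewrite nrmM ne mulr1 ler_norml; lra.
move=> h1 h2; have := mulr_ge0 (ltW tr) (_ : 0 <= re (d t * e) + nrm (d t)); rewrite -lerBlDr sub0r.
move=> /(_ h1) h3; have h4 := ler_wpM2r (ltW tr) h2; have h5 := mulr_ge0 (ltW tr) h3; lra.
Qed.

(** Cauchy's bound on discs of radius [1 - t] centred on the ray bounds the derivative there. The
    mean value theorem is applied to the real and imaginary parts separately, which doubles the
    constant 4. *)
Lemma radial_lipschitz phi (M : R) (e : cplx R) (s t : R) : nrm e = 1 -> 0 <= s -> s <= t -> t < 1 ->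
  holo_on phi 0 1 -> (forall z : cplx R, nrm z < 1 -> nrm (phi z) <= M) ->
  nrm (phi (ofreal t * e) - phi (ofreal s * e)) <= 8 * M / (1 - t) * (t - s).
Proof.
move=> ne s0 st t1 hol phiM.
have nt u : 0 <= u -> nrm (ofreal u * e) = u by move=> t0; rewrite nrmM ne mulr1 nrm_ofreal ger0_norm.
have ex u : exists d, s <= u <= t -> is_derive (0 + ofreal u * e) 1 phi d.
  have [/andP[h1 h2]|_] := boolP (s <= u <= t); last by exists 0.
  have [|d hd] := hol (0 + ofreal u * e); last by exists d.
  rewrite subr0 add0r nt; [exact: le_lt_trans t1|exact: le_trans h1].
have [d Hd] := choice ex.
have t10 : 0 < 1 - t by rewrite subr_gt0.
have B u : s <= u <= t -> nrm (d u) <= 4 * M / (1 - t).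
  move=> uI; have /andP[su ut] := uI; rewrite ler_pdivlMr//.
  apply: (@cauchy_bound phi (0 + ofreal u * e) (1 - t) M) => //; last exact: Hd.
    move=> z h; apply: hol; rewrite subr0 -(subrK (0 + ofreal u * e) z) (le_lt_trans (nrmD _ _))//.
    by rewrite {2}add0r nt; [lra|exact: le_trans su].
  move=> z h; apply: phiM; rewrite -(subrK (0 + ofreal u * e) z) (le_lt_trans (nrmD _ _))//.
  by rewrite {2}add0r nt; [lra|exact: le_trans su].
have C (a : cplx R) : nrm a = 1 -> `|re (a * (phi (ofreal t * e) - phi (ofreal s * e)))| <= 4 * M / (1 - t) * (t - s).
  move=> na.
  have := @mvt_bound R (fun u => re (a * phi (0 + ofreal u * e))) (fun u => re (a * d u * e)) s t (4 * M / (1 - t)) st _ _.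
  rewrite !add0r -reB -mulrBr; apply.
    move=> u uI; apply: (@rder_ray (fun z => a * phi z)).
    exact/is_derive_mulc/Hd.
  move=> u uI; rewrite (le_trans (re_le_nrm _))// !nrmM na ne mul1r mulr1; exact: B.
have ni : nrm (- 'i : cplx R) = 1 by rewrite nrmN /nrm normCi.
have := C _ (nrm1 R); have := C _ ni.
rewrite mul1r mulNr reN reM re_i im_i mul0r mul1r sub0r opprK => A1 A2.
rewrite (le_trans (nrm_le_reim _))// (le_trans (lerD A2 A1))// le_eqVlt; apply/orP; left; apply/eqP.
by field; rewrite gt_eqF.
Qed.
End Holomorphic.

Lemma mvt_affine (R : realType) (g d : R -> R) (c a e : R) :
  (forall t : R, `|t| <= `|c| -> is_derive t 1 g (d t)) ->
  (forall t : R, `|t| <= `|c| -> `|d t - a| <= e) -> `|g c - g 0 - a * c| <= e * `|c|.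
Proof.
move=> dg de; pose G t := g t - a * t.
have dG (t : R) : `|t| <= `|c| -> is_derive t 1 G (d t - a).
  by move=> /dg h; apply: is_derive_eq; rewrite /GRing.scale /= mulr1.
have E : g c - g 0 - a * c = G c - G 0 by rewrite /G; ring.
rewrite E; have [c0|/ltW c0] := leP 0 c.
  rewrite (ger0_norm c0) -[X in _ * X]subr0; apply: (@mvt_bound R G (fun t => d t - a)) => // t /andP[t0 tc].
    by apply: dG; rewrite !ger0_norm.
  by apply: de; rewrite !ger0_norm.
rewrite distrC (ler0_norm c0) -[X in _ * X]add0r; apply: (@mvt_bound R G (fun t => d t - a)) => // t /andP[tc t0].
  by apply: dG; rewrite !ler0_norm// lerN2.
by apply: de; rewrite !ler0_norm// lerN2.
Qed.

Lemma is_derive_translate (R : realType) (g : R -> R) (t d : R) :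
  is_derive (0 : R) 1 (fun s => g (t + s)) d -> is_derive t 1 g d.
Proof.
move=> /rderP H; apply/rderP => e /H[k k0 Hk]; exists k => // h /Hk.
by rewrite add0r addr0.
Qed.

Lemma segment_sum_arith (R : realFieldType) (N s W Z T k : R) : 0 <= W -> 0 <= Z -> 1 <= N ->
  s + 1 <= N - 1 -> T <= s * W -> Z * (3 * N) < k -> W * N * 3 < 2 * k -> Z + T + W < k.
Proof.
move=> W0 Z0 N1 sN TW Zk Wk; have h1 := ler_wpM2r W0 sN; have h2 := ler_wpM2l Z0 N1.
by rewrite mulr1 in h2; lra.
Qed.

(** * First and second order expansions in the real coordinates *)

Section Taylor.
Variables (R : realType) (n : nat).
Notation V := 'Cn[R]_n.
Implicit Types (psi rho : V -> R) (z w p h v : V) (U : set V).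

Definition ridx : finType := (bool * 'I_n)%type.
Definition rdir (i : ridx) : V := real_dir R i.1 i.2.
Definition rcoord (v : V) (i : ridx) : R := if i.1 then im (v 0 i.2) else re (v 0 i.2).
Definition pd (i : ridx) (psi : V -> R) : V -> R := partial i.1 i.2 psi.
Definition grad psi z h : R := \sum_(i : ridx) pd i psi z * rcoord h i.
Definition hess rho p h : R := \sum_(i : ridx) (\sum_(j : ridx) pd j (pd i rho) p * rcoord h j) * rcoord h i.

Lemma rcoordZ (t : R) h i : rcoord (ofreal t *: h) i = t * rcoord h i.
Proof.
by rewrite /rcoord mxE reM imM re_ofreal im_ofreal !mul0r subr0 addr0; case: ifP.
Qed.

Lemma rcoord_le h i : `|rcoord h i| <= nrm h.
Proof.
apply: le_trans (nrm_coord h i.2); rewrite /rcoord; case: ifP => _.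
  exact: im_le_nrm.
exact: re_le_nrm.
Qed.

Lemma gradZ psi z (t : R) h : grad psi z (ofreal t *: h) = t * grad psi z h.
Proof. by rewrite /grad mulr_sumr; apply: eq_bigr => i _; rewrite rcoordZ; ring. Qed.

Definition runit (b : bool) : cplx R := if b then 'i else 1.

Lemma rdirE i j : rdir i 0 j = runit i.1 * (j == i.2)%:R.
Proof. by rewrite !mxE eqxx. Qed.

Lemma nrm_rdir i : nrm (rdir i) <= 1.
Proof.
apply: nrm_le_coord => // j; rewrite rdirE nrmM.
have -> : nrm (runit i.1) = 1 by rewrite /runit; case: ifP => _; rewrite ?nrm1// /nrm normCi.
by rewrite mul1r; case: eqP => _; rewrite ?nrm1 ?nrm0.
Qed.

Lemma rcoord_sum h : h = \sum_(i : ridx) ofreal (rcoord h i) *: rdir i.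
Proof.
apply/rowP => k; rewrite summxE.
rewrite (eq_bigr (fun i : ridx => (if i.2 == k then
   ofreal (rcoord h i) * runit i.1 else 0))); last first.
  move=> i _; rewrite mxE rdirE eq_sym; case: eqP => _; rewrite ?mulr1 ?mulr0 ?mulr0//.
rewrite -(pair_bigA _ (fun b (j : 'I_n) => if j == k then ofreal (rcoord h (b, j)) * runit b else 0)) /=.
rewrite big_bool /= -!big_mkcond /= !big_pred1_eq /rcoord /runit [_.1]/= [_.2]/=.
by apply: cplx_eq; rewrite ?reD ?imD ?reM ?imM ?re_i ?im_i ?re_ofreal ?im_ofreal ?re1 ?im1; ring.
Qed.

Lemma line_derive U psi z i : C1_on U psi -> U z ->
  is_derive (0 : R) 1 (fun t => psi (z + ofreal t *: rdir i)) (pd i psi z).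
Proof.
move=> [_ H] Uz; have [dz _] := H i.1 i.2 z Uz.
by rewrite /pd /partial derive1E; exact: derivableP.
Qed.

Lemma pd_continuous U psi z i : C1_on U psi -> U z -> {for z, continuous (pd i psi)}.
Proof. by move=> [_ H] Uz; have [_] := H i.1 i.2 z Uz. Qed.

#[local] Opaque pd rdir.

Lemma segment_step U psi p i (e k : R) (z : V) (c : R) : C1_on U psi ->
  (forall w, nrm (w - p) < k -> U w /\ `|pd i psi w - pd i psi p| <= e) ->
  nrm (z - p) + `|c| < k ->
  `|psi (z + ofreal c *: rdir i) - psi z - pd i psi p * c| <= e * `|c|.
Proof.
move=> C1 H zk.
have kI (t : R) : `|t| <= `|c| -> nrm (z + ofreal t *: rdir i - p) < k.
  move=> tc; apply: le_lt_trans zk; rewrite addrAC (le_trans (nrmD _ _))// lerD2l.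
  by rewrite nrmZ nrm_ofreal -[leRHS]mulr1 ler_pM ?nrm_ge0 ?nrm_rdir.
have E0 : psi (z + ofreal 0 *: rdir i) = psi z by rewrite scale0r addr0.
rewrite -E0.
apply: (@mvt_affine R (fun t => psi (z + ofreal t *: rdir i)) (fun t => pd i psi (z + ofreal t *: rdir i))).
  move=> t tc; have [Uw _] := H _ (kI t tc).
  apply: is_derive_translate; have D := line_derive i C1 Uw.
  have -> : (fun s => psi (z + ofreal (t + s) *: rdir i)) =
      (fun s => psi (z + ofreal t *: rdir i + ofreal s *: rdir i)); last by [].
  by apply: funext => s; rewrite ofrealD scalerDl addrA.
by move=> t tc; have [_ h] := H _ (kI t tc).
Qed.

(** Continuity of the partial derivatives at [p] controls increments between two moving points. One
    goes from [z] to [w] one real coordinate at a time and uses the mean value theorem at each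
    step. *)
Lemma strict_diff U psi p (e : R) : open U -> U p -> C1_on U psi -> 0 < e ->
  exists2 k : R, 0 < k & (forall w, nrm (w - p) < k -> U w) /\
    forall z w, nrm (z - p) < k -> nrm (w - p) < k ->
    `|psi w - psi z - grad psi p (w - z)| <= e * nrm (w - z).
Proof.
move=> oU Up C1 e0.
pose N := 1 + #|ridx|%:R : R; have N0 : 0 < N by rewrite /N ltr_wpDr.
have eN : 0 < e / N by rewrite divr_gt0.
have [k0 k00 Hk0] := (open_nrmP U).1 oU p Up.
have [k k_gt0 Hk] : exists2 k : R, 0 < k & forall i w, nrm (w - p) < k -> U w /\ `|pd i psi w - pd i psi p| <= e / N.
  have ex i : exists ki : R, 0 < ki /\ forall w, nrm (w - p) < ki -> `|pd i psi w - pd i psi p| <= e / N.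
    have [ki ki0 Hki] := (continuous_nrm_absP _ _).1 (pd_continuous (i := i) C1 Up) _ eN.
    by exists ki; split=> // w /Hki /ltW.
  have [kf Hkf] := choice ex.
  pose m := \big[Num.min/k0]_(i : ridx) kf i.
  exists m; first by apply/bigmin_gtP; split=> // i _; have [] := Hkf i.
  move=> i w /bigmin_gtP[w1 w2]; split; first exact: Hk0.
  by have [_] := Hkf i; apply; exact: w2.
(* The intermediate points are at most [#|ridx|] steps of size [nrm (w - z)] away from [z]; this
   radius keeps them all in the ball of radius [k]. *)
exists (k / (3 * N)); first by rewrite divr_gt0// mulr_gt0.
have kN : k / (3 * N) <= k.
  rewrite ler_pdivrMr ?mulr_gt0// ler_peMr ?(ltW k_gt0)// /N.
  by have : (0 : R) <= #|ridx|%:R by []; lra.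
split.
  move=> w /lt_le_trans /(_ kN) wk.
  (* For [n = 0] there is no index from which to extract the bound, but then the space is a
     point. *)
  have [i|no] := pickP (predT : pred ridx); first by have [] := Hk i w wk.
  have V0 v : v = 0.
    by rewrite [v]rcoord_sum big1// => i; have := no i.
  by rewrite (V0 w) -(V0 p).
move=> z w; rewrite !ltr_pdivlMr ?mulr_gt0// => zk wk.
have wz : nrm (w - z) * N * 3 < 2 * k.
  have := nrm_tri p w z; rewrite (nrmBC p z) => h.
  rewrite -mulrA mulrC (mulrC N); have : 0 < 3 * N by rewrite mulr_gt0.
  nra.
pose c := rcoord (w - z).
suff H (s : seq ridx) : (size s <= #|ridx|)%N ->
  `|psi (z + \sum_(i <- s) ofreal (c i) *: rdir i) - psi z - \sum_(i <- s) pd i psi p * c i|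
     <= e / N * \sum_(i <- s) `|c i| /\ nrm (\sum_(i <- s) ofreal (c i) *: rdir i) <= (size s)%:R * nrm (w - z).
  have [] := H (index_enum ridx); first by rewrite cardE enumT.
  have -> : z + \sum_(i : ridx) ofreal (c i) *: rdir i = w by rewrite -rcoord_sum addrC subrK.
  move=> h _; apply: (le_trans h).
  rewrite mulrAC ler_pdivrMr// -mulrA ler_wpM2l ?(ltW e0)//.
  rewrite (le_trans (y := \sum_(i : ridx) nrm (w - z)))//.
    by apply: ler_sum => i _; exact: rcoord_le.
  rewrite sumr_const -mulr_natr ler_wpM2l ?nrm_ge0// /N lerDr//.
elim: s => [|i s IH] /=.
  by rewrite !big_nil addr0 subrr sub0r oppr0 normr0 mulr0 nrm0 mul0r.
move=> sN; have [IH1 IH2] := IH (ltnW sN); rewrite !big_cons; split; last first.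
  rewrite (le_trans (nrmD _ _))// -[in leRHS]natr1 mulrDl addrC lerD// mul1r nrmZ nrm_ofreal.
  by rewrite -[leRHS]mulr1 ler_pM ?nrm_ge0 ?nrm_rdir// rcoord_le.
set y := z + \sum_(i <- s) ofreal (c i) *: rdir i.
have := @segment_step U psi p i (e / N) k y (c i) C1 (Hk i) _.
rewrite (_ : z + (ofreal (c i) *: rdir i + _) = y + ofreal (c i) *: rdir i); last first.
  by rewrite /y -addrA [X in _ = _ + X]addrC.
move=> hs; rewrite mulrDr.
rewrite (_ : _ - _ = (psi (y + ofreal (c i) *: rdir i) - psi y - pd i psi p * c i) +
  (psi y - psi z - \sum_(i <- s) pd i psi p * c i)); last by ring.
rewrite (le_trans (ler_normD _ _))// lerD// hs//.
rewrite /y addrAC (le_lt_trans (lerD (nrmD _ _) (rcoord_le _ _)))//.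
have sN1 : (size s)%:R + 1 <= N - 1 :> R by rewrite natr1 /N addrAC subrr add0r ler_nat.
have W0 := nrm_ge0 (w - z); have Z0 := nrm_ge0 (z - p).
have N1 : 1 <= N by rewrite /N lerDl.
exact: segment_sum_arith W0 Z0 N1 sN1 IH2 zk wz.
Qed.

Lemma grad_derive U psi z h (t : R) : open U -> C1_on U psi -> U (z + ofreal t *: h) ->
  is_derive t 1 (fun s => psi (z + ofreal s *: h)) (grad psi (z + ofreal t *: h) h).
Proof.
move=> oU C1 Uz; apply/rderP => e e0.
have N0 : 0 < 1 + nrm h by rewrite ltr_wpDr ?nrm_ge0.
have [k k0 [_ Hk]] := strict_diff oU Uz C1 (divr_gt0 e0 N0).
exists (k / (1 + nrm h)); first exact: divr_gt0.
move=> s; rewrite ltr_pdivlMr// => sk.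
have sh : nrm (ofreal s *: h) <= `|s| * (1 + nrm h).
  by rewrite nrmZ nrm_ofreal ler_wpM2l// lerDr.
have -> : z + ofreal (t + s) *: h = z + ofreal t *: h + ofreal s *: h.
  by rewrite ofrealD scalerDl addrA.
move: (z + ofreal t *: h) Hk => y Hk.
have Es : y + ofreal s *: h - y = ofreal s *: h by rewrite addrAC subrr add0r.
have yk : nrm (y - y) < k by rewrite subrr nrm0.
have ysk : nrm (y + ofreal s *: h - y) < k by rewrite Es (le_lt_trans sh).
have := Hk _ _ yk ysk; rewrite Es gradZ => H; apply: (le_trans H).
rewrite mulrAC ler_pdivrMr// -mulrA ler_wpM2l ?(ltW e0)//.
Qed.

(** The gradient is taken at the moving point [z] and the Hessian at the fixed point [p]: continuity
    of the second derivatives at [p] then makes the estimate uniform in [z]. The mean value theorem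
    along the segment reduces it to strict differentiability of the first partials. *)
Lemma taylor2 U rho p (e : R) : open U -> U p -> C2_on U rho -> 0 < e ->
  exists2 k : R, 0 < k & (forall w, nrm (w - p) < k -> U w) /\
    forall z w, nrm (z - p) < k -> nrm (w - p) < k ->
    `|rho w - rho z - grad rho z (w - z) - hess rho p (w - z) / 2| <= e * nrm (w - z) ^+ 2.
Proof.
move=> oU Up [C1 C2] e0.
pose N := 1 + #|ridx|%:R : R; have N0 : 0 < N by rewrite /N ltr_wpDr.
have eN : 0 < e / N by rewrite divr_gt0.
have [k0 k00 Hk0] := (open_nrmP U).1 oU p Up.
have ex i : exists ki : R, 0 < ki /\ forall z w, nrm (z - p) < ki -> nrm (w - p) < ki ->
     `|pd i rho w - pd i rho z - grad (pd i rho) p (w - z)| <= e / N * nrm (w - z).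
  have [ki ki0 [_ Hki]] := strict_diff oU Up (C2 i.1 i.2) eN.
  by exists ki; split=> // w; exact: Hki.
have [kf Hkf] := choice ex.
pose k := \big[Num.min/k0]_(i : ridx) kf i.
exists k; first by apply/bigmin_gtP; split=> // i _; have [] := Hkf i.
split; first by move=> w /bigmin_gtP[w1 _]; exact: Hk0.
move=> z w zk wk; set h := w - z.
have segk t : 0 <= t <= 1 -> nrm (z + ofreal t *: h - p) < k.
  move=> /andP[t0 t1].
  have -> : z + ofreal t *: h - p = ofreal (1 - t) *: (z - p) + ofreal t *: (w - p).
    rewrite /h ofrealB ofreal1 !(scalerBr, scalerBl) !scale1r.
    by apply/rowP => j; rewrite !mxE; ring.
  rewrite (le_lt_trans (nrmD _ _))// !nrmZ !nrm_ofreal !ger0_norm ?subr_ge0//.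
  have [t10|t10] := eqVneq t 1; first by rewrite t10 subrr mul0r add0r mul1r.
  have t11 : t < 1 by rewrite lt_neqAle t10.
  nra.
have := @mvt_bound R (fun t => rho (z + ofreal t *: h) - t * grad rho z h - t ^+ 2 / 2 * hess rho p h)
  (fun t => grad rho (z + ofreal t *: h) h - grad rho z h - t * hess rho p h) 0 1 (e * nrm h ^+ 2) ler01 _ _.
rewrite ofreal0 ofreal1 scale0r scale1r addr0 mul0r mul1r expr0n expr1n /= !mul0r !subr0 mulr1.
rewrite (_ : z + h = w); last by rewrite /h addrC subrK.
rewrite (_ : _ - rho z = rho w - rho z - grad rho z h - hess rho p h / 2); last by field.
apply=> t tI.
  have Uz : U (z + ofreal t *: h) by apply: Hk0; have /bigmin_gtP[] := segk t tI.
  have h1 := grad_derive oU C1 Uz.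
  by apply: is_derive_eq; rewrite /GRing.scale /=; field.
have -> : grad rho (z + ofreal t *: h) h - grad rho z h - t * hess rho p h =
   \sum_(i : ridx) (pd i rho (z + ofreal t *: h) - pd i rho z - grad (pd i rho) p (ofreal t *: h)) * rcoord h i.
  rewrite /grad /hess mulr_sumr -!sumrB; apply: eq_bigr => i _.
  rewrite -/(grad (pd i rho) p h) -/(grad (pd i rho) p (ofreal t *: h)) gradZ; ring.
rewrite (le_trans (ler_norm_sum _ _ _))//.
apply: (@le_trans _ _ (\sum_(i : ridx) e / N * nrm h ^+ 2)); last first.
  rewrite sumr_const -mulr_natr mulrAC ler_wpM2r ?sqr_ge0//.
  by rewrite mulrAC ler_pdivrMr// ler_wpM2l ?(ltW e0)// /N lerDr.
apply: ler_sum => i _; rewrite normrM expr2 mulrA.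
have /andP[t0 t1] := tI.
apply: ler_pM; rewrite ?rcoord_le ?normr_ge0//.
have [ki0 Hki] := Hkf i.
have mk u : nrm (u - p) < k -> nrm (u - p) < kf i by move=> /bigmin_gtP[_]; exact.
have := Hki z (z + ofreal t *: h) (mk _ zk) (mk _ (segk t tI)).
rewrite (addrC z) addrK => H; apply: (le_trans H).
by rewrite nrmZ nrm_ofreal ger0_norm// ler_wpM2l ?(ltW eN)// ler_piMl ?nrm_ge0.
Qed.
End Taylor.

(** * Linear, quadratic and Hermitian forms, and coercivity on the unit sphere *)

Section ComplexForms.
Variables (R : realType) (n : nat).
Notation V := 'Cn[R]_n.

Lemma ofreal_nat k : ofreal (k%:R : R) = k%:R.
Proof. by elim: k => [|k IH]//; rewrite -natr1 ofrealD IH -natr1. Qed.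

Lemma re_conj (z : cplx R) : re (Num.conj z) = re z. Proof. by case: z. Qed.
Lemma im_conj (z : cplx R) : im (Num.conj z) = - im z. Proof. by case: z. Qed.

Definition clin (a : 'I_n -> cplx R) (h : V) : cplx R := \sum_j a j * h 0 j.
Definition cquad (q : 'I_n -> 'I_n -> cplx R) (h : V) : cplx R :=
  \sum_j \sum_k q j k * h 0 j * h 0 k.
Definition cherm (q : 'I_n -> 'I_n -> cplx R) (h : V) : cplx R :=
  \sum_j \sum_k q j k * h 0 j * Num.conj (h 0 k).

Lemma clinZ a (t : cplx R) h : clin a (t *: h) = t * clin a h.
Proof. by rewrite /clin mulr_sumr; apply: eq_bigr => j _; rewrite mxE mulrCA. Qed.

Lemma clinB a b h : clin a h - clin b h = clin (fun j => a j - b j) h.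
Proof. by rewrite /clin -sumrB; apply: eq_bigr => j _; rewrite mulrBl. Qed.

Lemma nrm_sum (I : Type) (s : seq I) (F : I -> cplx R) :
  nrm (\sum_(i <- s) F i) <= \sum_(i <- s) nrm (F i).
Proof.
elim: s => [|i s IH]; first by rewrite !big_nil nrm0.
by rewrite !big_cons (le_trans (nrmD _ _))// lerD2l.
Qed.

Lemma clin_le a h : nrm (clin a h) <= (\sum_j nrm (a j)) * nrm h.
Proof.
rewrite (le_trans (nrm_sum _ _))// mulr_suml; apply: ler_sum => j _.
by rewrite nrmM ler_wpM2l ?nrm_ge0 ?nrm_coord.
Qed.

Lemma cquad_le q h : nrm (cquad q h) <= (\sum_j \sum_k nrm (q j k)) * nrm h ^+ 2.
Proof.
rewrite (le_trans (nrm_sum _ _))// mulr_suml; apply: ler_sum => j _.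
rewrite (le_trans (nrm_sum _ _))// mulr_suml; apply: ler_sum => k _.
by rewrite !nrmM -mulrA ler_wpM2l ?nrm_ge0// expr2 ler_pM ?nrm_ge0 ?nrm_coord.
Qed.

Lemma cherm_le q h : nrm (cherm q h) <= (\sum_j \sum_k nrm (q j k)) * nrm h ^+ 2.
Proof.
rewrite (le_trans (nrm_sum _ _))// mulr_suml; apply: ler_sum => j _.
rewrite (le_trans (nrm_sum _ _))// mulr_suml; apply: ler_sum => k _.
by rewrite !nrmM nrm_conj -mulrA ler_wpM2l ?nrm_ge0// expr2 ler_pM ?nrm_ge0 ?nrm_coord.
Qed.

Lemma chermZ q (t : cplx R) h : cherm q (t *: h) = ofreal (nrm t ^+ 2) * cherm q h.
Proof.
rewrite /cherm mulr_sumr; apply: eq_bigr => j _; rewrite mulr_sumr; apply: eq_bigr => k _.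
have -> : ofreal (nrm t ^+ 2) = t * Num.conj t.
  by apply: cplx_eq; rewrite ?reM ?imM ?re_conj ?im_conj ?re_ofreal ?im_ofreal ?sqr_nrm; ring.
by rewrite !mxE rmorphM; ring.
Qed.

Lemma sum_ridx (F : ridx n -> R) : \sum_(i : ridx n) F i = \sum_j (F (false, j) + F (true, j)).
Proof.
rewrite (eq_bigr (fun i : ridx n => F (i.1, i.2))); last by case.
by rewrite big_split /= addrC -(pair_bigA _ (fun b j => F (b, j))) /= big_bool.
Qed.

(* [m a j b k] stands for the second derivative d_(a,j) d_(b,k). *)
Lemma hess_split (m : bool -> 'I_n -> bool -> 'I_n -> R) (h : V) :
  (\sum_(i : ridx n) (\sum_(j : ridx n) m j.1 j.2 i.1 i.2 * rcoord h j) * rcoord h i) / 2 =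
  re (cherm (fun j k => 4^-1 * ((m false j false k + m true j true k) +i*
                                (m false j true k - m true j false k) : cplx R)) h) +
  re (cquad (fun j k => 4^-1 * ((m false j false k - m true j true k) -i*
                                (m false j true k + m true j false k) : cplx R)) h).
Proof.
rewrite sum_ridx /cherm /cquad exchange_big [in X in _ + re X]exchange_big /=.
rewrite !re_sum -big_split mulr_suml; apply: eq_bigr => k _ /=.
rewrite !sum_ridx !re_sum !mulr_suml -!big_split mulr_suml; apply: eq_bigr => j _ /=.
rewrite -[4%:R]ofreal_nat -ofrealV !(reM, imM, re_conj, im_conj, re_ofreal, im_ofreal).
rewrite /rcoord [(_, _).1]/= [(_, _).2]/=; move: (re (h 0 j)) (im (h 0 j)) (re (h 0 k)) (im (h 0 k)).
move=> x y x' y'; rewrite /re /im /=.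
move: (m _ _ _ _) (m _ _ _ _) (m _ _ _ _) (m _ _ _ _) => a b c d.
by field.
Qed.

Lemma grad_split (g : ridx n -> R) (h : V) :
  \sum_(i : ridx n) g i * rcoord h i =
  re (clin (fun j => 2 * (2^-1 * (g (false, j) -i* g (true, j) : cplx R))) h).
Proof.
rewrite sum_ridx /clin re_sum; apply: eq_bigr => j _.
rewrite -[2%:R]ofreal_nat -ofrealV !(reM, imM, re_ofreal, im_ofreal).
rewrite /rcoord /=; move: (re (h 0 j)) (im (h 0 j)) => x y; rewrite /re /im /=.
by field.
Qed.

Lemma cherm_continuous q : continuous (fun h : V => re (cherm q h)).
Proof.
move=> h; apply/continuous_nrm_absP => e e0.
pose S := \sum_j \sum_k nrm (q j k).
have S0 : 0 <= S by do 2![apply: sumr_ge0 => ? _]; exact: nrm_ge0.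
pose N := (S + 1) * (2 * nrm h + 1).
have N0 : 0 < N by rewrite mulr_gt0 ?ltr_wpDl// mulr_ge0 ?nrm_ge0.
exists (Num.min 1 (e / N)); first by rewrite lt_min ltr01 divr_gt0.
move=> y; rewrite lt_min ltr_pdivlMr// => /andP[y1 ye].
rewrite -reB (le_lt_trans (re_le_nrm _))//.
apply: le_lt_trans ye.
have Y : nrm y <= nrm h + 1.
  by have := nrm_sub y h; lra.
have -> : cherm q y - cherm q h = \sum_j \sum_k q j k * ((y - h) 0 j * Num.conj (y 0 k) + h 0 j * Num.conj ((y - h) 0 k)).
  rewrite /cherm -sumrB; apply: eq_bigr => j _; rewrite -sumrB; apply: eq_bigr => k _.
  by rewrite !mxE rmorphB; ring.
apply: (@le_trans _ _ (S * (nrm (y - h) * (2 * nrm h + 1)))); last first.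
  rewrite mulrCA ler_wpM2l ?nrm_ge0// /N ler_wpM2r ?lerDl//.
  by rewrite addr_ge0// mulr_ge0// nrm_ge0.
rewrite (le_trans (nrm_sum _ _))// mulr_suml; apply: ler_sum => j _.
rewrite (le_trans (nrm_sum _ _))// mulr_suml; apply: ler_sum => k _.
rewrite nrmM ler_wpM2l ?nrm_ge0// (le_trans (nrmD _ _))// !nrmM !nrm_conj.
have a1 := nrm_coord (y - h) j; have a2 := nrm_coord (y - h) k.
have b1 := le_trans (nrm_coord y k) Y; have b2 := nrm_coord h j.
have := ler_pM (nrm_ge0 _) (nrm_ge0 _) a1 b1; have := ler_pM (nrm_ge0 _) (nrm_ge0 _) b2 a2.
lra.
Qed.

Lemma clin_continuous a : continuous (fun h : V => nrm (clin a h) ^+ 2).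
Proof.
move=> h.
have cn : {for h, continuous (fun h : V => nrm (clin a h))}.
  apply/continuous_nrm_absP => e e0.
  have S0 : 0 < \sum_j nrm (a j) + 1 by rewrite ltr_wpDl// sumr_ge0// => ? _; exact: nrm_ge0.
  exists (e / (\sum_j nrm (a j) + 1)); first by rewrite divr_gt0.
  move=> y; rewrite ltr_pdivlMr// => ye.
  have E : clin a y - clin a h = clin a (y - h).
    by rewrite /clin -sumrB; apply: eq_bigr => j _; rewrite !mxE mulrBr.
  rewrite (le_lt_trans (nrm_sub2 _ _))// E (le_lt_trans (clin_le _ _))//.
  by apply: le_lt_trans ye; rewrite mulrC ler_wpM2l ?nrm_ge0// lerDl.
exact: (@continuousM R _ _ _ h cn cn).
Qed.

Lemma sphere_compact : compact [set v : V | nrm v = 1].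
Proof.
pose box : set (cplx R) := (fun x : R * R => (x.1 +i* x.2 : cplx R)) @` (`[-1, 1] `*` `[-1, 1]).
have cbox : compact box.
  apply: continuous_compact; last by apply: compact_setX; exact: segment_compact.
  apply: continuous_subspaceT => x A /nbhs_nrmP[e e0 eA].
  apply/nbhs_ballP; exists (e / 2); first by rewrite /= divr_gt0.
  move=> y [/= y1 y2]; apply: eA; rewrite (le_lt_trans (nrm_le_reim _))// reB imB /=.
  by rewrite (distrC y.1) (distrC y.2) [e]splitr ltrD.
apply: (subclosed_compact _ (rV_compact (fun=> cbox))).
  move=> v /closure_nrmP cv; apply/eqP; rewrite -subr_eq0 -normr_le0 leNgt; apply/negP => v1.
  have [u u1 uv] := cv _ v1; move: (nrm_sub2 u v); rewrite u1 distrC; lra.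
move=> v v1 j; exists (re (v 0 j), im (v 0 j)); last by apply: cplx_eq.
have := nrm_coord v j; rewrite v1 => h.
have := le_trans (re_le_nrm _) h; have := le_trans (im_le_nrm _) h.
by rewrite !ler_norml => hi hr; split; rewrite /= in_itv.
Qed.

(** Near a zero of [g] on the sphere [f] is bounded below by a positive number; elsewhere a large
    [K] makes [K g] dominate. Taking [K^-1] as the lower bound leaves one parameter tending to
    infinity, uniformly by compactness. *)
Lemma coercive_penalty (f g : V -> R) : continuous f -> continuous g ->
  (forall v, 0 <= g v) -> (forall v, nrm v = 1 -> g v = 0 -> 0 < f v) ->
  exists c K : R, [/\ 0 < c, 0 <= K & forall v, nrm v = 1 -> c <= f v + K * g v].
Proof.
move=> cf cg g0 fg.
have cpt := sphere_compact; rewrite compact_near_coveringP in cpt.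
suff /(cpt R +oo%R (fun K v => K^-1 <= f v + K * g v)) [M [_ HM]] :
   forall v, nrm v = 1 -> \forall u \near v & K \near +oo%R, K^-1 <= f u + K * g u.
  exists (1 + `|M|)^-1, (1 + `|M|); rewrite invr_gt0; split; rewrite ?ltr_wpDr ?addr_ge0//.
  by move=> v v1; apply: HM => //; rewrite (le_lt_trans (ler_norm M))// ltrDr.
move=> v v1; have [gv|gv] := eqVneq (g v) 0.
  have fv := fg v v1 gv; have f2 : 0 < f v / 2 by rewrite divr_gt0.
  have [k k0 Hk] := (continuous_nrm_absP _ _).1 (cf v) _ f2.
  exists ([set u | nrm (u - v) < k], [set K | 2 / f v < K]); first split.
  - by apply/nbhs_nrmP; exists k.
  - by exists (2 / f v); split; rewrite ?num_real.
  move=> [u K] [/= uv fK]; have fK0 : 0 < 2 / f v by rewrite divr_gt0.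
  have K0 : 0 < K by exact: lt_trans fK.
  have := Hk u uv; rewrite ltr_norml => /andP[h _].
  have : K^-1 <= f v / 2.
    by rewrite -(invrK (f v / 2)) lef_pV2 ?posrE ?invr_gt0// invf_div ltW.
  have := mulr_ge0 (ltW K0) (g0 u); lra.
have {}gv : 0 < g v by rewrite lt_neqAle g0 eq_sym gv.
have g2 : 0 < g v / 2 by rewrite divr_gt0.
have [k k0 Hk] := (continuous_nrm_absP _ _).1 (cf v) _ (@ltr01 R).
have [l l0 Hl] := (continuous_nrm_absP _ _).1 (cg v) _ g2.
pose B := 1 + 2 * (2 + `|f v|) / g v.
exists ([set u | nrm (u - v) < Num.min k l], [set K | B < K]); first split.
- by apply/nbhs_nrmP; exists (Num.min k l); rewrite // lt_min k0.
- by exists B; split; rewrite ?num_real.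
move=> [u K] [/=]; rewrite lt_min => /andP[uk ul] BK.
have := Hk u uk; have := Hl u ul; rewrite !ltr_norml => /andP[h1 _] /andP[h2 _].
have B1 : 1 <= B by rewrite lerDl divr_ge0 ?mulr_ge0 ?addr_ge0// ltW.
have K1 : 1 <= K by rewrite ltW// (le_lt_trans B1).
have Kv : K^-1 <= 1 by rewrite invf_le1 ?(lt_le_trans ltr01).
have : 2 * (2 + `|f v|) <= K * g v.
  by rewrite -ler_pdivrMr//; apply: le_trans (ltW BK); rewrite /B lerDr.
have gu : g v / 2 <= g u by lra.
have := ler_wpM2l (le_trans ler01 K1) gu; have := ler_norm (- f v); rewrite normrN; lra.
Qed.
End ComplexForms.

(** * Local geometry of a strongly pseudoconvex boundary *)

Section LocalModel.
Variables (R : realType) (n : nat).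
Notation V := 'Cn[R]_n.

(** Holomorphic polynomials paired with their differentials; the chain rules along holomorphic discs
    and along C1 curves are both obtained by induction on this relation. *)
Inductive poly_der : (V -> cplx R) -> (V -> V -> cplx R) -> Prop :=
| poly_cst c : poly_der (fun=> c) (fun _ _ => 0)
| poly_coord j : poly_der (fun w => w 0 j) (fun _ h => h 0 j)
| poly_add P dP Q dQ : poly_der P dP -> poly_der Q dQ ->
    poly_der (fun w => P w + Q w) (fun w h => dP w h + dQ w h)
| poly_mul P dP Q dQ : poly_der P dP -> poly_der Q dQ ->
    poly_der (fun w => P w * Q w) (fun w h => dP w h * Q w + P w * dQ w h).

Definition is_poly P := exists dP, poly_der P dP.

Lemma is_poly_cst c : is_poly (fun=> c). Proof. by eexists; exact: poly_cst. Qed.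
Lemma is_poly_coord j : is_poly (fun w => w 0 j). Proof. by eexists; exact: poly_coord. Qed.
Lemma is_poly_add P Q : is_poly P -> is_poly Q -> is_poly (fun w => P w + Q w).
Proof. by move=> [dP hP] [dQ hQ]; eexists; exact: poly_add hP hQ. Qed.
Lemma is_poly_mul P Q : is_poly P -> is_poly Q -> is_poly (fun w => P w * Q w).
Proof. by move=> [dP hP] [dQ hQ]; eexists; exact: poly_mul hP hQ. Qed.
Lemma is_poly_sum (I : Type) (s : seq I) (F : I -> V -> cplx R) :
  (forall i, is_poly (F i)) -> is_poly (fun w => \sum_(i <- s) F i w).
Proof.
move=> h; elim: s => [|i s IH].
  have -> : (fun w => \sum_(i <- [::]) F i w) = (fun=> 0) by apply: funext => w; rewrite big_nil.
  exact: is_poly_cst.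
have -> : (fun w => \sum_(j <- i :: s) F j w) = (fun w => F i w + \sum_(j <- s) F j w).
  by apply: funext => w; rewrite big_cons.
exact: is_poly_add.
Qed.

Lemma is_poly_coordB z j : is_poly (fun w => (w - z) 0 j).
Proof.
have -> : (fun w => (w - z) 0 j) = (fun w : V => w 0 j + - z 0 j).
  by apply: funext => w; rewrite !mxE.
by apply: is_poly_add; [exact: is_poly_coord|exact: is_poly_cst].
Qed.

Lemma is_poly_clin a z : is_poly (fun w => clin a (w - z)).
Proof.
apply: is_poly_sum => j; apply: is_poly_mul; [exact: is_poly_cst|exact: is_poly_coordB].
Qed.

Lemma is_poly_cquad q z : is_poly (fun w => cquad q (w - z)).
Proof.
apply: is_poly_sum => j; apply: is_poly_sum => k; apply: is_poly_mul; last exact: is_poly_coordB.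
by apply: is_poly_mul; [exact: is_poly_cst|exact: is_poly_coordB].
Qed.

(** All that the distance estimates retain of strong pseudoconvexity. In [lm_normal] the vector [e]
    points inwards and [rho] decreases along it at unit rate; [lm_quasi] is convexity up to a
    quadratic error. In [lm_peak] the value [v0] lies between [- rho z / 2] and [- 2 rho z], as the
    last inequality at [w = z] shows. *)
Record local_model (D : set V) (p : V) (rho : V -> R) (eta C c : R) : Prop := LocalModel {
  lm_eta : 0 < eta;
  lm_C : 1 <= C;
  lm_c : 0 < c;
  lm_D : forall z, nrm (z - p) < eta -> (D z <-> rho z < 0);
  lm_bd : forall z, nrm (z - p) < eta -> boundary D z -> rho z = 0;
  lm_lip : forall z w, nrm (z - p) < eta -> nrm (w - p) < eta ->
    `|rho w - rho z| <= C * nrm (w - z);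
  lm_normal : forall z, nrm (z - p) < eta -> exists2 e : V, nrm e <= C &
    forall t : cplx R, nrm (z + t *: e - p) < eta ->
      rho (z + t *: e) <= rho z - re t + C * nrm t ^+ 2;
  lm_quasi : forall x y (t : R), nrm (x - p) < eta -> nrm (y - p) < eta -> 0 <= t <= 1 ->
    rho (ofreal (1 - t) *: x + ofreal t *: y) <= (1 - t) * rho x + t * rho y + C * nrm (x - y) ^+ 2;
  lm_peak : forall z, nrm (z - p) < eta -> D z -> exists P v0,
    [/\ is_poly P, P z = - ofreal v0, 0 < v0, v0 <= 2 * - rho z &
      forall w, nrm (w - p) < eta -> D w -> re (P w) <= rho w / 2 - c * nrm (w - z) ^+ 2]
}.

(* With X = Re l the identity |l|^2 = 2 X^2 - Re (l^2) turns the penalty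
   K |l|^2 into the real part of a holomorphic function, up to X^2, which is
   of the order of (rw - rz)^2. *)
Lemma peak_algebra (l : cplx R) (rw rz h L K S c e : R) : 0 <= K -> 0 <= h -> rw < 0 -> rz < 0 ->
  c * h <= L + K * nrm l ^+ 2 ->
  `|rw - rz - re l - L| <= e * h -> `|L| <= S * h -> 0 <= S ->
  e <= c / 2 -> 4 * K * (S + e) ^+ 2 * h <= c / 4 -> 4 * K * - rw <= 2^-1 ->
  re (l + ofreal K * l ^+ 2) <= rw / 2 + (- rz + 4 * K * rz ^+ 2) - c / 4 * h.
Proof.
move=> K0 h0 rw0 rz0 pen; rewrite !ler_norml => /andP[T1 T2] /andP[L1 L2] S0 ec small rws.
have E : re (l + ofreal K * l ^+ 2) = re l + 2 * K * re l ^+ 2 - K * nrm l ^+ 2.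
  by rewrite sqr_nrm reD expr2 !(reM, imM, re_ofreal, im_ofreal); ring.
set X := re l in E T1 T2; rewrite E.
have X2 : X ^+ 2 <= 2 * (rw ^+ 2 + rz ^+ 2) + 2 * ((S + e) * h) ^+ 2.
  set d := rw - rz - X in T1 T2.
  have dd : d ^+ 2 <= ((S + e) * h) ^+ 2.
    have := mulr_ge0 (_ : 0 <= (S + e) * h - d) (_ : 0 <= (S + e) * h + d).
    rewrite !subr_ge0; move=> H; rewrite -subr_ge0 subr_sqr; apply: H; lra.
  have : X ^+ 2 <= 2 * (rw - rz) ^+ 2 + 2 * d ^+ 2.
    have := sqr_ge0 (rw - rz + d); rewrite /d; nra.
  have := mulr_ge0 (ltW (_ : 0 < - rw)) (ltW (_ : 0 < - rz)).
  rewrite !oppr_gt0 => /(_ rw0 rz0); nra.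
have A : K * X ^+ 2 <= K * (2 * (rw ^+ 2 + rz ^+ 2)) + K * (2 * ((S + e) * h) ^+ 2).
  by rewrite -mulrDr ler_wpM2l.
have B : 4 * K * (S + e) ^+ 2 * h * h <= c / 4 * h by rewrite ler_wpM2r.
have Cc : 4 * K * rw ^+ 2 <= - rw / 2.
  have := ler_wpM2r (_ : 0 <= - rw) rws; rewrite oppr_ge0 => /(_ (ltW rw0)); lra.
have G : e * h <= c / 2 * h by rewrite ler_wpM2r.
lra.
Qed.

Lemma peak_constants (c K S h r : R) : 0 < c -> 16 * K * (S + c / 8) ^+ 2 * h <= c / 16 ->
  16 * K * r <= 2^-1 ->
  [/\ c / 8 <= c / 2 / 2, 4 * (4 * K) * (S + c / 8) ^+ 2 * h <= c / 2 / 4 & 4 * (4 * K) * r <= 2^-1].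
Proof. by move=> c0 h1 h2; rewrite !mulrA; split; lra. Qed.

Lemma peak_rearrange (x r a b c h K : R) : x <= r / 2 + (a + 4 * (4 * K) * b) - c / 2 / 4 * h ->
  - (a + 16 * K * b) + x <= r / 2 - c / 8 * h.
Proof. by move=> H; lra. Qed.

Lemma le_one_add (x y z : R) : 0 <= x -> 0 <= y -> 0 <= z ->
  [/\ 1 <= 1 + x + y + z, 1 + x <= 1 + x + y + z, y <= 1 + x + y + z & z <= 1 + x + y + z].
Proof. by move=> *; split; lra. Qed.

Lemma near_fin (I : finType) (p : V) (Q : I -> V -> Prop) :
  (forall i, exists2 k : R, 0 < k & forall w, nrm (w - p) < k -> Q i w) ->
  exists2 k : R, 0 < k & forall i w, nrm (w - p) < k -> Q i w.
Proof.
move=> H; have ex i : exists k : R, 0 < k /\ forall w, nrm (w - p) < k -> Q i w.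
  by have [k k0 Hk] := H i; exists k.
have [kf Hkf] := choice ex.
exists (\big[Num.min/1]_(i : I) kf i); first by apply/bigmin_gtP; split=> // i _; have [] := Hkf i.
by move=> i w /bigmin_gtP[_ w2]; have [_] := Hkf i; apply; exact: w2.
Qed.

Lemma nrm_gradient_diff (x y x' y' : R) :
  nrm (2 * (2^-1 * (x -i* y : cplx R)) - 2 * (2^-1 * (x' -i* y' : cplx R))) <= `|x - x'| + `|y - y'|.
Proof.
rewrite !mulrA !divff ?pnatr_eq0// !mul1r (le_trans (nrm_le_reim _))// reB imB /re /im /=.
by rewrite -opprD normrN.
Qed.

Lemma small_ex (A b : R) : 0 < b -> exists2 k : R, 0 < k & forall t, 0 <= t -> t <= k -> A * t <= b.
Proof.
move=> b0; have A0 : 0 < 1 + `|A| by rewrite ltr_wpDr.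
exists (b / (1 + `|A|)); first exact: divr_gt0.
move=> t t0; rewrite ler_pdivlMr// => h; apply: le_trans h.
have := ler_norm A; nra.
Qed.

(** Here [a z] is twice the complex gradient of [rho] at [z], while [q] and [L] are the holomorphic
    part and the Levi part of half the Hessian at [p]; so [clin (a z) + cquad q] is a Levi
    polynomial. In [tm_coer] the tangency condition of the Levi form is replaced by a penalty. *)
Record taylor_model (D : set V) (p : V) (rho : V -> R) (a : V -> 'I_n -> cplx R)
    (q : 'I_n -> 'I_n -> cplx R) (L : V -> R) (c0 K S k m : R) (j0 : 'I_n) : Prop := TaylorModel {
  tm_pos : [/\ 0 < c0, 0 <= K, 1 <= S, 0 < k & 0 < m];
  tm_D : forall z, nrm (z - p) < k -> (D z <-> rho z < 0);
  tm_bd : forall z, nrm (z - p) < k -> boundary D z -> rho z = 0;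
  tm_taylor : forall z w, nrm (z - p) < k -> nrm (w - p) < k ->
    `|rho w - rho z - re (clin (a z) (w - z) + cquad q (w - z)) - L (w - z)| <= c0 / 8 * nrm (w - z) ^+ 2;
  tm_coer : forall h, c0 * nrm h ^+ 2 <= L h + K * nrm (clin (a p) h) ^+ 2;
  tm_L : forall h, `|L h| <= S * nrm h ^+ 2;
  tm_q : forall h, nrm (cquad q h) <= S * nrm h ^+ 2;
  tm_lip : forall z w, nrm (z - p) < k -> nrm (w - p) < k -> `|rho w - rho z| <= S * nrm (w - z);
  tm_close : forall e : R, 0 < e -> exists2 l : R, 0 < l & forall z h, nrm (z - p) < l ->
    nrm (clin (a z) h - clin (a p) h) <= e * nrm h;
  tm_nondeg : forall z, nrm (z - p) < k -> m <= nrm (a z j0)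
}.

Lemma spc_taylor_model (D : set V) (p : V) : boundary D p ->
  C2_strongly_pseudoconvex_near D p ->
  exists rho a q L c0 K S k m j0, taylor_model D p rho a q L c0 K S k m j0.
Proof.
move=> bp [U [rho [oU Up C2 [DU bU] spc]]].
have [[j0 dz0] levi] := spc p bp Up.
have C1 : C1_on U rho by case: C2.
pose a z j : cplx R := 2 * d_z j rho z.
pose q j k : cplx R := 4^-1 * ((d_x j (d_x k rho) p - d_y j (d_y k rho) p) -i*
                     (d_x j (d_y k rho) p + d_y j (d_x k rho) p) : cplx R).
pose m j k := d_z_zbar j k rho p.
pose L h := re (cherm m h).
have gradE z h : grad rho z h = re (clin (a z) h) by exact: grad_split.
have hessE h : hess rho p h / 2 = L h + re (cquad q h).
  exact: (hess_split (fun a j b k => partial a j (partial b k rho) p) h).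
have [c0 [K [c0_gt0 K0 coer1]]] : exists c0 K : R, [/\ 0 < c0, 0 <= K &
    forall v, nrm v = 1 -> c0 <= L v + K * nrm (clin (a p) v) ^+ 2].
  apply: coercive_penalty; [exact: cherm_continuous|exact: clin_continuous|by move=> v; exact: sqr_ge0|].
  move=> v v1 /eqP; rewrite sqrf_eq0 nrm_eq0 => /eqP av.
  have v0 : v != 0 by rewrite -nrm_gt0 v1.
  have ct : complex_tangent rho p v.
    have E : clin (a p) v = 2 * \sum_(j < n) d_z j rho p * v 0 j.
      by rewrite /clin mulr_sumr; apply: eq_bigr => j _; rewrite /a mulrA.
    by move/eqP: av; rewrite E mulf_eq0 pnatr_eq0 /= => /eqP.
  have := levi v v0 ct; rewrite -[levi_form rho p v]/(cherm m v) => h.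
  by rewrite -ofreal_lt -(ge0_ofreal (ltW h)).
have LZ (t : R) v : L (ofreal t *: v) = t ^+ 2 * L v.
  by rewrite /L chermZ reM re_ofreal im_ofreal nrm_ofreal mul0r subr0 real_normK ?num_real.
have AZ (t : R) v : nrm (clin (a p) (ofreal t *: v)) ^+ 2 = t ^+ 2 * nrm (clin (a p) v) ^+ 2.
  by rewrite clinZ nrmM nrm_ofreal exprMn real_normK ?num_real.
(* Each term is homogeneous of degree 2 under real scaling, which carries the estimate from the unit
   sphere to all vectors. *)
have coer h : c0 * nrm h ^+ 2 <= L h + K * nrm (clin (a p) h) ^+ 2.
  have [->|h0] := eqVneq h 0.
    have -> : (0 : V) = ofreal 0 *: 0 by rewrite scale0r.
    by rewrite LZ AZ nrmZ nrm_ofreal normr0 expr0n /= !mul0r expr0n !mulr0 addr0.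
  have nh : 0 < nrm h by rewrite nrm_gt0.
  have [u hu u1] : exists2 u, h = ofreal (nrm h) *: u & nrm u = 1.
    exists (ofreal (nrm h)^-1 *: h).
      by rewrite scalerA -ofrealM divff ?scale1r// gt_eqF.
    by rewrite nrmZ nrm_ofreal ger0_norm ?invr_ge0 ?nrm_ge0// mulVf// gt_eqF.
  have := ler_wpM2r (sqr_ge0 (nrm h)) (coer1 u u1).
  have -> : L h = nrm h ^+ 2 * L u by rewrite -LZ -hu.
  have -> : nrm (clin (a p) h) ^+ 2 = nrm h ^+ 2 * nrm (clin (a p) u) ^+ 2 by rewrite -AZ -hu.
  lra.
pose SL := \sum_j \sum_k nrm (m j k); pose Sq := \sum_j \sum_k nrm (q j k).
have SL0 : 0 <= SL by do 2![apply: sumr_ge0 => ? _]; exact: nrm_ge0.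
have Sq0 : 0 <= Sq by do 2![apply: sumr_ge0 => ? _]; exact: nrm_ge0.
have Lle h : `|L h| <= SL * nrm h ^+ 2 by apply: le_trans (re_le_nrm _) (cherm_le _ _).
have qle h : nrm (cquad q h) <= Sq * nrm h ^+ 2 by exact: cquad_le.
have e4 : 0 < c0 / 8 by rewrite divr_gt0.
have [k1 k10 [Uk1 Hk1]] := taylor2 oU Up C2 e4.
have T z w : nrm (z - p) < k1 -> nrm (w - p) < k1 ->
   `|rho w - rho z - re (clin (a z) (w - z) + cquad q (w - z)) - L (w - z)| <= c0 / 8 * nrm (w - z) ^+ 2.
  move=> zk wk; have := Hk1 z w zk wk; rewrite gradE hessE reD.
  move: (rho w) (rho z) (re (clin _ _)) (re (cquad _ _)) (L _) => x1 x2 x3 x4 x5.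
  by rewrite (_ : x1 - x2 - (x3 + x4) - x5 = x1 - x2 - x3 - (x5 + x4))//; ring.
have [k2 k20 [_ Hk2]] := strict_diff oU Up C1 (@ltr01 R).
pose G := \sum_j nrm (a p j).
have G0 : 0 <= G by rewrite sumr_ge0// => ? _; exact: nrm_ge0.
have Lip z w : nrm (z - p) < k2 -> nrm (w - p) < k2 -> `|rho w - rho z| <= (1 + G) * nrm (w - z).
  move=> zk wk; have := Hk2 z w zk wk; rewrite gradE.
  have := le_trans (re_le_nrm _) (clin_le (a p) (w - z)); rewrite -/G.
  move: (rho w) (rho z) (re (clin _ _)) (nrm _) (G) => x1 x2 x3 x4 x5.
  rewrite mulrDl !ler_norml => /andP[? ?] /andP[? ?]; apply/andP; split; lra.
have acont j (e : R) : 0 < e -> exists2 k : R, 0 < k & forall w, nrm (w - p) < k -> nrm (a w j - a p j) <= e.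
  move=> e0; have e2 : 0 < e / 2 by rewrite divr_gt0.
  have [k k0 Hk] := (continuous_nrm_absP _ _).1 (pd_continuous (i := (false, j)) C1 Up) _ e2.
  have [l l0 Hl] := (continuous_nrm_absP _ _).1 (pd_continuous (i := (true, j)) C1 Up) _ e2.
  exists (Num.min k l); first by rewrite lt_min k0.
  move=> w; rewrite lt_min => /andP[/Hk hk /Hl hl].
  have hk' : `|d_x j rho w - d_x j rho p| < e / 2 := hk.
  have hl' : `|d_y j rho w - d_y j rho p| < e / 2 := hl.
  move: hk' hl'; rewrite /a /d_z.
  move: (d_x j rho w) (d_x j rho p) (d_y j rho w) (d_y j rho p) => x x' y y' h1 h2.
  apply: le_trans (nrm_gradient_diff _ _ _ _) _.
  by rewrite [e]splitr lerD// ltW.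
have ap0 : 0 < nrm (a p j0).
  by rewrite nrm_gt0 mulf_neq0// pnatr_eq0.
clearbody a q L SL Sq G m.
have m0 : 0 < nrm (a p j0) / 2 by rewrite divr_gt0.
have [k3 k30 Hk3] := acont j0 _ m0.
pose k := Num.min k1 (Num.min k2 k3).
have kP : [/\ k <= k1, k <= k2 & k <= k3] by rewrite /k; split; rewrite !ge_min lexx ?orbT.
have k0 : 0 < k by rewrite !lt_min k10 k20.
have [E1 E2 E3] := kP; clearbody k.
have UE z : nrm (z - p) < k -> U z by move=> zk; apply: Uk1; exact: lt_le_trans zk E1.
move: (le_one_add G0 SL0 Sq0); set S := 1 + G + SL + Sq => -[S1 SG SSL SSq]; clearbody S.
exists rho, a, q, L, c0, K, S, k, (nrm (a p j0) / 2), j0; split => //.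
- move=> z zk; have Uz := UE z zk; split=> [Dz|rz].
    by have [] : [set z | U z /\ rho z < 0] z by rewrite -DU.
  by have [] : (D `&` U) z by rewrite DU.
- move=> z zk bz; have Uz := UE z zk.
  by have [] : [set z | U z /\ rho z = 0] z by rewrite -bU.
- by move=> z w zk wk; apply: T; [exact: lt_le_trans zk E1|exact: lt_le_trans wk E1].
- by move=> h; rewrite (le_trans (Lle h))// ler_wpM2r ?sqr_ge0.
- by move=> h; rewrite (le_trans (qle h))// ler_wpM2r ?sqr_ge0.
- move=> z w zk wk; rewrite (le_trans (Lip _ _ (lt_le_trans zk E2) (lt_le_trans wk E2)))//.
  by rewrite ler_wpM2r ?nrm_ge0.
- move=> e e0; pose N1 := 1 + #|'I_n|%:R : R; have N10 : 0 < N1 by rewrite /N1 ltr_wpDr.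
  have [l l0 Hl] := near_fin (fun j => acont j _ (divr_gt0 e0 N10)).
  exists l => // z h zl; rewrite clinB (le_trans (clin_le _ _))// ler_wpM2r ?nrm_ge0//.
  rewrite (le_trans (ler_sum _ (fun j _ => Hl j z zl)))//.
  by rewrite sumr_const -mulr_natr mulrAC ler_pdivrMr// ler_wpM2l ?(ltW e0)// /N1 lerDr.
- move=> z zk; have := Hk3 z (lt_le_trans zk E3).
  by have := nrm_sub (a p j0) (a z j0); rewrite nrmBC; move: (nrm _) (nrm _) (nrm _) => x y z'; lra.
Qed.

Lemma convex_ball (p x y : V) (t eta : R) : 0 <= t <= 1 ->
  nrm (x - p) < eta -> nrm (y - p) < eta ->
  nrm (ofreal (1 - t) *: x + ofreal t *: y - p) < eta.
Proof.
move=> /andP[t0 t1] xk yk.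
have -> : ofreal (1 - t) *: x + ofreal t *: y - p = ofreal (1 - t) *: (x - p) + ofreal t *: (y - p).
  by rewrite ofrealB ofreal1; apply/rowP => j; rewrite !mxE; ring.
rewrite (le_lt_trans (nrmD _ _))// !nrmZ !nrm_ofreal !ger0_norm ?subr_ge0//.
have [t10|t10] := eqVneq t 1; first by rewrite t10 subrr mul0r add0r mul1r.
have t11 : t < 1 by rewrite lt_neqAle t10.
nra.
Qed.

(** * Normal directions, quasi-convexity and peak polynomials from the Taylor expansion *)

Section FromTaylor.
Variables (D : set V) (p : V) (rho : V -> R) (a : V -> 'I_n -> cplx R)
  (q : 'I_n -> 'I_n -> cplx R) (L : V -> R) (c0 K S k m : R) (j0 : 'I_n).
Hypothesis tm : taylor_model D p rho a q L c0 K S k m j0.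

Lemma tm_first_order z w : nrm (z - p) < k -> nrm (w - p) < k ->
   `|rho w - rho z - re (clin (a z) (w - z))| <= (c0 / 8 + 2 * S) * nrm (w - z) ^+ 2.
Proof.
move=> zk wk; have := tm_taylor tm zk wk; have := tm_L tm (w - z).
have := le_trans (re_le_nrm _) (tm_q tm (w - z)); rewrite reD !ler_norml.
move: (rho w) (rho z) (re (clin _ _)) (re (cquad _ _)) (L _) (nrm _ ^+ 2) => x1 x2 x3 x4 x5 x6.
by move=> /andP[? ?] /andP[? ?] /andP[? ?]; apply/andP; split; lra.
Qed.

(** Since [a z j0] is bounded away from 0, a bounded multiple of the [j0]-th basis vector satisfies
    [clin (a z) e = -1]. *)
Lemma tm_normal z : nrm (z - p) < k -> exists2 e : V, nrm e <= m^-1 &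
  forall t : cplx R, nrm (z + t *: e - p) < k ->
    rho (z + t *: e) <= rho z - re t + (c0 / 8 + 2 * S) * m ^- 2 * nrm t ^+ 2.
Proof.
have [c00 K0 S1 k0 m0] := tm_pos tm.
move=> zk; have az := tm_nondeg tm zk.
have az0 : 0 < nrm (a z j0) by apply: lt_le_trans az.
pose e : V := - (a z j0)^-1 *: delta_mx 0 j0.
have ne : nrm e <= m^-1.
  apply: nrm_le_coord => [|j]; first by rewrite invr_ge0 ltW.
  rewrite !mxE eqxx /= nrmM nrmN nrmV.
  apply: (@le_trans _ _ ((nrm (a z j0))^-1 * 1)).
    by rewrite ler_wpM2l ?invr_ge0 ?nrm_ge0//; case: eqP => _; rewrite ?nrm1 ?nrm0.
  by rewrite mulr1 lef_pV2 ?posrE.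
have ae : clin (a z) e = -1.
  rewrite /clin (bigD1 j0)//= big1 ?addr0 => [|j jj]; last first.
    by rewrite !mxE eqxx (negbTE jj) /= !mulr0.
  by rewrite !mxE !eqxx /= mulr1 mulrN divff// -nrm_gt0.
exists e => // t tk; have := tm_first_order zk tk.
have -> : z + t *: e - z = t *: e by rewrite addrAC subrr add0r.
rewrite clinZ ae mulrN1 reN ler_norml nrmZ => /andP[_ h1].
set T := c0 / 8 + 2 * S in h1 *.
have T0 : 0 <= T by rewrite /T; lra.
have : T * (nrm t * nrm e) ^+ 2 <= T * m ^- 2 * nrm t ^+ 2.
  rewrite exprMn mulrCA mulrC ler_wpM2r ?sqr_ge0// ler_wpM2l// -exprVn.
  by rewrite ler_pXn2r ?nnegrE ?nrm_ge0// invr_ge0 ltW.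
move: h1; move: (T * m ^- 2 * _) (T * _) (rho _) (rho _) (re t); move=> *; lra.
Qed.

(** The function is expanded at the point [w] of the segment towards both ends; with the weights
    [1 - t] and [t] the linear terms cancel. *)
Lemma tm_quasi x y (t : R) : nrm (x - p) < k -> nrm (y - p) < k -> 0 <= t <= 1 ->
  rho (ofreal (1 - t) *: x + ofreal t *: y) <=
    (1 - t) * rho x + t * rho y + (c0 / 8 + 2 * S) * nrm (x - y) ^+ 2.
Proof.
have [c00 K0 S1 k0 m0] := tm_pos tm.
move=> xk yk tI; have wk := convex_ball tI xk yk; have /andP[t0 t1] := tI.
set w := ofreal (1 - t) *: x + ofreal t *: y in wk *.
have xw : x - w = ofreal t *: (x - y).
  by rewrite /w ofrealB ofreal1; apply/rowP => j; rewrite !mxE; ring.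
have yw : y - w = ofreal (- (1 - t)) *: (x - y).
  rewrite ofrealN scaleNr /w ofrealB ofreal1; apply/rowP => j; rewrite !mxE.
  by move: (ofreal t : cplx R) (x 0 j) (y 0 j) => u1 u2 u3; ring.
have := tm_first_order wk xk; have := tm_first_order wk yk; rewrite xw yw !clinZ !nrmZ !nrm_ofreal normrN.
have u1 : 0 <= 1 - t by rewrite subr_ge0.
rewrite (ger0_norm t0) (ger0_norm u1) !(reM (ofreal _)) !re_ofreal !im_ofreal !mul0r !subr0.
have T0 : 0 <= c0 / 8 + 2 * S by lra.
move: (c0 / 8 + 2 * S) T0 (re _) (nrm (x - y)) (nrm_ge0 (x - y)) (rho x) (rho y) (rho w).
move=> T T0 X N N0 rx ry rw.
rewrite !ler_norml => /andP[h1 _] /andP[h2 _].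
have Nn : 0 <= T * N ^+ 2 by rewrite mulr_ge0 ?sqr_ge0.
have s1 : T * ((1 - t) * N) ^+ 2 <= T * N ^+ 2.
  by rewrite ler_wpM2l// ler_pXn2r ?nnegrE ?mulr_ge0// ler_piMl//; lra.
have s2 : T * (t * N) ^+ 2 <= T * N ^+ 2.
  by rewrite ler_wpM2l// ler_pXn2r ?nnegrE ?mulr_ge0// ler_piMl.
have f1 : - (T * N ^+ 2) <= ry - rw - - (1 - t) * X by lra.
have f2 : - (T * N ^+ 2) <= rx - rw - t * X by lra.
have g1 := ler_wpM2l t0 f1; have g2 := ler_wpM2l u1 f2.
lra.
Qed.

(** The penalty is rewritten with the Levi polynomial at [z] instead of the linear form at [p]. The
    two replacements cost a factor 2 each, whence [4 K], and errors of order [e1^2 |h|^2] and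
    [|h|^4], absorbed by half of [c0]. *)
Lemma tm_penalty : exists2 eta : R, 0 < eta & eta <= k /\
  forall z w, nrm (z - p) < eta -> nrm (w - p) < eta ->
  c0 / 2 * nrm (w - z) ^+ 2 <= L (w - z) + 4 * K * nrm (clin (a z) (w - z) + cquad q (w - z)) ^+ 2 /\
  16 * K * (S + c0 / 8) ^+ 2 * nrm (w - z) ^+ 2 <= c0 / 16.
Proof.
have [c00 K0 S1 k0 m0] := tm_pos tm; have S0 := le_trans ler01 S1.
pose e1 := Num.min 1 (c0 / (32 * (K + 1))).
have e10 : 0 < e1 by rewrite lt_min ltr01 divr_gt0// mulr_gt0// ltr_wpDl.
have e1K : 2 * K * e1 ^+ 2 <= c0 / 16.
  have h1 : e1 <= 1 by rewrite ge_min lexx.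
  have h2 : e1 * (32 * (K + 1)) <= c0.
    by rewrite -ler_pdivlMr ?mulr_gt0 ?ltr_wpDl// ge_min lexx orbT.
  move: e1 e10 h1 h2 => e1 e10 h1 h2; nra.
clearbody e1.
have [k4 k40 Hk4] := tm_close tm e10.
pose A1 := 4 * K * S ^+ 2; pose A2 := 16 * K * (S + c0 / 8) ^+ 2.
have c16 : 0 < c0 / 16 by rewrite divr_gt0.
have [k5 k50 Hk5] := small_ex (4 * A1) c16.
have [k6 k60 Hk6] := small_ex (4 * A2) c16.
have half0 : 0 < 2^-1 :> R by rewrite invr_gt0.
pose eta := Num.min (Num.min k k4) (Num.min k5 (Num.min k6 2^-1)).
have eta0 : 0 < eta by rewrite !lt_min k0 k40 k50 k60 half0.
have etaP : [/\ eta <= k & eta <= k4] /\ [/\ eta <= k5, eta <= k6 & eta <= 2^-1].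
  by rewrite /eta; do 2!split; rewrite !ge_min lexx ?orbT.
have [[E1 E4] [E5 E6 E8]] := etaP; clearbody eta.
exists eta => //; split=> // z w zk wk; set h := w - z; have nh := nrm_ge0 h.
have nh2 : nrm h ^+ 2 <= 4 * eta.
  have hk : nrm h <= 2 * eta.
    have := nrm_tri p w z; rewrite (nrmBC p) -/h; move: zk wk.
    by move: (nrm _) (nrm _) (nrm _) => x1 x2 x3; move=> *; lra.
  have := ler_pM nh nh hk hk; rewrite -expr2; move: (nrm h ^+ 2) => x.
  nra.
have h20 := sqr_ge0 (nrm h); have etaW := ltW eta0.
have small1 : A1 * nrm h ^+ 2 <= c0 / 16.
  have A10 : 0 <= A1 by rewrite /A1 !mulr_ge0 ?sqr_ge0.
  apply: le_trans (ler_wpM2l A10 nh2) _; rewrite mulrCA mulrA; exact: Hk5.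
split; last first.
  have A20 : 0 <= A2 by rewrite /A2 mulr_ge0 ?sqr_ge0// mulr_ge0.
  apply: le_trans (ler_wpM2l A20 nh2) _; rewrite mulrCA mulrA; exact: Hk6.
set l := clin (a z) h + cquad q h.
have C0 := tm_coer tm h.
have B1 : nrm (clin (a p) h) <= nrm (clin (a z) h) + e1 * nrm h.
  have := nrm_sub (clin (a p) h) (clin (a z) h); rewrite nrmBC.
  have := Hk4 z h (lt_le_trans zk E4); move: (nrm _) (nrm _) (nrm _) (e1 * _); move=> *; lra.
have B2 : nrm (clin (a z) h) <= nrm l + S * nrm h ^+ 2.
  have := nrm_sub (clin (a z) h) (- cquad q h); rewrite opprK nrmN -/l.
  have := tm_q tm h; move: (nrm l) (nrm (clin _ _)) (nrm _) (S * _); move=> *; lra.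
move: B1 B2 C0 h20 e1K small1; rewrite /A1.
move: (nrm_ge0 l) (nrm_ge0 (clin (a z) h)) (nrm_ge0 (clin (a p) h)).
move: (nrm h) (nrm l) (nrm (clin (a z) h)) (nrm (clin (a p) h)) (L h).
move=> x y u v Lh y0 u0 v0 B1 B2 C0 h20 e1K small1.
have B3 : v ^+ 2 <= 2 * u ^+ 2 + 2 * (e1 * x) ^+ 2.
  have := ler_pM v0 v0 B1 B1; rewrite -!expr2; have := sqr_ge0 (u - e1 * x); lra.
have B4 : u ^+ 2 <= 2 * y ^+ 2 + 2 * (S * x ^+ 2) ^+ 2.
  have := ler_pM u0 u0 B2 B2; rewrite -!expr2; have := sqr_ge0 (y - S * x ^+ 2); lra.
have M1 := ler_wpM2l K0 B3; have M2 := ler_wpM2l K0 B4.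
have M3 := ler_wpM2r h20 e1K; have M4 := ler_wpM2r h20 small1.
have M5 := mulr_ge0 (ltW c00) h20.
by move: M1 M2 M3 M4; rewrite !exprMn; lra.
Qed.

(** To the Levi polynomial [l] one adds [4 K l^2], which by [peak_algebra] takes care of the
    penalty. The shift [v0 = - rho z + 16 K (rho z)^2] is the excess left by that estimate; it is at
    most [- 2 rho z] because [16 K (- rho z) <= 1/2]. *)
Lemma tm_peak : boundary D p -> exists2 eta : R, 0 < eta & eta <= k /\
  forall z, nrm (z - p) < eta -> D z -> exists P v0,
    [/\ is_poly P, P z = - ofreal v0, 0 < v0, v0 <= 2 * - rho z &
      forall w, nrm (w - p) < eta -> D w -> re (P w) <= rho w / 2 - c0 / 8 * nrm (w - z) ^+ 2].
Proof.
move=> bp; have [c00 K0 S1 k0 m0] := tm_pos tm; have S0 := le_trans ler01 S1.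
have [eta1 eta10 [etak1 pen]] := tm_penalty.
have half0 : 0 < 2^-1 :> R by rewrite invr_gt0.
have [k7 k70 Hk7] := small_ex (16 * K * S) half0.
exists (Num.min eta1 k7); first by rewrite lt_min eta10.
split=> [|z]; first by rewrite ge_min etak1.
have pk : nrm (p - p) < k by rewrite subrr nrm0.
have rp : rho p = 0 by exact: tm_bd tm _ pk bp.
have rho_lt w : nrm (w - p) < eta1 -> D w -> rho w < 0.
  by move=> wk Dw; apply/(tm_D tm) => //; exact: lt_le_trans wk etak1.
have rho_small w : nrm (w - p) < eta1 -> nrm (w - p) < k7 -> 16 * K * - rho w <= 2^-1.
  move=> wk wk7; have := tm_lip tm pk (lt_le_trans wk etak1); rewrite rp subr0 => h.
  have h' : - rho w <= S * nrm (w - p) by rewrite (le_trans _ h)// -normrN ler_norm.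
  have K16 : 0 <= 16 * K by rewrite mulr_ge0.
  rewrite (le_trans (ler_wpM2l K16 h'))// mulrA; apply: Hk7; rewrite ?nrm_ge0// ltW//.
rewrite lt_min => /andP[zk zk7] Dz.
have rz := rho_lt z zk Dz; have rzs := rho_small z zk zk7.
pose v0 := - rho z + 16 * K * rho z ^+ 2.
pose l w := clin (a z) (w - z) + cquad q (w - z).
have Pl : is_poly l by apply: is_poly_add; [exact: is_poly_clin|exact: is_poly_cquad].
have z0 : l z = 0.
  rewrite /l subrr; have h := tm_q tm 0; rewrite nrm0 expr0n mulr0 in h.
  have -> : cquad q 0 = 0 by apply/eqP; rewrite -nrm_eq0 eq_le h nrm_ge0.
  by rewrite -(scale0r (0 : V)) clinZ mul0r addr0.
have Krz : 0 <= K * rho z ^+ 2 by rewrite mulr_ge0 ?sqr_ge0.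
exists (fun w => - ofreal v0 + (l w + ofreal (4 * K) * (l w * l w))), v0; split.
- apply: is_poly_add; first exact: is_poly_cst.
  apply: is_poly_add => //; apply: is_poly_mul; first exact: is_poly_cst.
  exact: is_poly_mul.
- by rewrite z0 !mulr0 !addr0.
- by rewrite /v0; lra.
- have := ler_wpM2r (_ : 0 <= - rho z) rzs; rewrite oppr_ge0 => /(_ (ltW rz)).
  by rewrite /v0; lra.
move=> w; rewrite lt_min => /andP[wk wk7] Dw; rewrite reD reN re_ofreal.
have rw := rho_lt w wk Dw; have rws := rho_small w wk wk7.
have [pen1 pen2] := pen z w zk wk.
have T := tm_taylor tm (lt_le_trans zk etak1) (lt_le_trans wk etak1).
have := @peak_algebra (l w) (rho w) (rho z) (nrm (w - z) ^+ 2) (L (w - z)) (4 * K) S (c0 / 2) (c0 / 8)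
  (mulr_ge0 (ler0n _ 4) K0) (sqr_ge0 _) rw rz pen1 T (tm_L tm _) S0.
have [q1 q2 q3] := peak_constants c00 pen2 rws.
by move=> /(_ q1 q2 q3); rewrite -expr2; exact: peak_rearrange.
Qed.
End FromTaylor.

Lemma spc_local_model (D : set V) (p : V) : boundary D p ->
  C2_strongly_pseudoconvex_near D p -> exists rho eta C c, local_model D p rho eta C c.
Proof.
move=> bp spc; have [rho [a [q [L [c0 [K [S [k [m [j0 tm]]]]]]]]]] := spc_taylor_model bp spc.
have [c00 K0 S1 k0 m0] := tm_pos tm.
have [eta eta0 [etak peak]] := tm_peak tm bp.
pose T := c0 / 8 + 2 * S.
have T0 : 0 <= T by rewrite /T; lra.
have mm : 0 <= T * m ^- 2 by rewrite mulr_ge0// invr_ge0 sqr_ge0.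
have mi : 0 <= m^-1 by rewrite invr_ge0 ltW.
pose C := S + T + T * m ^- 2 + m^-1.
have CE : [/\ 1 <= C, S <= C, T <= C, T * m ^- 2 <= C & m^-1 <= C].
  by split; rewrite /C; move: (T * _) (m^-1) mm mi T0 S1 => y z; lra.
have [C1 CS CT Cm Cmi] := CE; clearbody C.
have lk z : nrm (z - p) < eta -> nrm (z - p) < k by move=> h; exact: lt_le_trans h etak.
exists rho, eta, C, (c0 / 8); split => //.
- by rewrite divr_gt0.
- by move=> z /lk; exact: (tm_D tm).
- by move=> z /lk; exact: (tm_bd tm).
- move=> z w /lk zk /lk wk; rewrite (le_trans (tm_lip tm zk wk))//.
  by rewrite ler_wpM2r ?nrm_ge0.
- move=> z /lk zk; have [e ne He] := tm_normal tm zk; exists e; first exact: le_trans Cmi.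
  move=> t /lk tk; rewrite (le_trans (He t tk))// lerD2l ler_wpM2r ?sqr_ge0//.
- move=> x y t /lk xk /lk yk tI; rewrite (le_trans (tm_quasi tm xk yk tI))// lerD2l ler_wpM2r ?sqr_ge0//.
Qed.
End LocalModel.

(** * Bounds for integrals through measurable minorants and majorants *)

Section LowerIntegral.
Variable R : realType.
Implicit Types (F h : R -> \bar R) (a b c x y : R).
Let mu := @lebesgue_measure R.

(** The integral of a nonnegative function is a supremum over the nonnegative simple functions below
    it, and this supremum is monotone by construction. *)
Lemma le_integral_unmeasurable F h (A : set R) :
  (forall t, A t -> (0 <= F t)%E) -> (forall t, A t -> (F t <= h t)%E) ->
  (\int[mu]_(t in A) F t <= \int[mu]_(t in A) h t)%E.
Proof.
move=> F0 Fh; have h0 t : A t -> (0 <= h t)%E by move=> At; exact: le_trans (F0 t At) (Fh t At).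
rewrite !ge0_integralE//; apply: le_ereal_sup => _ [g gF <-]; exists g => // t.
by apply: le_trans (gF t) _; rewrite !patchE; case: ifPn => // /set_mem /Fh.
Qed.

(** The value [v] at the junction will be 0 for minorants and [+oo] for majorants, since nothing is
    known about the integrand at a subdivision point. *)
Definition glue h1 h2 b (v : \bar R) : R -> \bar R :=
  fun t => if t < b then h1 t else if b < t then h2 t else v.

Lemma measurable_glue h1 h2 b v : measurable_fun setT h1 -> measurable_fun setT h2 ->
  measurable_fun setT (glue h1 h2 b v).
Proof.
move=> m1 m2; have mid : measurable_fun [set: R] (fun t : R => t) by exact: measurable_id.
have mb : measurable_fun [set: R] (fun=> b) by exact: measurable_cst.
apply: measurable_fun_ifT => //; first exact: measurable_fun_ltr.
by apply: measurable_fun_ifT => //; exact: measurable_fun_ltr.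
Qed.

Lemma glue_ge0 h1 h2 b v : (forall t, 0 <= h1 t)%E -> (forall t, 0 <= h2 t)%E -> (0 <= v)%E ->
  forall t, (0 <= glue h1 h2 b v t)%E.
Proof. by move=> h10 h20 v0 t; rewrite /glue; case: ifP => _ //; case: ifP. Qed.

Lemma measurable_restrict (A : set R) h : measurable_fun setT h -> measurable_fun A h.
Proof. by move=> mf; apply: measurable_funS mf. Qed.

Lemma integral_glue h1 h2 a b c v : a <= b -> b <= c ->
  measurable_fun setT h1 -> measurable_fun setT h2 ->
  (forall t, 0 <= h1 t)%E -> (forall t, 0 <= h2 t)%E -> (0 <= v)%E ->
  (\int[mu]_(t in `]a, c[) glue h1 h2 b v t =
   \int[mu]_(t in `]a, b[) h1 t + \int[mu]_(t in `]b, c[) h2 t)%E.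
Proof.
move=> ab bc m1 m2 h10 h20 v0.
have mg := measurable_glue b v m1 m2; have g0 := glue_ge0 b h10 h20 v0.
have [E|ab'] := eqVneq a b.
  rewrite -E set_itvoo0 ?lexx// integral_set0 add0e; apply: eq_integral => t /set_mem /=.
  by rewrite in_itv /= /glue => /andP[at_ _]; rewrite ltNge (ltW at_) /= at_.
have lt_ab : a < b by rewrite lt_neqAle ab ab'.
have [E|bc'] := eqVneq b c.
  rewrite -E [in X in (_ + X)%E]set_itvoo0 ?lexx// integral_set0 adde0; apply: eq_integral => t /set_mem /=.
  by rewrite in_itv /= /glue => /andP[_ tb]; rewrite tb.
have lt_bc : b < c by rewrite lt_neqAle bc bc'.
have -> : `]a, c[%classic = `]a, b] `|` `]b, c[ :> set R.
  apply/seteqP; split=> t /=; rewrite !in_itv /=.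
    by move=> /andP[at_ tc]; have [tb|tb] := leP t b; [left|right]; rewrite ?at_ ?tc.
  move=> [/andP[at_ tb]|/andP[bt tc]]; first by rewrite at_ (le_lt_trans tb).
  by rewrite tc andbT (lt_trans lt_ab).
rewrite ge0_integral_setU//=; last 2 first.
- exact: measurable_restrict.
- apply/disj_setPS => t [/=]; rewrite !in_itv /= => /andP[_ tb] /andP[bt _].
  by move: bt; rewrite ltNge tb.
rewrite integral_itv_bndoo; last exact: measurable_restrict.
congr (_ + _)%E; apply: eq_integral => t /set_mem /=; rewrite in_itv /= /glue => /andP[h1' h2'].
  by rewrite h2'.
by rewrite ltNge (ltW h1') h1'.
Qed.

(** Only the measurable function [h] is integrated, and it is compared with [F] on the open interval
    only; such bounds add up over adjacent intervals. *)
Definition int_minorized F a b x : Prop := exists h,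
  [/\ measurable_fun setT h, forall t, (0 <= h t)%E, forall t, a < t < b -> (h t <= F t)%E
    & (x%:E <= \int[mu]_(t in `]a, b[) h t)%E].

Definition int_majorized F a b x : Prop := exists h,
  [/\ measurable_fun setT h, forall t, (0 <= h t)%E, forall t, a < t < b -> (F t <= h t)%E
    & (\int[mu]_(t in `]a, b[) h t <= x%:E)%E].

Lemma int_minorized_add F a b c x y : a <= b -> b <= c -> (forall t, 0 <= F t)%E ->
  int_minorized F a b x -> int_minorized F b c y -> int_minorized F a c (x + y).
Proof.
move=> ab bc F0 [h1 [m1 h10 hF1 I1]] [h2 [m2 h20 hF2 I2]].
exists (glue h1 h2 b 0%E); split.
- exact: measurable_glue.
- exact: glue_ge0.
- move=> t /andP[at_ tc]; rewrite /glue; case: ifPn => tb; first by rewrite hF1// at_.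
  by case: ifPn => // bt; rewrite hF2// bt.
by rewrite integral_glue// EFinD leeD.
Qed.

Lemma int_majorized_add F a b c x y : a <= b -> b <= c ->
  int_majorized F a b x -> int_majorized F b c y -> int_majorized F a c (x + y).
Proof.
move=> ab bc [h1 [m1 h10 hF1 I1]] [h2 [m2 h20 hF2 I2]].
exists (glue h1 h2 b +oo%E); split.
- exact: measurable_glue.
- exact: glue_ge0.
- move=> t /andP[at_ tc]; rewrite /glue; case: ifPn => tb; first by rewrite hF1// at_.
  by case: ifPn => [bt|_]; rewrite ?leey// hF2// bt.
by rewrite integral_glue// EFinD leeD.
Qed.

Lemma int_minorized_le F a b x y : y <= x -> int_minorized F a b x -> int_minorized F a b y.
Proof.
by move=> yx [h [m h0 hF I]]; exists h; split=> //; apply: le_trans I; rewrite lee_fin.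
Qed.

Lemma int_minorized_nil F a b x : x <= 0 -> (forall t, 0 <= F t)%E -> int_minorized F a b x.
Proof.
move=> x0 F0; exists (cst 0%E); split=> //.
by rewrite integral0 lee_fin.
Qed.

Lemma integral_derivative (k K : R -> R) a b : a < b -> continuous k ->
  (forall t, a <= t <= b -> is_derive t 1 K (k t)) ->
  (\int[mu]_(t in `]a, b[) (k t)%:E = (K b - K a)%:E)%E.
Proof.
move=> ab ck dK.
rewrite -(@integral_itv_bndoo R a b (EFin \o k) true false); last first.
  apply: measurable_funS (_ : measurable_fun setT _) => //.
  by apply/measurable_EFinP; exact: continuous_measurable_fun.
rewrite EFinB; apply: continuous_FTC2 => //.
- exact: continuous_subspaceT.
- have cK t : a <= t <= b -> {for t, continuous K} by move=> /dK; exact: rder_continuous.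
  split.
  + by move=> t /[!in_itv] /= /andP[at_ tb]; have [] := dK t; rewrite ?ltW.
  + by apply: cvg_at_right_filter; apply: cK; rewrite lexx ltW.
  + by apply: cvg_at_left_filter; apply: cK; rewrite lexx ltW.
- move=> t /[!in_itv] /= /andP[at_ tb]; have d : is_derive t 1 K (k t) by apply: dK; rewrite !ltW.
  by rewrite derive1E derive_val.
Qed.

Lemma continuous_clamp (g : R -> R) a b : a <= b ->
  (forall t, a <= t <= b -> {for t, continuous g}) ->
  continuous (fun t => g (Num.min (Num.max t a) b)).
Proof.
move=> ab cg x; apply: (@continuous_comp _ _ _ (fun t => Num.min (Num.max t a) b) g); last exact/cg/clamp_bounds.
by apply: continuous_min; [apply: continuous_max|]; try exact: cvg_id; exact: cvg_cst.
Qed.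

Lemma int_minorized_derivative F (g G : R -> R) a b : a <= b -> (forall t, 0 <= F t)%E ->
  (forall t, a <= t <= b -> {for t, continuous g}) ->
  (forall t, a <= t <= b -> is_derive t 1 G (g t)) ->
  (forall t, a < t < b -> ((g t)%:E <= F t)%E) -> int_minorized F a b (G b - G a).
Proof.
move=> ab F0 cg dG gF; have [<-|ab'] := eqVneq a b.
  by apply: int_minorized_nil => //; rewrite subrr.
have lt_ab : a < b by rewrite lt_neqAle ab ab'.
(* A minorant must be nonnegative and measurable on the whole line: [g] is frozen outside [[a, b]]
   and cut at 0. The primitive [H] of the larger function increases at least as much as [G]. *)
pose h t := Num.max (g (Num.min (Num.max t a) b)) 0.
have ch : continuous h.
  by move=> t; apply: continuous_max; [exact: continuous_clamp|exact: cvg_cst].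
have [H HH] := primitive_ex lt_ab ch.
exists (EFin \o h); split.
- by apply/measurable_EFinP; exact: continuous_measurable_fun.
- by move=> t; rewrite lee_fin /h le_max lexx orbT.
- move=> t /andP[at_ tb]; rewrite /= /h clamp_id; last by rewrite (ltW at_) ltW.
  by rewrite maxEle; case: ifP => _; [exact: F0|apply: gF; rewrite at_].
rewrite (integral_derivative lt_ab ch HH) lee_fin.
have := @deriv_ge R (fun t => H t - G t) (fun t => h t - g t) a b 0 ab _ _.
rewrite mul0r => D; suff : 0 <= H b - G b - (H a - G a) by lra.
apply: D => t tI; first by have := HH t tI; have := dG t tI => *; exact: is_deriveB.
by rewrite subr_ge0 /h clamp_id// le_max lexx.
Qed.

Lemma int_majorized_derivative F (g G : R -> R) a b : a < b ->
  (forall t, a <= t <= b -> 0 <= g t) ->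
  (forall t, a <= t <= b -> {for t, continuous g}) ->
  (forall t, a <= t <= b -> is_derive t 1 G (g t)) ->
  (forall t, a < t < b -> (F t <= (g t)%:E)%E) -> int_majorized F a b (G b - G a).
Proof.
move=> ab g0 cg dG gF.
have ch := continuous_clamp (ltW ab) cg.
exists (EFin \o (fun t => g (Num.min (Num.max t a) b))); split.
- by apply/measurable_EFinP; exact: continuous_measurable_fun.
- by move=> t; rewrite lee_fin g0// clamp_bounds// ltW.
- by move=> t /andP[at_ tb]; rewrite /= clamp_id ?gF ?at_// (ltW at_) ltW.
have dG' t : a <= t <= b -> is_derive t 1 G (g (Num.min (Num.max t a) b)).
  by move=> tI; rewrite clamp_id//; exact: dG.
by rewrite (integral_derivative ab ch dG').
Qed.

Lemma le_integral_minorized F x : (forall t, 0 <= F t)%E ->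
  int_minorized F 0 1 x -> (x%:E <= \int[mu]_(t in `[0%R, 1%R]) F t)%E.
Proof.
move=> F0 [h [mh h0 hF I]]; apply: (le_trans I).
have m01 : measurable_fun setT (glue (fun=> 0%E) (glue h (fun=> 0%E) 1 0%E) 0 0%E).
  by do 2?[apply: measurable_glue => //]; exact: measurable_cst.
apply: (@le_trans _ _ (\int[mu]_(t in `[0%R, 1%R]) glue (fun=> 0%E) (glue h (fun=> 0%E) 1 0%E) 0 0%E t)%E).
  rewrite [leRHS]integral_itv_bndoo; last exact: measurable_restrict.
  rewrite le_eqVlt; apply/orP; left; apply/eqP; apply: eq_integral => t /set_mem /=.
  by rewrite in_itv /= /glue => /andP[t0 t1]; rewrite ltNge (ltW t0) t0 t1.
apply: le_integral_unmeasurable => t _; rewrite /glue.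
  by case: ifP => _ //; case: ifP => _ //; case: ifP => _ //; case: ifP.
case: ifP => // _; case: ifPn => // t0; case: ifPn => [t1|_]; first by rewrite hF// t0.
by case: ifP.
Qed.

Lemma integral_le_majorized F x : (forall t, 0 <= F t)%E ->
  int_majorized F 0 1 x -> (\int[mu]_(t in `[0%R, 1%R]) F t <= x%:E)%E.
Proof.
move=> F0 [h [mh h0 hF I]]; apply: (le_trans _ I).
have m01 : measurable_fun setT (glue (fun=> +oo%E) (glue h (fun=> +oo%E) 1 +oo%E) 0 +oo%E).
  by do 2?[apply: measurable_glue => //]; exact: measurable_cst.
apply: (@le_trans _ _ (\int[mu]_(t in `[0%R, 1%R]) glue (fun=> +oo%E) (glue h (fun=> +oo%E) 1 +oo%E) 0 +oo%E t)%E).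
  apply: le_integral_unmeasurable => t _ //; rewrite /glue.
  case: ifP => _; rewrite ?leey//; case: ifPn => [t0|_]; rewrite ?leey//; case: ifPn => [t1|_].
    by rewrite hF// t0.
  by case: ifP => _; rewrite leey.
rewrite [leLHS]integral_itv_bndoo; last exact: measurable_restrict.
rewrite le_eqVlt; apply/orP; left; apply/eqP; apply: eq_integral => t /set_mem /=.
by rewrite in_itv /= /glue => /andP[t0 t1]; rewrite ltNge (ltW t0) t0 t1.
Qed.
End LowerIntegral.

(** * Elementary bounds for the Kobayashi metric *)

Section Metric.
Variables (R : realType) (n : nat).
Notation V := 'Cn[R]_n.
Implicit Types (D : set V) (z xi e : V).

Lemma kobayashi_metric_ge0 D z xi : (0 <= kobayashi_metric D z xi)%E.
Proof.
apply: le_ereal_inf_tmp => _ [a [a0 _] <-]; by rewrite lee_fin invr_ge0 ltW.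
Qed.

Lemma kobayashi_metric_le D z xi (a : R) (g : cplx R -> V) : 0 < a ->
  (forall t : cplx R, nrm t < 1 -> (exists d, is_derive t 1 g d) /\ D (g t)) -> g 0 = z ->
  is_derive (0 : cplx R) 1 g (ofreal a *: xi) -> (kobayashi_metric D z xi <= a^-1%:E)%E.
Proof.
move=> a0 hg g0 dg; apply: ereal_inf_lbound; exists a => //; split=> //; exists g; split=> //.
  move=> t; rewrite normE -[1]/(ofreal 1) ofreal_lt => t1; have [[d hd] Dt] := hg t t1.
  by split=> //; exact: (@ex_derive _ _ _ _ _ _ _ hd).
by rewrite derive1E; apply: derive_val.
Qed.

Lemma kobayashi_metric_ge D z xi (m : R) :
  (forall (a : R) (g : cplx R -> V), 0 < a ->
    (forall t : cplx R, nrm t < 1 -> (exists d, is_derive t 1 g d) /\ D (g t)) -> g 0 = z ->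
    is_derive (0 : cplx R) 1 g (ofreal a *: xi) -> m <= a^-1) ->
  (m%:E <= kobayashi_metric D z xi)%E.
Proof.
move=> H; apply: le_ereal_inf_tmp => _ [a [a0 [g [hg g0 dg]]] <-]; rewrite lee_fin.
have hg' t : nrm t < 1 -> derivable g t 1 /\ D (g t).
  by move=> t1; apply: hg; rewrite normE -[1]/(ofreal 1) ofreal_lt.
apply: (H a g a0 _ g0 _).
  move=> t t1; have [dt Dt] := hg' t t1; split; last exact: Dt.
  by exists ('D_1 g t); exact: (@derivableP _ _ _ _ _ _ dt).
have n0 : nrm (0 : cplx R) < 1 by rewrite nrm0.
have [d0 _] := hg' 0 n0; have P := @derivableP _ _ _ _ _ _ d0.
by rewrite -derive1E dg in P.
Qed.

Lemma is_derive_line z e (c d : cplx R -> cplx R) (t : cplx R) :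
  is_derive t 1 c (d t) -> is_derive t 1 (fun s => z + c s *: e) (d t *: e).
Proof.
move=> /cderP H; apply/cderP => x x0.
have N0 : 0 < 1 + nrm e by rewrite ltr_wpDr ?nrm_ge0.
have [k k0 Hk] := H _ (divr_gt0 x0 N0).
exists k => // h /Hk {}Hk.
have -> : z + c (t + h) *: e - (z + c t *: e) - h *: (d t *: e) = (c (t + h) - c t - h *: d t) *: e.
  by apply/rowP => j; rewrite !mxE /GRing.scale /=; ring.
rewrite nrmZ (le_trans (ler_wpM2r (nrm_ge0 e) Hk))//.
rewrite mulrAC ler_wpM2r ?nrm_ge0// mulrAC ler_pdivrMr// ler_wpM2l ?(ltW x0)// lerDr//.
Qed.

Lemma kobayashi_metric_ball D z xi (r s : R) : 0 < r -> 0 < s ->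
  (forall w, nrm (w - z) < r -> D w) -> nrm xi <= s -> (kobayashi_metric D z xi <= (s / r)%:E)%E.
Proof.
move=> r0 s0 hD xs; rewrite -invf_div.
have rs : 0 < r / s by rewrite divr_gt0.
have D1 (t : cplx R) : is_derive t 1 (fun s' => z + (s' * ofreal (r / s)) *: xi) (ofreal (r / s) *: xi).
  apply: (@is_derive_line z xi (fun s' => s' * ofreal (r / s)) (fun=> ofreal (r / s))).
  apply/cderP => e e0; exists 1 => // h _.
  have -> : (t + h) * ofreal (r / s) - t * ofreal (r / s) - h *: ofreal (r / s) = 0.
    by rewrite /GRing.scale /=; ring.
  by rewrite nrm0 mulr_ge0 ?nrm_ge0// ltW.
apply: (kobayashi_metric_le (g := fun t => z + (t * ofreal (r / s)) *: xi)) => //.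
  move=> t t1; split; first by exists (ofreal (r / s) *: xi).
  apply: hD; rewrite addrAC subrr add0r nrmZ nrmM nrm_ofreal ger0_norm ?(ltW rs)//.
  apply: (@le_lt_trans _ _ (nrm t * (r / s) * s)).
    by rewrite ler_wpM2l// mulr_ge0 ?nrm_ge0// ltW.
  by rewrite -mulrA divfK ?gt_eqF// gtr_pMl.
by rewrite mul0r scale0r addr0.
Qed.

(** A competing disc for [xi] is precomposed with the rotation by [c / |c|], which preserves the
    unit disc; the positive factor [|c|] goes into [alpha]. The margin [e] is there because the
    infimum may not be attained. *)
Lemma kobayashi_metricZ D z xi (c : cplx R) (x : R) : c != 0 ->
  (kobayashi_metric D z xi <= x%:E)%E -> (kobayashi_metric D z (c *: xi) <= (nrm c * x)%:E)%E.
Proof.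
move=> c0 h; have nc : 0 < nrm c by rewrite nrm_gt0.
apply/lee_addgt0Pr => e e0; rewrite -EFinD.
have e1 : 0 < e / nrm c by rewrite divr_gt0.
have : (kobayashi_metric D z xi < (x + e / nrm c)%:E)%E.
  by apply: (le_lt_trans h); rewrite lte_fin ltrDl.
move=> /ereal_inf_lt[_ [a [a0 [g [hg g0 dg]]] <-]]; rewrite lte_fin => ax.
have hg' t : nrm t < 1 -> derivable g t 1 /\ D (g t).
  by move=> t1; apply: hg; rewrite normE -[1]/(ofreal 1) ofreal_lt.
pose u := c / ofreal (nrm c).
have nu : nrm u = 1 by rewrite nrmM nrmV nrm_ofreal ger0_norm ?nrm_ge0// divff// gt_eqF.
have du (t : cplx R) : nrm t < 1 -> exists2 d, is_derive (u * t) 1 g d & is_derive t 1 (fun s => g (u * s)) (u *: d).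
  move=> t1; have ut : nrm (u * t) < 1 by rewrite nrmM nu mul1r.
  have [dt Dt] := hg' _ ut.
  have P := @derivableP _ _ _ _ _ _ dt; exists ('D_1 g (u * t)); first exact: P.
  have /cderP H := P; apply/cderP => y /H[k k0 Hk]; exists k => // h' hk.
  have nh : nrm (u * h') = nrm h' by rewrite nrmM nu mul1r.
  have := Hk (u * h'); rewrite nh => /(_ hk); rewrite mulrDr.
  by rewrite scalerA (mulrC h').
apply: (@le_trans _ _ ((a / nrm c)^-1)%:E); last first.
  rewrite lee_fin invf_div; have := ler_wpM2l (ltW nc) (ltW ax).
  by rewrite mulrDr [nrm c * (e / _)]mulrC divfK ?gt_eqF.
apply: (kobayashi_metric_le (g := fun t => g (u * t))); first exact: divr_gt0.
- move=> t t1; have [d _ h2] := du t t1; split; first by exists (u *: d).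
  have ut : nrm (u * t) < 1 by rewrite nrmM nu mul1r.
  exact: (hg' _ ut).2.
- by rewrite mulr0.
have [|d h1 h2] := du 0; first by rewrite nrm0.
have E : d = ofreal a *: xi.
  by rewrite -dg derive1E; rewrite mulr0 in h1; rewrite derive_val.
have -> : ofreal (a / nrm c) *: (c *: xi) = u *: d; last exact: h2.
by rewrite E !scalerA; congr (_ *: _); rewrite /u ofrealM ofrealV; ring.
Qed.

Lemma moebius_disc (a : R) (t : cplx R) : `|a| < 1 -> nrm t < 1 ->
  1 + ofreal a * t != 0 /\ nrm ((t + ofreal a) / (1 + ofreal a * t)) < 1.
Proof.
move=> a1 t1.
have d0 : 0 < nrm (1 + ofreal a * t : cplx R).
  have := nrm_sub (1 : cplx R) (- (ofreal a * t)); rewrite opprK nrm1 nrmN nrmM nrm_ofreal.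
  have : `|a| * nrm t < 1 by have := normr_ge0 a; have := nrm_ge0 t; nra.
  lra.
split; first by rewrite -nrm_gt0.
rewrite nrmM nrmV ltr_pdivrMr// mul1r -(ltr_pXn2r (n := 2)) ?nnegrE ?nrm_ge0//.
rewrite !sqr_nrm !reD !imD reM imM !re_ofreal !im_ofreal ?re1 ?im1.
have : re t ^+ 2 + im t ^+ 2 < 1 by rewrite -sqr_nrm expr_lt1 ?nrm_ge0.
have : a ^+ 2 < 1 by rewrite -real_normK ?num_real// expr_lt1.
move: (re t) (im t) => x y h1 h2.
have := mulr_gt0 (_ : 0 < 1 - a ^+ 2) (_ : 0 < 1 - (x ^+ 2 + y ^+ 2)).
rewrite !subr_gt0 => /(_ h1 h2); lra.
Qed.

End Metric.

Lemma derivable_moebius (K : numFieldType) (r T a t : K) : 1 + a * t != 0 ->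
  is_derive t 1 (fun s => r + T * ((s + a) / (1 + a * s))) (T * (1 - a ^+ 2) / (1 + a * t) ^+ 2).
Proof.
move=> h0.
have d1 : is_derive t 1 (fun s : K => s + a) 1.
  by apply: is_derive_eq; rewrite addr0.
have d2 : is_derive t 1 (fun s : K => 1 + a * s) a.
  by apply: is_derive_eq; rewrite /GRing.scale /=; ring.
have d3 : is_derive t 1 (fun s : K => (1 + a * s)^-1) (- (1 + a * t) ^- 2 *: a).
  have dv : derivable (fun s : K => 1 + a * s) t 1 := @ex_derive _ _ _ _ _ _ _ d2.
  split; first exact: derivableV.
  by rewrite deriveV// (@derive_val _ _ _ _ _ _ _ d2).
apply: is_derive_eq; rewrite /GRing.scale /=; field; exact: h0.
Qed.

(** * Upper bound for the metric in the normal direction *)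

Section NormalDisc.
Variables (R : realType) (n : nat).
Notation V := 'Cn[R]_n.

(** On the complex normal line at a point of depth [d], [normal_metric] uses the disc of centre [r]
    and radius [T], which requires [T^2 <= r^2 + 2 r d]. This [T] is the second order expansion of
    the square root and keeps the computation rational. The Moebius parameter [a] places the centre
    at [t], and the inverse of [T (1 - a^2)] is the half sum of the inverses of [T + t - r] and
    [T + r - t]; the first of them carries the singularity. *)
Lemma normal_metric_arith (r d t : R) : 0 < d -> d <= r -> 0 <= t -> t <= r ->
  let T := r + d - d ^+ 2 / (2 * r) in let a := (t - r) / T in
  [/\ 0 < T, `|a| < 1, T ^+ 2 <= r ^+ 2 + 2 * r * d, r + T * a = t
    & 0 < T * (1 - a ^+ 2) /\ (T * (1 - a ^+ 2))^-1 <= (2 * (d + t))^-1 + r^-1].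
Proof.
move=> d0 dr t0 tr T a.
have r0 : 0 < r by exact: lt_le_trans dr.
pose y := d ^+ 2 / (2 * r); have TE : T = r + d - y by [].
clearbody T.
have y0 : 0 <= y by rewrite divr_ge0 ?sqr_ge0// mulr_ge0// ltW.
have yr : y * (2 * r) = d ^+ 2 by rewrite divfK// gt_eqF// mulr_gt0.
have yd : y <= d / 2 by rewrite ler_pdivrMr ?mulr_gt0//; nra.
have T0 : 0 < T by rewrite TE; lra.
have x1 : 0 < d + t - y by lra.
have x2 : r <= T + r - t by rewrite TE; lra.
have aT : a * T = t - r by rewrite divfK// gt_eqF.
have Tt : T + t - r = d + t - y by rewrite TE; ring.
have T2 : T ^+ 2 <= r ^+ 2 + 2 * r * d by rewrite TE; nra.
have x1' : 0 < T + t - r by rewrite Tt.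
have x2' : 0 < T + r - t by exact: lt_le_trans x2.
have E : T * (1 - a ^+ 2) = (T + t - r) * (T + r - t) / T by rewrite /a; field; rewrite gt_eqF.
split => //.
- by rewrite ltr_norml ltr_pdivlMr// ltr_pdivrMr// mulN1r mul1r; apply/andP; split; lra.
- by rewrite mulrC aT; ring.
split; first by rewrite E divr_gt0// mulr_gt0.
have -> : (T * (1 - a ^+ 2))^-1 = 2^-1 * ((T + t - r)^-1 + (T + r - t)^-1).
  by rewrite E; field; rewrite !gt_eqF.
have b1 : (T + r - t)^-1 <= r^-1 by rewrite lef_pV2 ?posrE.
have dt : 0 < d + t by rewrite ltr_wpDr.
have b2 : (T + t - r)^-1 <= (d + t)^-1 + r^-1.
  rewrite Tt -subr_ge0.
  have -> : (d + t)^-1 + r^-1 - (d + t - y)^-1 = ((d + t) * (d + t - y) - y * r) / ((d + t) * r * (d + t - y)).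
    by field; rewrite !gt_eqF.
  rewrite divr_ge0 ?mulr_ge0 ?(ltW dt) ?(ltW r0) ?(ltW x1)// subr_ge0.
  nra.
have -> : (2 * (d + t))^-1 = 2^-1 * (d + t)^-1 by rewrite invfM.
lra.
Qed.

Lemma normal_metric (D : set V) (p : V) rho eta (C c : R) : local_model D p rho eta C c ->
  exists r : R, 0 < r /\ forall z, nrm (z - p) < eta / 2 -> rho z < 0 -> - rho z <= r ->
  exists2 e : V, nrm e <= C & 
    (forall t : R, 0 <= t -> t <= r ->
      nrm (z + ofreal t *: e - p) < eta /\ rho (z + ofreal t *: e) <= rho z - t + C * t ^+ 2) /\
    (forall t : R, 0 <= t -> t <= r ->
      D (z + ofreal t *: e) /\
      (kobayashi_metric D (z + ofreal t *: e) e <= ((2 * (- rho z + t))^-1 + r^-1)%:E)%E).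
Proof.
move=> lm; have eta0 := lm_eta lm; have C1 := lm_C lm.
have C0 : 0 < C by exact: lt_le_trans C1.
pose r := Num.min (2 * C)^-1 (eta / (8 * C)).
have r0 : 0 < r by rewrite lt_min invr_gt0 divr_gt0 ?mulr_gt0.
have rC : 2 * C * r <= 1 by rewrite mulrC -ler_pdivlMr ?mulr_gt0// div1r ge_min lexx.
have re_ : 8 * C * r <= eta by rewrite mulrC -ler_pdivlMr ?mulr_gt0// ge_min lexx orbT.
clearbody r; exists r; split=> // z zp rz rzr.
have zeta : nrm (z - p) < eta by lra.
have [e eC He] := lm_normal lm zeta; exists e => //.
have near (w : cplx R) : nrm w <= 3 * r -> nrm (z + w *: e - p) < eta.
  move=> wr; rewrite addrAC (le_lt_trans (nrmD _ _))// nrmZ.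
  have := ler_pM (nrm_ge0 _) (nrm_ge0 _) wr eC; have := mulr_gt0 C0 r0; lra.
split=> t t0 tr.
  have nt : nrm (z + ofreal t *: e - p) < eta by apply: near; rewrite nrm_ofreal ger0_norm//; lra.
  by split=> //; have := He (ofreal t) nt; rewrite re_ofreal nrm_ofreal ger0_norm.
have d0 : 0 < - rho z by rewrite oppr_gt0.
have [] := normal_metric_arith d0 rzr t0 tr; set T := r + _ - _; set a := (t - r) / T.
move=> T0 a1 T2 raT [] Ta0 Tab.
(* On this disc [|w|^2 < 2 r (- rho z + Re w)], and [2 C r <= 1] makes the quadratic error of
   [lm_normal] smaller than the linear gain. *)
have disc (w : cplx R) : nrm (w - ofreal r) < T -> D (z + w *: e).
  move=> wT.
  have w2 : nrm w ^+ 2 < 2 * r * (- rho z + re w).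
    have : nrm (w - ofreal r) ^+ 2 < T ^+ 2 by rewrite ltr_pXn2r ?nnegrE ?nrm_ge0// ltW.
    rewrite !sqr_nrm reB imB re_ofreal im_ofreal subr0; lra.
  have wr : nrm w <= 3 * r.
    have Tr : T <= 2 * r.
      rewrite /T; have : 0 <= (- rho z) ^+ 2 / (2 * r) by rewrite divr_ge0 ?sqr_ge0// mulr_ge0// ltW.
      lra.
    have := nrm_sub w (ofreal r); rewrite nrm_ofreal ger0_norm ?(ltW r0)//; lra.
  apply/(lm_D lm (near w wr)); apply: le_lt_trans (He w (near w wr)) _.
  have : C * nrm w ^+ 2 < - rho z + re w.
    have w20 := sqr_ge0 (nrm w); have x0 : 0 < - rho z + re w.
      have := le_lt_trans w20 w2; rewrite pmulr_rgt0//; lra.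
    have := ler_wpM2l (ltW C0) (ltW w2); have := ler_wpM2r (ltW x0) rC.
    have := ltr_pM2l C0 (nrm w ^+ 2) (2 * r * (- rho z + re w)); rewrite w2; lra.
  lra.
have rT : nrm (ofreal t - ofreal r) < T.
  rewrite -ofrealB nrm_ofreal; have -> : t - r = T * a by rewrite -raT; ring.
  by rewrite normrM (gtr0_norm T0) gtr_pMr.
split; first exact: disc.
apply: le_trans (kobayashi_metric_le (a := T * (1 - a ^+ 2))
  (g := fun s => z + (ofreal r + ofreal T * ((s + ofreal a) / (1 + ofreal a * s))) *: e) Ta0 _ _ _) _.
- move=> s s1; have [m0 m1] := moebius_disc a1 s1; split.
    have dg := @is_derive_line R n z e
      (fun s => ofreal r + ofreal T * ((s + ofreal a) / (1 + ofreal a * s)))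
      (fun s => ofreal T * (1 - ofreal a ^+ 2) / (1 + ofreal a * s) ^+ 2) s
      (derivable_moebius (ofreal r) (ofreal T) m0).
    by eexists; exact: dg.
  by apply: disc; rewrite addrAC subrr add0r nrmM nrm_ofreal gtr0_norm// gtr_pMr.
- by rewrite mulr0 addr0 divr1 add0r -ofrealM -ofrealD raT.
- have m0 : 1 + ofreal a * 0 != 0 :> cplx R by rewrite mulr0 addr0 oner_eq0.
  have := @is_derive_line R n z e (fun s => ofreal r + ofreal T * ((s + ofreal a) / (1 + ofreal a * s)))
     (fun s => ofreal T * (1 - ofreal a ^+ 2) / (1 + ofreal a * s) ^+ 2) 0
     (derivable_moebius (ofreal r) (ofreal T) m0).
  have -> : ofreal T * (1 - ofreal a ^+ 2) / (1 + ofreal a * 0) ^+ 2 = ofreal (T * (1 - a ^+ 2)) :> cplx R.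
    by rewrite mulr0 addr0 expr1n divr1 expr2 -ofrealM -expr2 -[1]/(ofreal 1) -ofrealB -ofrealM.
  by [].
by rewrite lee_fin.
Qed.
End NormalDisc.

(** * Kobayashi length of broken lines with three segments *)

Section Polyline.
Variables (R : realType) (n : nat).
Notation V := 'Cn[R]_n.
Implicit Types (D : set V) (p q v : V) (gamma : R -> V).

Lemma is_derive_affine (K : R -> R) (a b t d : R) :
  is_derive (a * t + b) 1 K d -> is_derive t 1 (fun s => K (a * s + b)) (a * d).
Proof.
move=> h; have g : is_derive t 1 (fun s : R => a * s + b) a.
  by apply: is_derive_eq; rewrite /GRing.scale /=; ring.
by have := @is_derive1_comp R K (fun s => a * s + b) t d a h g; rewrite mulrC.
Qed.

Lemma continuous_affine (k : R -> R) (a b t : R) :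
  {for a * t + b, continuous k} -> {for t, continuous (fun s => k (a * s + b))}.
Proof.
move=> h; apply: (@continuous_comp _ _ _ (fun s : R => a * s + b) k) => //.
have g : is_derive t 1 (fun s : R => a * s + b) a.
  by apply: is_derive_eq; rewrite /GRing.scale /=; ring.
exact: rder_continuous g.
Qed.

Lemma is_derive_locally_affine (g : R -> R) (t k a b : R) : 0 < k ->
  (forall s, `|s - t| < k -> g s = a + s * b) -> is_derive t 1 g b.
Proof.
move=> k0 H; apply/rderP => e e0; exists k => // h hk.
rewrite !H ?subrr ?normr0//; last by rewrite addrAC subrr add0r.
by rewrite (_ : _ - _ - _ = 0) ?normr0 ?mulr_ge0 ?(ltW e0)//; ring.
Qed.

Lemma reim_line q v (s : R) j :
  re ((q + ofreal s *: v) 0 j) = re (q 0 j) + s * re (v 0 j) /\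
  im ((q + ofreal s *: v) 0 j) = im (q 0 j) + s * im (v 0 j).
Proof. by rewrite !mxE reD imD reM imM re_ofreal im_ofreal !mul0r subr0 addr0. Qed.

Lemma velocity_locally_affine gamma (t k : R) q v : 0 < k ->
  (forall s, `|s - t| < k -> gamma s = q + ofreal s *: v) -> velocity gamma t = v.
Proof.
move=> k0 H; apply/rowP => j; rewrite mxE !derive1E.
have dr : is_derive t 1 (re_coord gamma j) (re (v 0 j)).
  apply: (is_derive_locally_affine (a := re (q 0 j)) k0) => s /H e.
  by rewrite /re_coord e; have [] := reim_line q v s j.
have di : is_derive t 1 (im_coord gamma j) (im (v 0 j)).
  apply: (is_derive_locally_affine (a := im (q 0 j)) k0) => s /H e.
  by rewrite /im_coord e; have [] := reim_line q v s j.
by rewrite !derive_val; exact: cplx_eq.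
Qed.

Lemma C1_affine q v : C1_curve (fun t : R => q + ofreal t *: v).
Proof.
split.
  move=> t j; split.
    have h : is_derive t 1 (re_coord (fun t : R => q + ofreal t *: v) j) (re (v 0 j)).
      apply: (is_derive_locally_affine (a := re (q 0 j)) (@ltr01 R)) => s _.
      by rewrite /re_coord; have [] := reim_line q v s j.
    by case: h.
  have h : is_derive t 1 (im_coord (fun t : R => q + ofreal t *: v) j) (im (v 0 j)).
    apply: (is_derive_locally_affine (a := im (q 0 j)) (@ltr01 R)) => s _.
    by rewrite /im_coord; have [] := reim_line q v s j.
  by case: h.
have -> : velocity (fun t : R => q + ofreal t *: v) = fun=> v.
  by apply: funext => t; apply: (velocity_locally_affine (@ltr01 R)).
exact: cst_continuous.
Qed.

(** A bound [k] of the metric along the segment comes with a primitive [K], so that [c] bounds the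
    length and bounds can be reversed and reparametrized without integrals. *)
Definition seg_bound D p v (c : R) : Prop := exists k K : R -> R,
  (forall t, 0 <= t <= 1 -> [/\ 0 <= k t, {for t, continuous k}, is_derive t 1 K (k t),
    D (p + ofreal t *: v) & (kobayashi_metric D (p + ofreal t *: v) v <= (k t)%:E)%E]) /\
  K 1 - K 0 <= c.

Lemma seg_bound_rev D p v c : seg_bound D p v c -> seg_bound D (p + v) (- v) c.
Proof.
move=> [k [K [H Kc]]]; exists (fun t => k (-1 * t + 1)), (fun t => - K (-1 * t + 1)); split; last first.
  by rewrite (_ : -1 * 1 + 1 = 0); [rewrite (_ : -1 * 0 + 1 = 1); [lra|ring]|ring].
move=> t tI; have tI' : 0 <= -1 * t + 1 <= 1 by lra.
have [k0 ck dK Dt Fk] := H _ tI'.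
have E : p + v + ofreal t *: - v = p + ofreal (-1 * t + 1) *: v.
  have -> : -1 * t + 1 = 1 - t by ring.
  by rewrite scalerN -addrA ofrealB ofreal1 scalerBl scale1r.
split => //; rewrite ?E//.
- exact: continuous_affine.
- have h := is_derive_affine dK.
  by apply: is_derive_eq; ring.
have /(kobayashi_metricZ (_ : -1 != 0 :> cplx R)) := Fk.
by rewrite nrmN nrm1 mul1r scaleN1r; apply; rewrite oppr_eq0 oner_eq0.
Qed.

Lemma seg_bound_ball D p v (r s : R) : 0 < r -> 0 < s -> nrm v <= s ->
  (forall t : R, 0 <= t <= 1 -> forall w, nrm (w - (p + ofreal t *: v)) < r -> D w) ->
  seg_bound D p v (s / r).
Proof.
move=> r0 s0 vs H; exists (fun=> s / r), (fun t => t * (s / r)); split; last by lra.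
move=> t tI; split.
- by rewrite divr_ge0 ?ltW.
- exact: cst_continuous.
- by apply: is_derive_eq; rewrite /GRing.scale /= mulr0 add0r mulr1.
- by apply: (H t tI); rewrite subrr nrm0.
- exact: kobayashi_metric_ball (H t tI) vs.
Qed.

Definition clamp01 (x : R) : R := Num.min (Num.max x 0) 1.

(** There are three segments because the curves of the upper bound leave the boundary, cross, and
    return to it. Clamping gives one formula, valid for all real [t]. *)
Definition polyline p v0 v1 v2 : R -> V := fun t =>
  p + ofreal (clamp01 (3 * t)) *: v0 + ofreal (clamp01 (3 * t - 1)) *: v1
    + ofreal (clamp01 (3 * t - 2)) *: v2.

Lemma clamp01_le0 x : x <= 0 -> clamp01 x = 0.
Proof. by move=> x0; rewrite /clamp01 max_r// min_l. Qed.
Lemma clamp01_ge1 x : 1 <= x -> clamp01 x = 1.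
Proof. by move=> x1; rewrite /clamp01 max_l ?min_r// (le_trans ler01). Qed.
Lemma clamp01_id x : 0 <= x <= 1 -> clamp01 x = x.
Proof. by move=> /andP[x0 x1]; rewrite /clamp01 max_l// min_l. Qed.
Lemma clamp01_lip x y : `|clamp01 x - clamp01 y| <= `|x - y|.
Proof.
have aux a : [\/ a <= 0 /\ clamp01 a = 0, 1 <= a /\ clamp01 a = 1 | 0 <= a <= 1 /\ clamp01 a = a].
  have [a0|a0] := leP a 0; first by constructor 1; rewrite clamp01_le0.
  have [a1|a1] := leP 1 a; first by constructor 2; rewrite clamp01_ge1.
  by constructor 3; rewrite clamp01_id ?(ltW a0) ?(ltW a1).
have h1 := ler_norm (x - y); have h2 := ler_norm (y - x); rewrite distrC in h2.
rewrite ler_norml; move: (`|x - y|) h1 h2 => N h1 h2.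
by case: (aux x) => -[? ->]; case: (aux y) => -[? ->]; apply/andP; split; lra.
Qed.

Section Fixed.
Variables (p v0 v1 v2 : V).
Let gamma := polyline p v0 v1 v2.

Lemma polyline0 t : 0 <= t <= 3^-1 -> gamma t = p + ofreal (3 * t) *: v0.
Proof.
move=> tI.
have e0 : clamp01 (3 * t) = 3 * t by apply: clamp01_id; lra.
have e1 : clamp01 (3 * t - 1) = 0 by apply: clamp01_le0; lra.
have e2 : clamp01 (3 * t - 2) = 0 by apply: clamp01_le0; lra.
by rewrite /gamma /polyline e0 e1 e2 !scale0r !addr0.
Qed.
Lemma polyline1 t : 3^-1 <= t <= 2 / 3 -> gamma t = p + v0 + ofreal (3 * t - 1) *: v1.
Proof.
move=> tI.
have e0 : clamp01 (3 * t) = 1 by apply: clamp01_ge1; lra.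
have e1 : clamp01 (3 * t - 1) = 3 * t - 1 by apply: clamp01_id; lra.
have e2 : clamp01 (3 * t - 2) = 0 by apply: clamp01_le0; lra.
by rewrite /gamma /polyline e0 e1 e2 ofreal1 scale1r scale0r addr0.
Qed.
Lemma polyline2 t : 2 / 3 <= t <= 1 -> gamma t = p + v0 + v1 + ofreal (3 * t - 2) *: v2.
Proof.
move=> tI.
have e0 : clamp01 (3 * t) = 1 by apply: clamp01_ge1; lra.
have e1 : clamp01 (3 * t - 1) = 1 by apply: clamp01_ge1; lra.
have e2 : clamp01 (3 * t - 2) = 3 * t - 2 by apply: clamp01_id; lra.
by rewrite /gamma /polyline e0 e1 e2 ofreal1 !scale1r.
Qed.

Lemma polyline_continuous : continuous gamma.
Proof.
move=> t; apply/continuous_abs_nrmP => e e0.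
pose N := 3 * (nrm v0 + nrm v1 + nrm v2) + 1.
have N0 : 0 < N by rewrite ltr_wpDl// mulr_ge0// !addr_ge0 ?nrm_ge0.
exists (e / N); first exact: divr_gt0.
move=> s; rewrite ltr_pdivlMr// => se.
have -> : gamma s - gamma t = ofreal (clamp01 (3 * s) - clamp01 (3 * t)) *: v0 +
   ofreal (clamp01 (3 * s - 1) - clamp01 (3 * t - 1)) *: v1 +
   ofreal (clamp01 (3 * s - 2) - clamp01 (3 * t - 2)) *: v2.
  rewrite /gamma /polyline !ofrealB !scalerBl.
  move: (ofreal _ *: v0) (ofreal _ *: v0) (ofreal _ *: v1) (ofreal _ *: v1) (ofreal _ *: v2) (ofreal _ *: v2).
  move=> a b c d x y; apply/rowP => j; rewrite !mxE.
  by move: (p 0 j) (a 0 j) (b 0 j) (c 0 j) (d 0 j) (x 0 j) (y 0 j) => *; ring.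
apply: le_lt_trans se.
have L a : `|clamp01 (3 * s - a) - clamp01 (3 * t - a)| <= 3 * `|s - t|.
  rewrite (le_trans (clamp01_lip _ _))//.
  have -> : 3 * s - a - (3 * t - a) = 3 * (s - t) by ring.
  by rewrite normrM ger0_norm.
rewrite (le_trans (nrmD _ _))// (le_trans (lerD (nrmD _ _) (lexx _)))// !nrmZ !nrm_ofreal.
have L0 := L 0; rewrite !subr0 in L0.
have := ler_wpM2r (nrm_ge0 v0) L0; have := ler_wpM2r (nrm_ge0 v1) (L 1).
have := ler_wpM2r (nrm_ge0 v2) (L 2); have := normr_ge0 (s - t); rewrite /N.
by move: (nrm v0) (nrm v1) (nrm v2) (`|s - t|) => *; lra.
Qed.

Lemma polyline_piecewise_C1 : piecewise_C1 gamma.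
Proof.
split; first exact/continuous_subspaceT/polyline_continuous.
exists [:: 3^-1; 2 / 3; 1]; split => //=; first by rewrite !andbT; apply/and3P; split; lra.
have C q v (b : R) : C1_curve (fun t => q + ofreal (3 * t - b) *: v).
  have -> : (fun t => q + ofreal (3 * t - b) *: v) =
      (fun t => (q - ofreal b *: v) + ofreal t *: (ofreal 3 *: v)).
    apply: funext => t; rewrite scalerA -ofrealM ofrealB scalerBl (mulrC t).
    by rewrite addrA addrAC.
  exact: C1_affine.
case=> [|[|[|//]]] _ /=.
- exists (fun t => p + ofreal (3 * t - 0) *: v0); split; first exact: C.
  by move=> t tI; rewrite subr0; exact: polyline0.
- exists (fun t => p + v0 + ofreal (3 * t - 1) *: v1); split; first exact: C.
  exact: polyline1.
- exists (fun t => p + v0 + v1 + ofreal (3 * t - 2) *: v2); split; first exact: C.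
  exact: polyline2.
Qed.

Lemma polyline_majorized D q v (a b i c : R) : a < b -> 3 * a = i -> 3 * b = i + 1 ->
  (forall t, a <= t <= b -> gamma t = q + ofreal (3 * t - i) *: v) -> seg_bound D q v c ->
  int_majorized (fun t => kobayashi_metric D (gamma t) (velocity gamma t)) a b c.
Proof.
move=> ab ai bi G [k [K [H Kc]]].
have tI t : a <= t <= b -> 0 <= 3 * t + - i <= 1 by move=> ?; lra.
suff : int_majorized (fun t => kobayashi_metric D (gamma t) (velocity gamma t)) a b
    (K (3 * b + - i) - K (3 * a + - i)).
  rewrite ai bi subrr (_ : i + 1 + - i = 1); last by ring.
  by move=> [h [m h0 hF I]]; exists h; split=> //; apply: (le_trans I); rewrite lee_fin.
apply: (int_majorized_derivative (g := fun t => 3 * k (3 * t + - i)) (G := fun t => K (3 * t + - i)) ab).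
- by move=> t /tI /H[k0 _ _ _ _]; rewrite mulr_ge0.
- move=> t /tI /H[_ ck _ _ _]; apply: (@continuousM R _ (fun=> 3) _ t); first exact: cst_continuous.
  exact: continuous_affine.
- by move=> t /tI /H[_ _ dK _ _]; exact: is_derive_affine.
move=> t /andP[at_ tb]; have tab : a <= t <= b by rewrite !ltW.
have [_ _ _ _ Fk] := H _ (tI _ tab).
(* In the open third the curve is affine on a neighbourhood of [t]; the factor 3 is the speed of the
   parametrization. *)
have -> : velocity gamma t = ofreal 3 *: v.
  apply: (@velocity_locally_affine gamma t (Num.min (t - a) (b - t)) (q - ofreal i *: v)).
    by rewrite lt_min !subr_gt0 at_.
  move=> s; rewrite lt_min !ltr_norml => /andP[/andP[? ?] /andP[? ?]].
  rewrite G; last by lra.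
  by rewrite scalerA -ofrealM ofrealB scalerBl (mulrC s) addrA addrAC.
rewrite G//; have := kobayashi_metricZ (c := ofreal 3) _ Fk.
rewrite nrm_ofreal ger0_norm//; apply.
by rewrite ofreal_eq0 pnatr_eq0.
Qed.

Lemma kobayashi_dist_polyline D (c0 c1 c2 : R) : seg_bound D p v0 c0 ->
  seg_bound D (p + v0) v1 c1 -> seg_bound D (p + v0 + v1) v2 c2 ->
  (kobayashi_dist D p (p + v0 + v1 + v2) <= (c0 + c1 + c2)%:E)%E.
Proof.
move=> b0 b1 b2; apply: (@le_trans _ _ (kobayashi_length D gamma)).
  apply: ereal_inf_lbound; exists gamma => //; split.
  - exact: polyline_piecewise_C1.
  - move=> t /andP[t0 t1].
    have [t3|t3] := leP t 3^-1.
      have tI : 0 <= t <= 3^-1 by rewrite t0.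
      have sI : 0 <= 3 * t <= 1 by lra.
      have [k [K [H _]]] := b0; have [_ _ _ Dt _] := H _ sI.
      by rewrite (polyline0 tI).
    have [t23|t23] := leP t (2 / 3).
      have tI : 3^-1 <= t <= 2 / 3 by rewrite t23 ltW.
      have sI : 0 <= 3 * t - 1 <= 1 by lra.
      have [k [K [H _]]] := b1; have [_ _ _ Dt _] := H _ sI.
      by rewrite (polyline1 tI).
    have tI : 2 / 3 <= t <= 1 by rewrite t1 ltW.
    have sI : 0 <= 3 * t - 2 <= 1 by lra.
    have [k [K [H _]]] := b2; have [_ _ _ Dt _] := H _ sI.
    by rewrite (polyline2 tI).
  - have tI : 0 <= (0 : R) <= 3^-1 by rewrite lexx invr_ge0 ler0n.
    by rewrite (polyline0 tI) mulr0 scale0r addr0.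
  - have tI : 2 / 3 <= (1 : R) <= 1 by rewrite lexx andbT; lra.
    have e : 3 * 1 - 2 = 1 :> R by ring.
    by rewrite (polyline2 tI) e ofreal1 scale1r.
rewrite /kobayashi_length; apply: integral_le_majorized.
  by move=> t; exact: kobayashi_metric_ge0.
have G0 t : 0 <= t <= 3^-1 -> gamma t = p + ofreal (3 * t - 0) *: v0.
  by move=> tI; rewrite subr0; exact: polyline0.
have M0 := @polyline_majorized D p v0 0 3^-1 0 c0 ltac:(lra) ltac:(lra) ltac:(lra) G0 b0.
have M1 := @polyline_majorized D _ v1 3^-1 (2 / 3) 1 c1 ltac:(lra) ltac:(lra) ltac:(lra) polyline1 b1.
have M2 := @polyline_majorized D _ v2 (2 / 3) 1 2 c2 ltac:(lra) ltac:(lra) ltac:(lra) polyline2 b2.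
pose F t := kobayashi_metric D (gamma t) (velocity gamma t).
have M01 := @int_majorized_add R F 0 3^-1 (2 / 3) c0 c1 ltac:(lra) ltac:(lra) M0 M1.
exact: (@int_majorized_add R F 0 (2 / 3) 1 (c0 + c1) c2 ltac:(lra) ltac:(lra) M01 M2).
Qed.
End Fixed.
End Polyline.

(** * Upper bound for the Kobayashi distance near the boundary *)

Section UpperArith.
Variable R : realType.
Implicit Types C s m eta t : R.

Lemma upper_radius_arith C m eta : 1 <= C -> 0 < m -> 8 * C * m <= eta -> 36 * C ^+ 3 * m <= 1 ->
  [/\ m < eta / 2, m + m * C < eta / 2, eta / 2 < eta & C * m <= 2^-1].
Proof.
move=> C1 m0 h1 h2; have mC : m <= C * m by rewrite ler_peMl// ltW.
have Cm : 0 < C * m by exact: lt_le_trans mC.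
have CC : 1 <= C ^+ 2 by rewrite expr2; nra.
have := ler_wpM2r (ltW Cm) CC; move: h2; rewrite !exprS expr0 mulr1 => h2 h3.
by split; lra.
Qed.

Lemma normal_descent_arith C s a x : a < 0 -> 0 <= s -> C * s <= 2^-1 ->
  x <= a - s + C * s ^+ 2 -> x <= - (s / 2).
Proof. by move=> a0 s0 Cs h; have := ler_wpM2r s0 Cs; lra. Qed.

Lemma quasi_arith C s t a b N x : 0 < C -> 0 < s -> 0 <= t <= 1 -> a <= - (s / 2) -> b <= - (s / 2) ->
  0 <= N -> N <= 3 * C * s -> 36 * C ^+ 3 * s <= 1 ->
  x <= (1 - t) * a + t * b + C * N ^+ 2 -> x <= - (s / 4).
Proof.
move=> C0 s0 /andP[t0 t1] as_ bs N0 NC h; have u0 : 0 <= 1 - t by rewrite subr_ge0.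
have q1 := ler_wpM2l u0 as_; have q2 := ler_wpM2l t0 bs.
have := ler_wpM2l (ltW C0) (ler_pM N0 N0 NC NC); rewrite -expr2 => q3.
have := ler_wpM2r (ltW s0) h; move: q3; rewrite !exprS !expr0 !mulr1; lra.
Qed.

Lemma ball_arith C s a b N : 0 < C -> a <= - (s / 4) -> N < s / (8 * C) -> b - a <= C * N -> 0 < s -> b < 0.
Proof.
move=> C0 as_ Ns h s0; have : C * N < C * (s / (8 * C)) by rewrite ltr_pM2l.
have -> : C * (s / (8 * C)) = s / 8 by field; rewrite gt_eqF.
lra.
Qed.
End UpperArith.

Section UpperBound.
Variables (R : realType) (n : nat).
Notation V := 'Cn[R]_n.
Implicit Types (D : set V) (p : V).

Lemma is_derive_ln_affine (d s t : R) : 0 < d + s * t ->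
  is_derive t 1 (fun u => ln (d + s * u)) (s / (d + s * t)).
Proof.
move=> h; have g : is_derive t 1 (fun u : R => d + s * u) s.
  by apply: is_derive_eq; rewrite /GRing.scale /=; ring.
have := @is_derive1_comp R (@ln R) (fun u => d + s * u) t _ s (is_derive1_ln h) g.
by rewrite mulrC.
Qed.

(** The two summands are the integrals of [1 / (2 (d + t))] and [1 / r] for [t] from 0 to [s]. *)
Lemma normal_seg_bound D z e (d r s : R) : 0 < d -> 0 < s -> s <= r -> 
  (forall t : R, 0 <= t -> t <= r -> D (z + ofreal t *: e) /\
      (kobayashi_metric D (z + ofreal t *: e) e <= ((2 * (d + t))^-1 + r^-1)%:E)%E) ->
  seg_bound D z (ofreal s *: e) (2^-1 * ln ((s + d) / d) + s / r).
Proof.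
move=> d0 s0 sr H; have r0 : 0 < r by exact: lt_le_trans sr.
have pos t : 0 <= t -> 0 < d + s * t by move=> t0; rewrite ltr_wpDr// mulr_ge0// ltW.
exists (fun t => s * ((2 * (d + s * t))^-1 + r^-1)), (fun t => 2^-1 * ln (d + s * t) + t * (s / r)).
split; last first.
  rewrite mulr1 mulr0 addr0 mul1r mul0r addr0 ln_div ?posrE ?addr_gt0// (addrC s d); lra.
move=> t /andP[t0 t1]; have p1 := pos t t0.
have st0 : 0 <= s * t by rewrite mulr_ge0// ltW.
have str : s * t <= r by rewrite (le_trans _ sr)// ler_piMr// ltW.
have [Dst Fst] := H _ st0 str; have E : z + ofreal t *: (ofreal s *: e) = z + ofreal (s * t) *: e.
  by rewrite scalerA -ofrealM (mulrC t).
split.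
- by rewrite mulr_ge0 ?(ltW s0)// addr_ge0 ?invr_ge0 ?mulr_ge0 ?(ltW p1) ?(ltW r0).
- have g : is_derive t 1 (fun u : R => 2 * (d + s * u)) (2 * s).
    by apply: is_derive_eq; rewrite /GRing.scale /=; ring.
  have ci : {for t, continuous (fun u => (2 * (d + s * u))^-1)}.
    by apply: continuousV; [rewrite gt_eqF// mulr_gt0|exact: rder_continuous g].
  apply: (@continuousM R _ (fun=> s) _ t); first exact: cst_continuous.
  by apply: (@continuousD _ _ _ _ (fun=> r^-1)); [exact: ci|exact: cst_continuous].
- have L := is_derive_ln_affine p1.
  apply: is_derive_eq; rewrite /GRing.scale /=; field.
  by rewrite !gt_eqF.
- by rewrite E.
rewrite E; have := kobayashi_metricZ (c := ofreal s) _ Fst.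
by rewrite nrm_ofreal gtr0_norm// ofreal_eq0 gt_eqF//; exact.
Qed.

(** The path descends from [x] along its normal to depth at least [s / 2], crosses, and climbs back
    to [y]. The conclusion keeps the segments and their sizes, and not only the distance, because
    [image_near_cluster_point] moves along them. *)
Lemma upper_bound D p rho (eta C c : R) : local_model D p rho eta C c -> boundary D p ->
  exists r0 A K : R, [/\ 0 < r0, 0 < K & forall x y (s : R), D x -> D y ->
    nrm (x - p) < r0 -> nrm (y - p) < r0 -> 0 < s -> s <= r0 -> nrm (x - y) <= s ->
    exists v0 v1 v2 : V, exists b0 b1 b2 : R,
    [/\ y = x + v0 + v1 + v2,
        [/\ seg_bound D x v0 b0, seg_bound D (x + v0) v1 b1 & seg_bound D (x + v0 + v1) v2 b2],
        [/\ nrm v0 <= K * s, nrm v1 <= K * s & nrm v2 <= K * s] &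
        b0 + b1 + b2 <= 2^-1 * ln ((s - rho x) / - rho x) + 2^-1 * ln ((s - rho y) / - rho y) + A]].
Proof.
move=> lm bp; have eta0 := lm_eta lm; have C1 := lm_C lm.
have C0 : 0 < C by exact: lt_le_trans C1.
have [r [r0 nm]] := normal_metric lm.
have pk : nrm (p - p) < eta by rewrite subrr nrm0.
have rp : rho p = 0 by exact: (lm_bd lm pk bp).
pose m := Num.min (Num.min (eta / (8 * C)) r) (Num.min (r / C) (36 * C ^+ 3)^-1).
have C3 : 0 < C ^+ 3 by rewrite exprn_gt0.
have m0 : 0 < m by rewrite !lt_min !divr_gt0 ?r0 ?invr_gt0 ?mulr_gt0.
have mP : [/\ 8 * C * m <= eta, m <= r, C * m <= r & 36 * C ^+ 3 * m <= 1].
  split.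
  - by rewrite mulrC -ler_pdivlMr ?mulr_gt0// !ge_min lexx.
  - by rewrite !ge_min lexx !orbT.
  - by rewrite mulrC -ler_pdivlMr// !ge_min lexx !orbT.
  - by rewrite mulrC -ler_pdivlMr ?mulr_gt0// div1r !ge_min lexx !orbT.
have [m1 m2 m3 m4] := mP; clearbody m.
have [mh mCm half Cm2] := upper_radius_arith C1 m0 m1 m4.
(* The summand 2 accounts for the two terms [s / r <= 1], and [24 C^2] for the crossing: its size is
   at most [3 C s], with balls of radius [s / (8 C)] around its points. *)
exists m, (2 + 24 * C ^+ 2), (3 * C); split; rewrite ?mulr_gt0// => x y s Dx Dy xm ym s0 sm xy.
have base z : D z -> nrm (z - p) < m -> exists2 e : V, nrm e <= C &
   [/\ seg_bound D z (ofreal s *: e) (2^-1 * ln ((s - rho z) / - rho z) + s / r),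
       nrm (z + ofreal s *: e - p) < eta / 2 & rho (z + ofreal s *: e) <= - (s / 2)].
  move=> Dz zm; have ze : nrm (z - p) < eta by exact: lt_trans (lt_trans zm mh) half.
  have rz : rho z < 0 by exact/(lm_D lm ze).
  have dr : - rho z <= r.
    have := lm_lip lm pk ze; rewrite rp subr0 ltr0_norm// => h.
    by rewrite (le_trans h)// (le_trans _ m3)// ler_pM2l// ltW.
  have [e eC [H1 H2]] := nm z (lt_trans zm mh) rz dr.
  exists e => //; split.
  - by apply: normal_seg_bound => //; [rewrite oppr_gt0|exact: le_trans m2].
  - rewrite addrAC (le_lt_trans (nrmD _ _))// nrmZ nrm_ofreal gtr0_norm//.
    by apply: lt_trans mCm; rewrite ltr_leD// ler_pM ?nrm_ge0// ltW.
  have [_ h] := H1 s (ltW s0) (le_trans sm m2).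
  have Cs : C * s <= 2^-1 by apply: le_trans Cm2; rewrite ler_pM2l.
  exact: normal_descent_arith rz (ltW s0) Cs h.
have [ex exC [bx nx rx]] := base x Dx xm; have [ey eyC [by_ ny ry]] := base y Dy ym.
set x' := x + ofreal s *: ex in nx rx; set y' := y + ofreal s *: ey in ny ry.
have nex : nrm (ofreal s *: ex) <= C * s.
  by rewrite nrmZ nrm_ofreal gtr0_norm// mulrC ler_pM2r.
have ney : nrm (ofreal s *: ey) <= C * s.
  by rewrite nrmZ nrm_ofreal gtr0_norm// mulrC ler_pM2r.
have sCs : s <= C * s by rewrite ler_peMl// ltW.
have C8 : 0 < 8 * C by rewrite mulr_gt0.
have sC8 : 0 < s / (8 * C) by exact: divr_gt0.
have Cs3 : 0 < 3 * C * s by rewrite !mulr_gt0.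
have ws : s / (8 * C) <= s.
  by rewrite ler_pdivrMr// ler_peMr ?(ltW s0)// mulr_ege1// ler1n.
have h36 : 36 * C ^+ 3 * s <= 1 by apply: le_trans m4; rewrite ler_pM2l// mulr_gt0.
have smh : s < eta / 2 by exact: le_lt_trans sm mh.
have xy' : nrm (y' - x') <= 3 * C * s.
  have -> : y' - x' = - (x - y) + (ofreal s *: ey - ofreal s *: ex).
    by rewrite /y' /x'; apply/rowP => j; rewrite !mxE; ring.
  rewrite (le_trans (nrmD _ _))// nrmN; have -> : 3 * C * s = C * s + (C * s + C * s) by ring.
  by rewrite lerD ?(le_trans xy)// (le_trans (nrmB _ _))// lerD.
(* The ends of the crossing satisfy [rho <= - s / 2] and are at most [3 C s] apart, so [lm_quasi]
   gives [rho <= - s / 4] on it; the Lipschitz bound then leaves room for these balls. *)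
have seg t : 0 <= t <= 1 -> forall w, nrm (w - (x' + ofreal t *: (y' - x'))) < s / (8 * C) -> D w.
  move=> tI w; set u := x' + _ => wu.
  have uE : u = ofreal (1 - t) *: x' + ofreal t *: y'.
    by rewrite /u ofrealB ofreal1 scalerBl scale1r scalerBr addrA addrAC.
  have un : nrm (u - p) < eta / 2 by rewrite uE; exact: convex_ball.
  have ru : rho u <= - (s / 4).
    have := lm_quasi lm (lt_trans nx half) (lt_trans ny half) tI; rewrite -uE nrmBC.
    exact: quasi_arith C0 s0 tI rx ry (nrm_ge0 _) xy' h36.
  have wp : nrm (w - p) < eta.
    apply: le_lt_trans (nrm_tri u w p) _; rewrite [eta]splitr; apply: ltrD; last exact: un.
    exact: lt_trans wu (le_lt_trans ws smh).
  apply/(lm_D lm wp).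
  have := lm_lip lm (lt_trans un half) wp; rewrite ler_norml => /andP[_ h].
  exact: ball_arith C0 ru wu h s0.
exists (ofreal s *: ex), (y' - x'), (- (ofreal s *: ey)).
exists (2^-1 * ln ((s - rho x) / - rho x) + s / r), ((3 * C * s) / (s / (8 * C))),
  (2^-1 * ln ((s - rho y) / - rho y) + s / r); split.
- by rewrite -/x' (addrC x') subrK /y' addrK.
- split; [exact: bx| |].
    by apply: (seg_bound_ball _ _ xy' seg); [exact: sC8|exact: Cs3].
  rewrite -/x' (addrC x') subrK; exact: seg_bound_rev.
- have sC3 : C * s <= 3 * C * s by rewrite -mulrA ler_peMl ?mulr_ge0 ?(ltW C0) ?(ltW s0)// ler1n.
  by split; [exact: le_trans nex sC3|exact: xy'|rewrite nrmN; exact: le_trans ney sC3].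
have sr : s / r <= 1 by rewrite ler_pdivrMr// mul1r (le_trans sm).
have -> : 3 * C * s / (s / (8 * C)) = 24 * C ^+ 2 by field; rewrite !gt_eqF.
move: sr; move: (s / r) (2^-1 * _) (2^-1 * _) (24 * _) => a b d e' a1.
rewrite (_ : d + a + e' + (b + a) = d + b + (a + a + e')); last by ring.
by rewrite lerD2l lerD2r (_ : 2 = 1 + 1)// lerD.
Qed.
End UpperBound.

(** * Lower bounds for lengths from polynomials along curves *)

Section PolynomialAlongCurves.
Variables (R : realType) (n : nat).
Notation V := 'Cn[R]_n.
Implicit Types (P : V -> cplx R) (dP : V -> V -> cplx R) (D : set V) (sigma gamma : R -> V).

Lemma cder_coord (g : cplx R -> V) (t : cplx R) (d : V) j :
  is_derive t 1 g d -> is_derive t 1 (fun s => g s 0 j) (d 0 j).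
Proof.
move=> /cderP H; apply/cderP => e /H[k k0 Hk]; exists k => // h /Hk {}Hk.
apply: le_trans Hk.
have -> : g (t + h) 0 j - g t 0 j - h *: d 0 j = (g (t + h) - g t - h *: d) 0 j by rewrite !mxE.
exact: nrm_coord.
Qed.

Lemma poly_holo P dP : poly_der P dP -> forall (g : cplx R -> V) (t : cplx R) (d : V),
  is_derive t 1 g d -> is_derive t 1 (fun s => P (g s)) (dP (g t) d).
Proof.
elim=> {P dP} [c|j|P dP Q dQ _ IP _ IQ|P dP Q dQ _ IP _ IQ] g t d dg.
- exact: is_derive_cst.
- exact: cder_coord.
- exact: is_deriveD (IP g t d dg) (IQ g t d dg).
- have := is_deriveM (IP g t d dg) (IQ g t d dg).
  rewrite [P (g t) *: _ + _]addrC.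
  by rewrite [_ *: dP (g t) d]mulrC.
Qed.

Lemma poly_der_scale P dP : poly_der P dP -> forall w (a : cplx R) h, dP w (a *: h) = a * dP w h.
Proof.
elim=> {P dP} [c|j|P dP Q dQ _ IP _ IQ|P dP Q dQ _ IP _ IQ] w a h.
- by rewrite mulr0.
- by rewrite mxE.
- by rewrite IP IQ mulrDr.
- by rewrite IP IQ; ring.
Qed.

Lemma poly_curve P dP : poly_der P dP -> forall sigma, C1_curve sigma ->
  (forall t : R, is_derive t 1 (fun s => re (P (sigma s))) (re (dP (sigma t) (velocity sigma t))) /\
             is_derive t 1 (fun s => im (P (sigma s))) (im (dP (sigma t) (velocity sigma t)))) /\
  continuous (fun t => re (dP (sigma t) (velocity sigma t))) /\
  continuous (fun t => im (dP (sigma t) (velocity sigma t))).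
Proof.
elim=> {P dP} [c|j|P dP Q dQ _ IP _ IQ|P dP Q dQ _ IP _ IQ] sigma C1.
- by split=> [t|]; split; try exact: is_derive_cst; exact: cst_continuous.
- have [dc cv] := C1; split.
    move=> t; have [dr di] := dc t j; rewrite mxE; split.
      by rewrite /re /= derive1E; exact: derivableP.
    by rewrite /im /= derive1E; exact: derivableP.
  have vB s t : velocity sigma s 0 j - velocity sigma t 0 j = (velocity sigma s - velocity sigma t) 0 j.
    by rewrite !mxE.
  split=> t; apply/continuous_absP => e e0; have [k k0 Hk] := (continuous_abs_nrmP _ _).1 (cv t) _ e0.
    exists k => // s /Hk h; apply: le_lt_trans h.
    by rewrite -reB vB (le_trans (re_le_nrm _)) ?nrm_coord.
  exists k => // s /Hk h; apply: le_lt_trans h.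
  by rewrite -imB vB (le_trans (im_le_nrm _)) ?nrm_coord.
- have [dp [c1 c2]] := IP _ C1; have [dq [c3 c4]] := IQ _ C1; split.
    move=> t; have [a1 a2] := dp t; have [b1 b2] := dq t; rewrite reD imD; split.
      have -> : (fun s => re (P (sigma s) + Q (sigma s))) = (fun s => re (P (sigma s)) + re (Q (sigma s))).
        by apply: funext => s; rewrite reD.
      exact: is_deriveD.
    have -> : (fun s => im (P (sigma s) + Q (sigma s))) = (fun s => im (P (sigma s)) + im (Q (sigma s))).
      by apply: funext => s; rewrite imD.
    exact: is_deriveD.
  under eq_fun do rewrite reD; under [X in _ /\ continuous X]eq_fun do rewrite imD.
  split=> t; first exact: (continuousD (c1 t) (c3 t)).
  exact: (continuousD (c2 t) (c4 t)).
- have [dp [c1 c2]] := IP _ C1; have [dq [c3 c4]] := IQ _ C1.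
  have p1 t : {for t, continuous (fun s => re (P (sigma s)))} by apply: rder_continuous (dp t).1.
  have p2 t : {for t, continuous (fun s => im (P (sigma s)))} by apply: rder_continuous (dp t).2.
  have q1 t : {for t, continuous (fun s => re (Q (sigma s)))} by apply: rder_continuous (dq t).1.
  have q2 t : {for t, continuous (fun s => im (Q (sigma s)))} by apply: rder_continuous (dq t).2.
  split.
    move=> t; have [a1 a2] := dp t; have [b1 b2] := dq t; rewrite reD imD !reM !imM; split.
      have -> : (fun s => re (P (sigma s) * Q (sigma s))) =
          (fun s => re (P (sigma s)) * re (Q (sigma s)) - im (P (sigma s)) * im (Q (sigma s))).
        by apply: funext => s; rewrite reM.
      by apply: is_derive_eq; rewrite /GRing.scale /=; ring.
    have -> : (fun s => im (P (sigma s) * Q (sigma s))) =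
        (fun s => re (P (sigma s)) * im (Q (sigma s)) + im (P (sigma s)) * re (Q (sigma s))).
      by apply: funext => s; rewrite imM.
    by apply: is_derive_eq; rewrite /GRing.scale /=; ring.
  under eq_fun do rewrite reD !reM; under [X in _ /\ continuous X]eq_fun do rewrite imD !imM.
  split=> t.
    exact: (continuousD (continuousB (continuousM (c1 t) (q1 t)) (continuousM (c2 t) (q2 t)))
      (continuousB (continuousM (p1 t) (c3 t)) (continuousM (p2 t) (c4 t)))).
  exact: (continuousD (continuousD (continuousM (c1 t) (q2 t)) (continuousM (c2 t) (q1 t)))
    (continuousD (continuousM (p1 t) (c4 t)) (continuousM (p2 t) (c3 t)))).
Qed.

Lemma is_derive_local (g h : R -> R) (t k d : R) : 0 < k ->
  (forall s, `|s - t| < k -> g s = h s) -> is_derive t 1 h d -> is_derive t 1 g d.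
Proof.
move=> k0 gh /rderP H; apply/rderP => e /H[l l0 Hl].
exists (Num.min k l); first by rewrite lt_min k0.
move=> u; rewrite lt_min => /andP[uk ul]; rewrite !gh ?subrr ?normr0//; first exact: Hl.
by rewrite addrAC subrr add0r.
Qed.

Lemma velocity_local gamma sigma (t k : R) : 0 < k -> C1_curve sigma ->
  (forall s, `|s - t| < k -> gamma s = sigma s) -> velocity gamma t = velocity sigma t.
Proof.
move=> k0 [dc _] H; apply/rowP => j; rewrite !mxE; have [dr di] := dc t j.
have e1 : is_derive t 1 (re_coord gamma j) (derive1 (re_coord sigma j) t).
  apply: (is_derive_local (h := re_coord sigma j) k0); first by move=> s /H e; rewrite /re_coord e.
  by rewrite derive1E; exact: derivableP.
have e2 : is_derive t 1 (im_coord gamma j) (derive1 (im_coord sigma j) t).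
  apply: (is_derive_local (h := im_coord sigma j) k0); first by move=> s /H e; rewrite /im_coord e.
  by rewrite derive1E; exact: derivableP.
by apply: cplx_eq; rewrite /re /im /= derive1E derive_val.
Qed.

Definition speed D gamma t := kobayashi_metric D (gamma t) (velocity gamma t).

(** The derivative of [G (Re P)] along the curve is [G' (Re P)] times the real part of [dP] on the
    velocity. If the metric dominates this linear form, the length dominates the increment of
    [G (Re P)]. *)
Lemma piece_minorized D gamma sigma P dP (G G' : R -> R) (a b : R) : a <= b ->
  C1_curve sigma -> (forall t, a <= t <= b -> gamma t = sigma t) -> poly_der P dP ->
  (forall t, a <= t <= b -> [/\ is_derive (re (P (gamma t))) 1 G (G' (re (P (gamma t)))),
     {for re (P (gamma t)), continuous G'} &
     forall xi, ((G' (re (P (gamma t))) * re (dP (gamma t) xi))%:E <= kobayashi_metric D (gamma t) xi)%E]) ->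
  int_minorized (speed D gamma) a b (G (re (P (gamma b))) - G (re (P (gamma a)))).
Proof.
move=> ab C1 gs PdP H; have [dP_ [cdP _]] := poly_curve PdP C1.
rewrite !gs ?lexx ?ab//.
apply: (@int_minorized_derivative _ _ (fun t => G' (re (P (sigma t))) * re (dP (sigma t) (velocity sigma t)))
  (fun t => G (re (P (sigma t))))) => //.
- by move=> t; exact: kobayashi_metric_ge0.
- move=> t tI; have [_ cG _] := H t tI; rewrite gs// in cG.
  apply: continuousM; last exact: cdP.
  apply: (@continuous_comp _ _ _ (fun s => re (P (sigma s))) G') => //.
  by apply: rder_continuous (dP_ t).1.
- move=> t tI; have [dG _ _] := H t tI; rewrite gs// in dG.
  exact: (@is_derive1_comp R G (fun s => re (P (sigma s))) t _ _ dG (dP_ t).1).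
move=> t /andP[at_ tb]; have tI : a <= t <= b by rewrite !ltW.
have [_ _ F] := H t tI.
rewrite /speed (@velocity_local gamma sigma t (Num.min (t - a) (b - t)))//.
- by rewrite -gs.
- by rewrite lt_min !subr_gt0 at_.
move=> s; rewrite lt_min !ltr_norml => /andP[/andP[? ?] /andP[? ?]].
by apply: gs; lra.
Qed.

(** The interval [[a, b]] is independent of the subdivision, since only the parts of a curve near
    its end points are estimated later. The induction drops the nodes to the left of [a] and cuts at
    the next one. *)
Lemma path_minorized D gamma P dP (G G' : R -> R) (s : seq R) : poly_der P dP ->
  forall x0 a b, path <%R x0 s -> x0 <= a -> a <= b -> b <= last x0 s ->
  (forall i, (i < size s)%N -> exists sigma, C1_curve sigma /\
     forall t, nth 0 (x0 :: s) i <= t <= nth 0 s i -> gamma t = sigma t) ->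
  (forall t, a <= t <= b -> [/\ is_derive (re (P (gamma t))) 1 G (G' (re (P (gamma t)))),
     {for re (P (gamma t)), continuous G'} &
     forall xi, ((G' (re (P (gamma t))) * re (dP (gamma t) xi))%:E <= kobayashi_metric D (gamma t) xi)%E]) ->
  int_minorized (speed D gamma) a b (G (re (P (gamma b))) - G (re (P (gamma a)))).
Proof.
move=> PdP; elim: s => [|x1 s IH] x0 a b /=.
  move=> _ xa ab bx _ _; have -> : b = a by apply: le_anti; rewrite ab (le_trans bx).
  by rewrite subrr; apply: int_minorized_nil => // t; exact: kobayashi_metric_ge0.
move=> /andP[x01 px] xa ab bl pieces H.
have [sigma [C1 gs]] := pieces 0%N isT; rewrite /= in gs.
have [bx|xb] := leP b x1.
  apply: (piece_minorized ab C1 _ PdP H) => t /andP[at_ tb].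
  by apply: gs; rewrite (le_trans xa)// (le_trans tb).
have pieces' i : (i < size s)%N -> exists sigma, C1_curve sigma /\
     forall t, nth 0 (x1 :: s) i <= t <= nth 0 s i -> gamma t = sigma t.
  by move=> si; exact: (pieces i.+1 si).
have [xa1|ax1] := leP x1 a; first exact: (IH x1 a b px xa1 ab bl pieces' H).
have -> : G (re (P (gamma b))) - G (re (P (gamma a))) =
   (G (re (P (gamma x1))) - G (re (P (gamma a)))) + (G (re (P (gamma b))) - G (re (P (gamma x1)))) by ring.
apply: (@int_minorized_add _ _ _ x1); rewrite ?(ltW xb) ?(ltW ax1)//.
- by move=> t; exact: kobayashi_metric_ge0.
- apply: (piece_minorized (ltW ax1) C1 _ PdP).
    by move=> t /andP[at_ tb]; apply: gs; rewrite (le_trans xa).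
  by move=> t /andP[at_ tb]; apply: H; rewrite at_ (le_trans tb)// ltW.
apply: (IH x1 x1 b px (lexx _) (ltW xb) bl pieces').
by move=> t /andP[at_ tb]; apply: H; rewrite tb andbT (le_trans _ at_)// ltW.
Qed.

Lemma curve_minorized D gamma P dP (G G' : R -> R) (a b : R) : piecewise_C1 gamma ->
  0 <= a -> a <= b -> b <= 1 -> poly_der P dP ->
  (forall t, a <= t <= b -> [/\ is_derive (re (P (gamma t))) 1 G (G' (re (P (gamma t)))),
     {for re (P (gamma t)), continuous G'} &
     forall xi, ((G' (re (P (gamma t))) * re (dP (gamma t) xi))%:E <= kobayashi_metric D (gamma t) xi)%E]) ->
  int_minorized (speed D gamma) a b (G (re (P (gamma b))) - G (re (P (gamma a)))).
Proof.
move=> [_ [s [ps ls pieces]]] a0 ab b1 PdP H.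
by apply: (path_minorized PdP ps a0 ab _ pieces H); rewrite ls.
Qed.

Lemma kobayashi_dist_ge D (x y : V) (m : R) :
  (forall gamma, piecewise_C1 gamma -> (forall t, 0 <= t <= 1 -> D (gamma t)) ->
     gamma 0 = x -> gamma 1 = y -> int_minorized (speed D gamma) 0 1 m) ->
  (m%:E <= kobayashi_dist D x y)%E.
Proof.
move=> H; apply: le_ereal_inf_tmp => _ [gamma [pc Dg g0 g1] <-].
apply: le_integral_minorized; first by move=> t; exact: kobayashi_metric_ge0.
exact: H.
Qed.
End PolynomialAlongCurves.

(** * Discs centred near the boundary stay near it on a large radius *)

Section LocalizationArith.
Variable R : realType.
Implicit Types (c e h N r t q : R).

Lemma harnack_arith c e h N u d : 0 < c -> 0 < e -> 0 < h -> c * N ^+ 2 <= u -> h <= d ->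
  u * d ^+ 2 <= 2 * e ^+ 2 -> N ^+ 2 <= 2 * e ^+ 2 / (c * h ^+ 2).
Proof.
move=> c0 e0 h0 Nu hd H; rewrite ler_pdivlMr; last by rewrite mulr_gt0 ?exprn_gt0.
apply: le_trans H; have dd : h ^+ 2 <= d ^+ 2 by rewrite ler_pXn2r ?nnegrE ?(ltW h0) ?(le_trans (ltW h0) hd).
have u0 : 0 <= u by rewrite (le_trans _ Nu)// mulr_ge0 ?sqr_ge0// ltW.
rewrite mulrCA mulrA; exact: ler_pM (mulr_ge0 (ltW c0) (sqr_ge0 N)) (sqr_ge0 h) Nu dd.
Qed.

Lemma extension_arith (M B e k t s : R) : 0 < M -> 0 < B -> 0 < e -> 0 < k ->
  t <= 1 - (B + 64 * M * B / k) * e + B * e -> s <= t -> t - s <= 2 * (B * e) ->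
  t < 1 /\ 8 * M / (1 - t) * (t - s) <= k / 4.
Proof.
move=> M0 B0 e0 k0 h st ts.
have q0 : 0 < 64 * M * B / k * e by rewrite !mulr_gt0// invr_gt0.
have tq : 64 * M * B / k * e <= 1 - t by lra.
have t1 : 0 < 1 - t by exact: lt_le_trans tq.
split; first by rewrite -subr_gt0.
rewrite mulrAC ler_pdivrMr//.
apply: (@le_trans _ _ (k / 4 * (64 * M * B / k * e))); last by rewrite ler_pM2l// divr_gt0.
have -> : k / 4 * (64 * M * B / k * e) = 8 * M * (2 * (B * e)) by field; rewrite gt_eqF.
by rewrite ler_wpM2l// mulr_ge0// ltW.
Qed.
End LocalizationArith.

Section Localization.
Variables (R : realType) (n : nat).
Notation V := 'Cn[R]_n.

Definition disc_map (D : set V) (g : cplx R -> V) : Prop :=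
  forall t : cplx R, nrm t < 1 -> (exists d, is_derive t 1 g d) /\ D (g t).

Lemma disc_map_lipschitz (D : set V) (g : cplx R -> V) (M : R) (e : cplx R) (s t : R) :
  disc_map D g -> (forall z, D z -> nrm z <= M) -> 0 < M -> nrm e = 1 -> 0 <= s -> s <= t -> t < 1 ->
  nrm (g (ofreal t * e) - g (ofreal s * e)) <= 8 * M / (1 - t) * (t - s).
Proof.
move=> hg DM M0 ne s0 st t1.
apply: nrm_le_coord => [|j].
  by rewrite mulr_ge0 ?subr_ge0// divr_ge0 ?mulr_ge0 ?subr_ge0 ?(ltW M0) ?(ltW t1).
rewrite !mxE; apply: (@radial_lipschitz R (fun z => g z 0 j) M e s t) => //.
  move=> z; rewrite subr0 => z1; have [[d hd] _] := hg z z1.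
  by exists (d 0 j); exact: cder_coord.
move=> z z1; have [_ Dz] := hg z z1; exact: le_trans (nrm_coord _ _) (DM _ Dz).
Qed.

(** A bootstrap: if the disc stays within [eta / 2] of its centre [w] for [|l| < r], Harnack's
    inequality for the peak polynomial at [w] improves this to [eta / 4] for [|l| <= r - B e]. The
    Lipschitz bound along rays then recovers [eta / 2] up to [r + B e]. *)
Lemma localization_step (D : set V) p rho (eta C c M B e r : R) (w : V) (g : cplx R -> V) :
  local_model D p rho eta C c -> (forall z, D z -> nrm z <= M) -> 0 < M ->
  D w -> nrm (w - p) < eta / 2 -> disc_map D g -> g 0 = w -> 
  0 < B -> 0 < e -> e ^+ 2 = - rho w -> 2 / (c * B ^+ 2) = (eta / 2 / 2) ^+ 2 ->
  r <= 1 - (B + 64 * M * B / (eta / 2)) * e ->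
  (forall l : cplx R, nrm l < r -> nrm (g l - w) < eta / 2) ->
  (forall l : cplx R, nrm l < r + B * e -> nrm (g l - w) < eta / 2).
Proof.
move=> lm DM M0 Dw wp hg g0 B0 e0 e2 HB rX Sr l lr.
have eta0 := lm_eta lm; have eta2 : 0 < eta / 2 by rewrite divr_gt0.
have c0 := lm_c lm; have Be : 0 < B * e by rewrite mulr_gt0.
have k0 : 0 < 64 * M * B / (eta / 2) * e by rewrite !mulr_gt0// invr_gt0.
have r1 : r < 1.
  by apply: (le_lt_trans rX); rewrite ltrBlDr ltrDl mulrDl addr_gt0.
have half_eta : eta / 2 < eta by rewrite ltr_pdivrMr// ltr_pMr// ltr1n.
have claim (l' : cplx R) : nrm l' <= r - B * e -> nrm (g l' - w) <= eta / 2 / 2.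
  move=> lr'; have r0 : nrm l' < r by apply: (le_lt_trans lr'); rewrite ltrBlDr ltrDl.
  have inB (t : cplx R) : nrm t < r -> nrm (g t - p) < eta.
    move=> /Sr h; apply: le_lt_trans (nrm_tri w _ _) _; rewrite [eta]splitr; exact: ltrD.
  have [P [v0 [[dP PdP] Pw v00 v0d Pneg]]] := lm_peak lm (lt_trans wp half_eta) Dw.
  have Pneg' (t : cplx R) : nrm t < r -> c * nrm (g t - w) ^+ 2 <= - re (P (g t)).
    move=> tr; have [_ Dg] := hg t (lt_trans tr r1); have rg : rho (g t) < 0.
      exact/(lm_D lm (inB t tr)).
    have := Pneg _ (inB t tr) Dg; lra.
  have hol : holo_on (fun t => P (g t)) 0 r.
    move=> t; rewrite subr0 => tr; have [[d hd] _] := hg t (lt_trans tr r1).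
    by exists (dP (g t) d); exact: poly_holo.
  have neg (t : cplx R) : nrm t < r -> re (P (g t)) <= 0.
    move=> /Pneg' h; rewrite -oppr_ge0; apply: le_trans h.
    by rewrite mulr_ge0 ?sqr_ge0// ltW.
  have := harnack hol neg r0; rewrite g0 Pw reN re_ofreal opprK => H.
  have H2 : - re (P (g l')) * (r - nrm l') ^+ 2 <= 2 * e ^+ 2.
    apply: (le_trans H); rewrite e2; apply: le_trans v0d.
    have r00 : 0 < r by exact: le_lt_trans (nrm_ge0 l') r0.
    by rewrite ler_piMr ?(ltW v00)// expr_le1 ?ltW.
  have hd : B * e <= r - nrm l' by rewrite lerBrDr addrC -lerBrDr.
  have := harnack_arith c0 e0 Be (Pneg' _ r0) hd H2.
  have -> : 2 * e ^+ 2 / (c * (B * e) ^+ 2) = 2 / (c * B ^+ 2) by field; rewrite !gt_eqF.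
  by rewrite HB ler_pXn2r ?nnegrE ?nrm_ge0// ltW// divr_gt0.
have q4 : eta / 2 / 4 < eta / 2 / 2 by rewrite ltr_pM2l// ltf_pV2 ?posrE// ltr_nat.
have [l0|l0] := eqVneq l 0; first by rewrite l0 g0 subrr nrm0.
have nl : 0 < nrm l by rewrite nrm_gt0.
pose u := l / ofreal (nrm l).
have nu : nrm u = 1 by rewrite nrmM nrmV nrm_ofreal ger0_norm ?nrm_ge0// divff// gt_eqF.
have lu : l = ofreal (nrm l) * u by rewrite mulrC divfK// ofreal_eq0 gt_eqF.
have [ls|ls] := leP (nrm l) (r - B * e).
  by apply: le_lt_trans (claim l ls) _; rewrite ltr_pdivrMr// ltr_pMr// ltr1n.
have main (s : R) : 0 <= s -> s <= nrm l -> nrm l - s <= 2 * (B * e) ->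
    nrm (g (ofreal s * u) - w) <= eta / 2 / 2 -> nrm (g l - w) < eta / 2.
  move=> s0 sl ts hs.
  have tX : nrm l <= 1 - (B + 64 * M * B / (eta / 2)) * e + B * e.
    by apply: le_trans (ltW lr) _; rewrite lerD2r.
  have [t1 bound] := extension_arith M0 B0 e0 eta2 tX sl ts.
  have := disc_map_lipschitz hg DM M0 nu s0 sl t1; rewrite -lu => L.
  apply: le_lt_trans (nrm_tri (g (ofreal s * u)) _ _) _; rewrite [ltRHS]splitr.
  apply: ltr_leD; last exact: hs.
  exact: le_lt_trans (le_trans L bound) q4.
have [rs|rs] := leP 0 (r - B * e).
  apply: (main _ rs (ltW ls)); first by move: lr; lra.
  by apply: claim; rewrite nrmM nu mulr1 nrm_ofreal ger0_norm.
apply: (main 0 (lexx _) (ltW nl)); first by rewrite subr0; move: lr rs; lra.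
by rewrite ofreal0 mul0r g0 subrr nrm0 !divr_ge0// ltW.
Qed.

(** Each use of the step enlarges the radius by [B e], starting from radius 0, where there is
    nothing to prove, until [1 - A e] is reached, with [e] the square root of the depth of [w]. *)
Lemma localization (D : set V) p rho (eta C c M : R) :
  local_model D p rho eta C c -> (forall z, D z -> nrm z <= M) -> 0 < M ->
  exists2 A : R, 0 < A & forall (w : V) (g : cplx R -> V), D w -> nrm (w - p) < eta / 2 ->
    disc_map D g -> g 0 = w -> forall l : cplx R, nrm l < 1 - A * Num.sqrt (- rho w) ->
    nrm (g l - p) < eta.
Proof.
move=> lm DM M0; have eta0 := lm_eta lm; have eta2 : 0 < eta / 2 by rewrite divr_gt0.
have c0 := lm_c lm; have half_eta : eta / 2 < eta by rewrite ltr_pdivrMr// ltr_pMr// ltr1n.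
(* This [B] makes the bound from Harnack's inequality equal to [(eta / 4)^2]. *)
pose B := Num.sqrt (2 / c) * (eta / 2 / 2)^-1.
have B0 : 0 < B by rewrite mulr_gt0 ?sqrtr_gt0 ?invr_gt0 ?divr_gt0.
have HB : 2 / (c * B ^+ 2) = (eta / 2 / 2) ^+ 2.
  by rewrite /B exprMn sqr_sqrtr ?divr_ge0 ?(ltW c0)//; field; rewrite !gt_eqF.
(* The second summand keeps [1 - |l|] so large that the Lipschitz constant [8 M / (1 - |l|)] times
   the distance [2 B e] is at most [eta / 8]. *)
exists (B + 64 * M * B / (eta / 2)); first by apply: addr_gt0 => //; apply: divr_gt0 => //; apply: mulr_gt0 => //; exact: mulr_gt0.
move=> w g Dw wp hg g0 l.
have rw : rho w < 0 by exact/(lm_D lm (lt_trans wp half_eta)).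
set e := Num.sqrt (- rho w); have e0 : 0 < e by rewrite sqrtr_gt0 oppr_gt0.
have e2 : e ^+ 2 = - rho w by rewrite sqr_sqrtr// oppr_ge0 ltW.
set X := 1 - _ => lX.
have Be : 0 < B * e by rewrite mulr_gt0.
have S k : forall l : cplx R, nrm l < Num.min (k%:R * (B * e)) X -> nrm (g l - w) < eta / 2.
  elim: k => [|k IH] l'.
    by rewrite mul0r lt_min => /andP[h _]; move: (le_lt_trans (nrm_ge0 _) h); rewrite ltxx.
  move=> h; apply: (localization_step lm DM M0 Dw wp hg g0 B0 e0 e2 HB _ IH); first by rewrite ge_min lexx orbT.
  apply: lt_le_trans h _; rewrite [X in _ <= X + _]minEle; case: ifP => _; rewrite ge_min.
    by rewrite -natr1 mulrDl mul1r lexx.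
  by rewrite lerDl (ltW Be) orbT.
apply: le_lt_trans (nrm_tri w _ _) _; rewrite [eta]splitr; apply: ltrD; last exact: wp.
apply: (S (Num.bound (X / (B * e)))); rewrite lt_min lX andbT.
apply: lt_le_trans lX _; rewrite -ler_pdivrMr//.
have [X0|X0] := leP 0 X; first by rewrite ltW// archi_boundP// divr_ge0// ltW.
by rewrite (le_trans _ (ler0n _ _))// pmulr_lle0 ?invr_gt0// ltW.
Qed.
End Localization.

(** * The primitive of the lower density, and first exit times *)

Section Psi.
Variable R : realType.
Implicit Types (k v e : R).

(** Primitive of [dpsi k], that is of [1 / (2 v)] divided by the factor [1 + k sqrt v] lost in the
    localization of discs. The correction to [ln v / 2] is bounded near 0. *)
Definition psi k v : R := 2^-1 * ln v - ln (1 + k * Num.sqrt v).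
Definition dpsi k v : R := (2 * v * (1 + k * Num.sqrt v))^-1.

Lemma psi_den_gt0 k v : 0 <= k -> 0 < 1 + k * Num.sqrt v.
Proof. by move=> k0; rewrite ltr_wpDr// mulr_ge0// sqrtr_ge0. Qed.

Lemma is_derive_psi k v : 0 <= k -> 0 < v -> is_derive v 1 (psi k) (dpsi k v).
Proof.
move=> k0 v0; have d0 := psi_den_gt0 v k0; have s0 : 0 < Num.sqrt v by rewrite sqrtr_gt0.
have d1 : is_derive v 1 (fun u => 1 + k * Num.sqrt u) (k * (2 * Num.sqrt v)^-1).
  have ds := is_derive1_sqrt v0.
  by apply: is_derive_eq; rewrite /GRing.scale /=; ring.
have d2 := @is_derive1_comp R (@ln R) (fun u => 1 + k * Num.sqrt u) v _ _ (is_derive1_ln d0) d1.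
have d3 := is_derive1_ln v0.
have d4 : is_derive v 1 (fun u => ln (1 + k * Num.sqrt u)) ((1 + k * Num.sqrt v)^-1 * (k * (2 * Num.sqrt v)^-1)) := d2.
apply: is_derive_eq; rewrite /GRing.scale /= /dpsi.
have E : v = Num.sqrt v ^+ 2 by rewrite sqr_sqrtr// ltW.
clear d1 d2 d3 d4; move: E s0 d0; move: (Num.sqrt v) => s -> s0 d0; field.
by rewrite !gt_eqF.
Qed.

Lemma continuous_dpsi k v : 0 <= k -> 0 < v -> {for v, continuous (dpsi k)}.
Proof.
move=> k0 v0; have d0 := psi_den_gt0 v k0.
have cc u : {for v, continuous (fun=> u : R)} by exact: cst_continuous.
have cs : {for v, continuous (@Num.sqrt R)} by exact: sqrt_continuous.
have ci : {for v, continuous (fun u : R => u)} by move=> B.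
have c1 := continuousM (cc 2) ci.
have c2 := continuousD (cc 1) (continuousM (cc k) cs).
have c3 := continuousM c1 c2.
apply: (continuousV _ c3); by rewrite gt_eqF// mulr_gt0// mulr_gt0.
Qed.

Lemma psi_le k u v : 0 <= k -> 0 < u -> u <= v -> psi k u <= psi k v.
Proof.
move=> k0 u0 uv; rewrite -subr_ge0.
have := @deriv_ge R (psi k) (dpsi k) u v 0 uv _ _; rewrite mul0r; apply=> t /andP[ut tv].
  by apply: is_derive_psi => //; exact: lt_le_trans ut.
have t0 : 0 < t by exact: lt_le_trans ut.
by rewrite /dpsi invr_ge0 mulr_ge0 ?mulr_ge0 ?ltW ?psi_den_gt0.
Qed.

Lemma psi_le_ln k v : 0 <= k -> psi k v <= 2^-1 * ln v.
Proof.
move=> k0; rewrite /psi lerBlDr lerDl ln_ge0// lerDl mulr_ge0// sqrtr_ge0.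
Qed.

(** The time sought is the supremum of those up to which [h] has stayed strictly below [e]. *)
Lemma first_exit (h : R -> R) e : continuous h -> 0 < e -> h 0 < e -> e <= h 1 ->
  exists t : R, [/\ 0 <= t <= 1, h t = e & forall s, 0 <= s <= t -> h s <= e].
Proof.
move=> ch e0 h0 h1.
pose B := [set b : R | 0 <= b <= 1 /\ forall s, 0 <= s <= b -> h s < e].
have B0 : B 0.
  split=> [|s s0]; first by rewrite lexx ler01.
  by have -> : s = 0 by apply: le_anti; rewrite andbC.
have hB : has_sup B by split; [exists 0|exists 1 => b [/andP[]]].
pose t := sup B.
have t0 : 0 <= t by apply: ub_le_sup => //; case: hB.
have t1 : t <= 1 by apply: ge_sup; [exists 0|move=> b [/andP[]]].
have below s : 0 <= s -> s < t -> h s < e.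
  move=> s0 st; have d0 : 0 < t - s by rewrite subr_gt0.
  have [b [_ Hb] bs] := sup_adherent d0 hB; apply: Hb; rewrite s0 ltW//.
  by move: bs; rewrite -/t opprB addrC subrK.
have le_e : h t <= e.
  rewrite leNgt; apply/negP => et; have et' : 0 < h t - e by rewrite subr_gt0.
  have [k k0 Hk] := (continuous_absP _ _).1 (ch t) _ et'.
  have tn : t != 0 by apply: contraTneq et => ->; rewrite -leNgt ltW.
  have tp : 0 < t by rewrite lt_neqAle eq_sym tn.
  pose s := Num.max 0 (t - k / 2).
  have st : s < t by rewrite /s gt_max tp ltrBlDr ltrDl divr_gt0.
  have s0 : 0 <= s by rewrite /s le_max lexx.
  have sk : `|s - t| < k.
    rewrite distrC gtr0_norm ?subr_gt0//.
    have : t - k / 2 <= s by rewrite /s le_max lexx orbT.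
    by move: s {st s0} => s; lra.
  have := Hk s sk; rewrite distrC; have := ler_norm (h t - h s); have := below s s0 st; lra.
have ge_e : e <= h t.
  rewrite leNgt; apply/negP => he; have he' : 0 < e - h t by rewrite subr_gt0.
  have tn : t < 1 by rewrite lt_neqAle t1 andbT; apply: contraTneq he => ->; rewrite -leNgt.
  have [k k0 Hk] := (continuous_absP _ _).1 (ch t) _ he'.
  pose b := Num.min 1 (t + k / 2).
  have tb : t < b by rewrite /b lt_min tn ltrDl divr_gt0.
  have bk : b <= t + k / 2 by rewrite /b ge_min lexx orbT.
  have Bb : B b.
    split; first by rewrite (le_trans t0 (ltW tb)) /b ge_min lexx.
    move=> s /andP[s0 sb]; have [st|ts] := ltP s t; first exact: below.
    have sk : `|s - t| < k by rewrite ger0_norm ?subr_ge0//; move: sb bk; lra.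
    have := Hk s sk; have := ler_norm (h s - h t); lra.
  have : b <= t by apply: ub_le_sup => //; case: hB.
  by rewrite leNgt tb.
exists t; split; first by rewrite t0.
  by apply: le_anti; rewrite le_e.
move=> s /andP[s0]; rewrite le_eqVlt => /orP[/eqP->//|st]; exact/ltW/below.
Qed.
End Psi.

(** * Lower bound for the metric and for the length of curves leaving a point *)

Section LowerBound.
Variables (R : realType) (n : nat).
Notation V := 'Cn[R]_n.

Lemma schwarz_arith (a N v x k s : R) : 0 < a -> 0 <= N -> 0 < v -> 0 <= x -> x <= 2^-1 ->
  a * N * (1 - x) <= 2 * v -> 2 * x <= k * s -> N * (2 * v * (1 + k * s))^-1 <= a^-1.
Proof.
move=> a0 N0 v0 x0 x1 H xs.
have q0 : 0 < 1 + k * s by lra.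
rewrite ler_pdivrMr ?mulr_gt0// mulrC ler_pdivlMr// mulrC.
have aN : 0 <= a * N by rewrite mulr_ge0// ltW.
have x2 : 0 <= x * (1 - 2 * x) by rewrite mulr_ge0//; lra.
have h1 := mulr_ge0 aN x2; have p0 : 0 <= 1 + 2 * x by lra.
have h2 := ler_wpM2r p0 H; have h3 := ler_wpM2l (ltW v0) xs.
lra.
Qed.

(** A disc centred at [w] stays where [P] is controlled on the radius [1 - x], [x = A sqrt d], and
    Caratheodory's inequality for [P] on that smaller disc costs the factor [1 - x]. As [d <= 2 v]
    with [v = - Re (P w)], the loss is expressed by [v] alone, so that the bound can be integrated
    along a curve. *)
Lemma metric_lower (D : set V) p rho (eta C c M : R) :
  local_model D p rho eta C c -> boundary D p -> (forall z, D z -> nrm z <= M) -> 0 < M ->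
  exists k r : R, [/\ 0 <= k, 0 < r, r <= eta / 2 &
    forall P dP w xi, poly_der P dP ->
      (forall u, nrm (u - p) < eta -> D u -> re (P u) <= rho u / 2) ->
      D w -> nrm (w - p) < r ->
      ((nrm (dP w xi) * dpsi k (- re (P w)))%:E <= kobayashi_metric D w xi)%E].
Proof.
move=> lm bp DM M0; have eta0 := lm_eta lm; have C0 : 0 < C := lt_le_trans ltr01 (lm_C lm).
have half_eta : eta / 2 < eta by rewrite ltr_pdivrMr// ltr_pMr// ltr1n.
have [A A0 loc] := localization lm DM M0.
have q0 : 0 < (4 * A ^+ 2 * C)^-1 by rewrite invr_gt0 !mulr_gt0// exprn_gt0.
(* The second radius forces [x <= 1/2], hence [1 <= (1 - x) (1 + 2 x)]; this [k] gives
   [2 x <= k sqrt v]. *)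
exists (2 * A * Num.sqrt 2), (Num.min (eta / 2) (4 * A ^+ 2 * C)^-1).
split; rewrite ?mulr_ge0 ?sqrtr_ge0 ?(ltW A0)//.
- by rewrite lt_min q0 divr_gt0.
- by rewrite ge_min lexx.
move=> P dP w xi PdP Pneg Dw; rewrite lt_min => /andP[wp wq].
have we : nrm (w - p) < eta by exact: lt_trans half_eta.
have rw : rho w < 0 by exact/(lm_D lm we).
set d := - rho w; have d0 : 0 < d by rewrite oppr_gt0.
pose x := A * Num.sqrt d.
have x0 : 0 <= x by rewrite mulr_ge0 ?sqrtr_ge0// ltW.
have x1 : x <= 2^-1.
  have pk : nrm (p - p) < eta by rewrite subrr nrm0.
  have := lm_lip lm pk we; rewrite (lm_bd lm pk bp) subr0 ltr0_norm// -/d => dC.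
  have dq : d <= C * (4 * A ^+ 2 * C)^-1 by apply: le_trans dC _; rewrite ler_pM2l// ltW.
  rewrite -(ler_pXn2r (n := 2)) ?nnegrE ?invr_ge0// /x exprMn sqr_sqrtr ?(ltW d0)//.
  apply: le_trans (ler_wpM2l (sqr_ge0 A) dq) _; rewrite le_eqVlt; apply/orP; left; apply/eqP.
  by field; rewrite !gt_eqF.
have v2 : d <= 2 * - re (P w) by have := Pneg w we Dw; rewrite /d; lra.
have v0 : 0 < - re (P w) by lra.
have xk : 2 * x <= 2 * A * Num.sqrt 2 * Num.sqrt (- re (P w)).
  rewrite -!mulrA -sqrtrM// ler_wpM2l// ler_wpM2l ?(ltW A0)//; exact: ler_wsqrtr.
apply: kobayashi_metric_ge => a g a0 hg g0 dg.
apply: (schwarz_arith a0 (nrm_ge0 _) v0 x0 x1 _ xk).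
have X0 : 0 < 1 - x by rewrite subr_gt0 (le_lt_trans x1)// invf_lt1// ltr1n.
have X1 : 1 - x <= 1 by rewrite lerBlDr lerDl.
have inB (t : cplx R) : nrm t < 1 - x -> nrm (g t - p) < eta by exact: loc.
have hol : holo_on (fun t => P (g t)) 0 (1 - x).
  move=> t; rewrite subr0 => tx; have [[b hb] _] := hg t (lt_le_trans tx X1).
  by exists (dP (g t) b); exact: poly_holo.
have neg (t : cplx R) : nrm t < 1 - x -> re (P (g t)) <= 0.
  move=> tx; have [_ Dg] := hg t (lt_le_trans tx X1).
  have rg : rho (g t) < 0 by exact/(lm_D lm (inB t tx)).
  by have := Pneg _ (inB t tx) Dg; lra.
have := caratheodory0 X0 hol neg (poly_holo PdP dg).
by rewrite g0 (poly_der_scale PdP) nrmM nrm_ofreal gtr0_norm// mulrN mulNr.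
Qed.

(** For the peak polynomial at [z], [- Re P] is at least [c e^2] on the sphere of radius [e] about
    [z] and at most [- 2 rho z] at the centre. The length is at least the difference of [psi] at
    these values. *)
Lemma exit_bound (D : set V) p rho (eta C c k r e : R) gamma (z : V) (a b : R) :
  local_model D p rho eta C c -> 0 <= k -> r <= eta / 2 ->
  (forall P dP w xi, poly_der P dP ->
      (forall u, nrm (u - p) < eta -> D u -> re (P u) <= rho u / 2) ->
      D w -> nrm (w - p) < r ->
      ((nrm (dP w xi) * dpsi k (- re (P w)))%:E <= kobayashi_metric D w xi)%E) ->
  D z -> nrm (z - p) < r / 2 -> 0 < e -> e <= r / 2 ->
  piecewise_C1 gamma -> 0 <= a -> a <= b -> b <= 1 ->
  (forall t, a <= t <= b -> D (gamma t) /\ nrm (gamma t - z) <= e) ->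
  (gamma a = z /\ nrm (gamma b - z) = e) \/ (gamma b = z /\ nrm (gamma a - z) = e) ->
  int_minorized (speed D gamma) a b (psi k (c * e ^+ 2) - 2^-1 * ln (2 * - rho z)).
Proof.
move=> lm k0 reta ml Dz zp e0 er pc a0 ab b1 near ends.
have eta0 := lm_eta lm; have c0 := lm_c lm.
have half_eta : eta / 2 < eta by rewrite ltr_pdivrMr// ltr_pMr// ltr1n.
have r0 : 0 < r by have := lt_le_trans e0 er; rewrite pmulr_lgt0 ?invr_gt0.
have rr : r / 2 + r / 2 = r by rewrite -splitr.
have ze : nrm (z - p) < eta.
  apply: lt_le_trans zp _; apply: le_trans (ltW half_eta); apply: le_trans reta.
  by rewrite ler_pdivrMr// ler_peMr ?(ltW r0)// ler1n.
have [P [v0 [[dP PdP] Pz v00 v0d Pneg]]] := lm_peak lm ze Dz.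
have Pneg' u : nrm (u - p) < eta -> D u -> re (P u) <= rho u / 2.
  move=> ue Du; apply: le_trans (Pneg u ue Du) _; rewrite lerBlDr lerDl.
  by rewrite mulr_ge0 ?sqr_ge0// ltW.
have inr t : a <= t <= b -> nrm (gamma t - p) < r.
  move=> /near[_ h]; apply: le_lt_trans (nrm_tri z _ _) _.
  by rewrite -rr; apply: ler_ltD => //; exact: le_trans h er.
have ine t : a <= t <= b -> nrm (gamma t - p) < eta.
  by move=> /inr h; apply: lt_le_trans h (le_trans reta (ltW half_eta)).
have vpos t : a <= t <= b -> 0 < - re (P (gamma t)).
  move=> tI; have [Dg _] := near t tI; have h := Pneg' _ (ine t tI) Dg.
  have rg : rho (gamma t) < 0 by exact/(lm_D lm (ine t tI)).
  by move: h rg; move: (re _) (rho _) => x y; lra.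
(* The sign [s] treats curves that leave [z] and curves that arrive at [z] together. *)
have H (s : R) : `|s| = 1 -> int_minorized (speed D gamma) a b
   (s * psi k (- re (P (gamma b))) - s * psi k (- re (P (gamma a)))).
  move=> s1.
  have E t : s * psi k (- re (P (gamma t))) = (fun u => s * psi k (-1 * u + 0)) (re (P (gamma t))).
    by rewrite mulN1r addr0.
  rewrite !E.
  apply: (curve_minorized (G := fun u => s * psi k (-1 * u + 0)) (G' := fun u => s * (-1 * dpsi k (-1 * u + 0)))
    pc a0 ab b1 PdP) => t tI.
  have v1 : 0 < -1 * re (P (gamma t)) + 0 by rewrite mulN1r addr0 vpos.
  split.
  - have h := is_derive_affine (is_derive_psi k0 v1).
    by apply: is_derive_eq; rewrite /GRing.scale /=; ring.
  - have h := continuous_affine (continuous_dpsi k0 v1).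
    have cc u : {for re (P (gamma t)), continuous (fun=> u : R)} by exact: cst_continuous.
    exact: (continuousM (cc s) (continuousM (cc (-1)) h)).
  move=> xi; have [Dg _] := near t tI.
  apply: le_trans (ml _ _ _ xi PdP Pneg' Dg (inr t tI)); rewrite lee_fin.
  have dp0 : 0 <= dpsi k (- re (P (gamma t))).
    by rewrite /dpsi invr_ge0 !mulr_ge0 ?(ltW (vpos t tI))// ltW// psi_den_gt0.
  have -> : -1 * re (P (gamma t)) + 0 = - re (P (gamma t)) by ring.
  apply: le_trans (ler_norm _) _; rewrite !normrM s1 normrN1 !mul1r (ger0_norm dp0) mulrC.
  by rewrite ler_wpM2r// re_le_nrm.
have val t : a <= t <= b -> nrm (gamma t - z) = e -> psi k (c * e ^+ 2) <= psi k (- re (P (gamma t))).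
  move=> tI te; have [Dg _] := near t tI; apply: psi_le => //; first by rewrite mulr_gt0// exprn_gt0.
  have := Pneg _ (ine t tI) Dg; rewrite te => h.
  have rg : rho (gamma t) < 0 by exact/(lm_D lm (ine t tI)).
  by move: h rg; move: (re _) (rho _) (c * _) => x y w; lra.
have valz : psi k (- re (P z)) <= 2^-1 * ln (2 * - rho z).
  rewrite Pz reN re_ofreal opprK; apply: le_trans (psi_le_ln _ k0) _.
  by rewrite ler_pM2l ?invr_gt0// ler_ln ?posrE// (lt_le_trans v00).
have aI : a <= a <= b by rewrite lexx.
have bI : a <= b <= b by rewrite lexx andbT.
case: ends => -[gz ge].
  have := H 1 (normr1 _); apply: int_minorized_le.
  by rewrite !mul1r gz; exact: (lerB (val _ bI ge) valz).
have := H (-1) (normrN1 _); apply: int_minorized_le.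
by rewrite !mulN1r gz opprK [leRHS]addrC; exact: (lerB (val _ aI ge) valz).
Qed.
End LowerBound.

(** * Lower bounds for the Kobayashi distance *)

Section DistanceLowerBounds.
Variables (R : realType) (n : nat).
Notation V := 'Cn[R]_n.

Lemma clamp01_itv (x : R) : 0 <= clamp01 x <= 1.
Proof. exact/clamp_bounds/ler01. Qed.

(** The curve is continuous on [[0, 1]] only, whereas [first_exit] asks for continuity everywhere;
    [a = -1], [b = 1] reverses time. *)
Lemma piecewise_C1_clamp (gamma : R -> V) (z : V) (a b : R) : piecewise_C1 gamma ->
  `|a| = 1 -> continuous (fun t : R => nrm (gamma (clamp01 (a * t + b)) - z)).
Proof.
move=> [/subspace_continuousP cg _] a1 t; apply/continuous_absP => e e0.
have uI := clamp01_itv (a * t + b).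
have /cg : `[0, 1]%classic (clamp01 (a * t + b)) by rewrite /= in_itv.
move=> /(_ [set y | nrm (y - gamma (clamp01 (a * t + b))) < e]) [].
  by apply/nbhs_nrmP; exists e.
move=> k /= k0 Hk; exists k => // s st; rewrite (le_lt_trans (nrm_sub2 _ _))//.
rewrite opprB addrA subrK; apply: (Hk (clamp01 (a * s + b))).
  rewrite /ball /= distrC (le_lt_trans (clamp01_lip _ _))//.
  have -> : a * s + b - (a * t + b) = a * (s - t) by ring.
  by rewrite normrM a1 mul1r.
by rewrite /= in_itv /= clamp01_itv.
Qed.

Lemma unit_interval_flip (t : R) : 0 <= t <= 1 -> 0 <= -1 * t + 1 <= 1 /\
  forall s, -1 * t + 1 <= s <= 1 -> 0 <= s <= 1 /\ 0 <= 1 - s <= t.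
Proof. by move=> /andP[t0 t1]; split=> [|s /andP[s0 s1]]; first lra; split; lra. Qed.

Lemma far_from_small_balls (d e a N : R) : 0 < d -> e <= d / 3 -> a <= e -> d <= N -> N <= e + a -> False.
Proof. by move=> *; lra. Qed.

Lemma lower_bound_arith (l x y q : R) :
  - (2^-1 * x) - 2^-1 * y - (l - 2 * q) <= q - 2^-1 * (l + x) + 0 + (q - 2^-1 * (l + y)).
Proof. by lra. Qed.

(** A curve is estimated by [exit_bound] until it first leaves the [e]-ball around [x] and after it
    last enters the one around [y]; the part in between contributes at least 0. *)
Lemma lower_bound (D : set V) p rho (eta C c M : R) :
  local_model D p rho eta C c -> boundary D p -> (forall z, D z -> nrm z <= M) -> 0 < M ->
  exists2 r : R, 0 < r & forall d : R, 0 < d -> exists A : R, forall x y, D x -> D y ->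
    nrm (x - p) < r -> nrm (y - p) < r -> d <= nrm (x - y) ->
    ((- (2^-1 * ln (- rho x)) - 2^-1 * ln (- rho y) - A)%:E <= kobayashi_dist D x y)%E.
Proof.
move=> lm bp DM M0; have [k [r [k0 r0 reta ml]]] := metric_lower lm bp DM M0.
have r2 : 0 < r / 2 by rewrite divr_gt0.
have half_eta : eta / 2 < eta by rewrite ltr_pdivrMr ?(lm_eta lm)// ltr_pMr ?(lm_eta lm)// ltr1n.
exists (r / 2) => // d d0; pose e := Num.min (d / 3) (r / 2).
have e0 : 0 < e by rewrite lt_min r2 divr_gt0.
have ed : e <= d / 3 by rewrite ge_min lexx.
have er : e <= r / 2 by rewrite ge_min lexx orbT.
clearbody e; exists (ln 2 - 2 * psi k (c * e ^+ 2)) => x y Dx Dy xp yp dxy.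
apply: kobayashi_dist_ge => gamma pc Dg g0 g1.
have d3 : d / 3 < d by rewrite ltr_pdivrMr// ltr_pMr// ltr1n.
have [t1 [t1I h1 H1]] : exists t : R, [/\ 0 <= t <= 1, nrm (gamma t - x) = e &
    forall s, 0 <= s <= t -> nrm (gamma s - x) <= e].
  have ch : continuous (fun t : R => nrm (gamma (clamp01 (1 * t + 0)) - x)).
    by apply: piecewise_C1_clamp => //; rewrite normr1.
  have [||t [tI ht Ht]] := first_exit ch e0.
  - by rewrite mul1r addr0 clamp01_le0// g0 subrr nrm0.
  - rewrite mul1r addr0 clamp01_ge1// g1 nrmBC; apply: le_trans dxy.
    exact: le_trans ed (ltW d3).
  exists t; split=> //; first by move: ht; rewrite mul1r addr0 clamp01_id.
  move=> s /andP[s0 st]; have /andP[_ t1] := tI.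
  have := Ht s; rewrite mul1r addr0 clamp01_id ?s0 ?st; first exact.
  by rewrite (le_trans st).
(* The last entry is the first exit of the reversed curve. *)
have [t2 [t2I h2 H2]] : exists t : R, [/\ 0 <= t <= 1, nrm (gamma t - y) = e &
    forall s, t <= s <= 1 -> nrm (gamma s - y) <= e].
  have ch : continuous (fun t : R => nrm (gamma (clamp01 (-1 * t + 1)) - y)).
    by apply: piecewise_C1_clamp => //; rewrite normrN1.
  have [||t [tI ht Ht]] := first_exit ch e0.
  - by rewrite mulr0 add0r clamp01_ge1// g1 subrr nrm0.
  - rewrite mulr1 addNr clamp01_le0// g0; apply: le_trans dxy.
    exact: le_trans ed (ltW d3).
  have [tI' flip] := unit_interval_flip tI.
  exists (-1 * t + 1); split=> //; first by move: ht; rewrite clamp01_id.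
  move=> s sI; have [s1 st] := flip s sI; have := Ht (1 - s).
  by rewrite (_ : -1 * (1 - s) + 1 = s); [rewrite clamp01_id//; exact|ring].
(* As [e <= d / 3] the two closed balls are disjoint, so the exit precedes the entry. *)
have t12 : t1 <= t2.
  rewrite leNgt; apply/negP => lt21; have /andP[_ t11] := t1I.
  have := H2 t1; rewrite (ltW lt21) t11 => /(_ isT) a1.
  have := nrm_tri (gamma t1) x y; rewrite (nrmBC x (gamma t1)) h1.
  exact: far_from_small_balls d0 ed a1 dxy.
have F0 t : (0 <= speed D gamma t)%E by exact: kobayashi_metric_ge0.
have /andP[t10 t11] := t1I; have /andP[t20 t21] := t2I.
have lx : - rho x > 0.
  rewrite oppr_gt0; apply/(lm_D lm) => //; apply: lt_trans xp _; apply: le_lt_trans half_eta.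
  by apply: le_trans reta; rewrite ler_pdivrMr// ler_peMr ?(ltW r0)// ler1n.
have ly : - rho y > 0.
  rewrite oppr_gt0; apply/(lm_D lm) => //; apply: lt_trans yp _; apply: le_lt_trans half_eta.
  by apply: le_trans reta; rewrite ler_pdivrMr// ler_peMr ?(ltW r0)// ler1n.
have B1 : int_minorized (speed D gamma) 0 t1 (psi k (c * e ^+ 2) - 2^-1 * ln (2 * - rho x)).
  apply: (exit_bound lm k0 reta ml Dx xp e0 er pc (lexx _) t10 t11); last by left.
  move=> t /andP[s0 st]; split; last by apply: H1; rewrite s0.
  by apply: Dg; rewrite s0 (le_trans st).
have B2 : int_minorized (speed D gamma) t2 1 (psi k (c * e ^+ 2) - 2^-1 * ln (2 * - rho y)).
  apply: (exit_bound lm k0 reta ml Dy yp e0 er pc t20 t21 (lexx _)); last by right.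
  move=> t /andP[s0 st]; split; last by apply: H2; rewrite s0.
  by apply: Dg; rewrite st andbT (le_trans t20).
have B0 : int_minorized (speed D gamma) t1 t2 0 by exact: int_minorized_nil.
have := int_minorized_add t20 t21 F0 (int_minorized_add t10 t12 F0 B1 B0) B2.
apply: int_minorized_le; rewrite !lnM ?posrE//.
exact: lower_bound_arith.
Qed.

Lemma metric_ge_coord (D : set V) (M : R) (z xi : V) j : (forall z, D z -> nrm z <= M) -> 0 < M ->
  ((nrm (xi 0 j) / (4 * M))%:E <= kobayashi_metric D z xi)%E.
Proof.
move=> DM M0; apply: kobayashi_metric_ge => a g a0 hg g0 dg.
rewrite ler_pdivrMr ?mulr_gt0// mulrC ler_pdivlMr// mulrC.
have := @cauchy_bound R (fun t => g t 0 j) 0 1 M _ ltr01 _ _ (cder_coord j dg).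
rewrite mulr1 mxE nrmM nrm_ofreal gtr0_norm//; apply.
  by move=> t; rewrite subr0 => t1; have [[d hd] _] := hg t t1; exists (d 0 j); exact: cder_coord.
by move=> t; rewrite subr0 => t1; have [_ Dt] := hg t t1; exact: le_trans (nrm_coord _ _) (DM _ Dt).
Qed.

(** In a bounded domain Cauchy's bound for a coordinate of a disc bounds the metric below by
    [|xi_j| / (4 M)]. Along a curve this is compared with the increment of the real part of the
    [j]-th coordinate, rotated so that the increment between the ends is real. *)
Lemma kobayashi_dist_euclid (D : set V) (M m : R) (x y : V) : (forall z, D z -> nrm z <= M) -> 0 < M ->
  0 <= m -> (kobayashi_dist D x y <= m%:E)%E -> nrm (x - y) <= 4 * M * m.
Proof.
move=> DM M0 m0 dm; apply: nrm_le_coord => [|j]; first by rewrite !mulr_ge0// ltW.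
set v := (x - y) 0 j; have [->|v0] := eqVneq v 0; first by rewrite nrm0 !mulr_ge0// ltW.
have nv : 0 < nrm v by rewrite nrm_gt0.
pose u : cplx R := - (Num.conj v / ofreal (nrm v)).
have nu : nrm u = 1 by rewrite nrmN nrmM nrm_conj nrmV nrm_ofreal gtr0_norm// divff// gt_eqF.
have uv : re (u * v) = - nrm v.
  rewrite mulNr mulrAC; have -> : Num.conj v * v = ofreal (nrm v ^+ 2).
    by apply: cplx_eq; rewrite ?reM ?imM ?re_conj ?im_conj ?re_ofreal ?im_ofreal ?sqr_nrm; ring.
  by rewrite -ofrealV -ofrealM reN re_ofreal expr2 mulfK// gt_eqF.
rewrite mulrC -ler_pdivrMr ?mulr_gt0// -lee_fin; apply: le_trans dm.
apply: kobayashi_dist_ge => gamma pc Dg g0 g1.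
have PdP := poly_mul (poly_cst n u) (poly_coord R j).
have := @curve_minorized R n D gamma _ _ (fun s => s / (4 * M)) (fun=> (4 * M)^-1) 0 1 pc
  (lexx _) ler01 (lexx _) PdP.
rewrite /= g0 g1.
have -> : re (u * y 0 j) / (4 * M) - re (u * x 0 j) / (4 * M) = nrm v / (4 * M).
  rewrite -mulrBl -reB -mulrBr; congr (_ / _).
  have -> : y 0 j - x 0 j = - v by rewrite /v !mxE opprB.
  by rewrite mulrN reN uv opprK.
apply=> t tI; split.
- by apply: is_derive_eq; rewrite /GRing.scale /=; ring.
- exact: cst_continuous.
move=> xi; rewrite mul0r add0r; apply: le_trans (@metric_ge_coord D M (gamma t) xi j DM M0).
rewrite lee_fin mulrC ler_wpM2r ?invr_ge0 ?mulr_ge0 ?(ltW M0)//.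
by rewrite (le_trans (ler_norm _))// (le_trans (re_le_nrm _))// nrmM nu mul1r.
Qed.
End DistanceLowerBounds.

(** * Extension by limits, and local estimates of the distance *)

Section Extension.
Variables (R : realType) (n : nat).
Notation V := 'Cn[R]_n.

Definition cauchy_at (D : set V) (f : V -> V) (x : V) : Prop :=
  forall e : R, 0 < e -> exists2 k : R, 0 < k &
    forall p q, D p -> D q -> nrm (p - x) < k -> nrm (q - x) < k -> nrm (f p - f q) < e.

Definition limit_at (D : set V) (f : V -> V) (x l : V) : Prop :=
  forall e : R, 0 < e -> exists2 k : R, 0 < k &
    forall p, D p -> nrm (p - x) < k -> nrm (f p - l) <= e.

(** The limit is the supremum of the eventual lower bounds of [g] near [x]. It inherits the radius
    [k] of the Cauchy condition, which lets the coordinates be recombined afterwards. *)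
Lemma real_limit_of_cauchy (D : set V) (g : V -> R) (x : V) : closure D x ->
  (exists k0 M : R, 0 < k0 /\ forall p, D p -> nrm (p - x) < k0 -> `|g p| <= M) ->
  exists l : R, forall e k : R, 0 < k ->
   (forall p q, D p -> D q -> nrm (p - x) < k -> nrm (q - x) < k -> `|g p - g q| < e) ->
   forall p, D p -> nrm (p - x) < k -> `|g p - l| <= e.
Proof.
move=> /closure_nrmP cD [k0 [M [k00 gM]]].
pose A := [set a : R | exists2 k, 0 < k & forall p, D p -> nrm (p - x) < k -> a <= g p].
have A0 : A (- M).
  by exists k0 => // p Dp pk; have := gM p Dp pk; rewrite ler_norml => /andP[].
exists (sup A) => e k kp H p Dp pk.
have up : ubound A (g p + e).
  move=> a [k' k'0 Ha]; have m0 : 0 < Num.min k k' by rewrite lt_min kp.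
  have [q Dq] := cD _ m0; rewrite lt_min => /andP[qk qk'].
  have := Ha q Dq qk'; have := H q p Dq Dp qk pk; rewrite ltr_norml => /andP[_]; lra.
have lo : A (g p - e).
  exists k => // q Dq qk; have := H p q Dp Dq pk qk; rewrite ltr_norml => /andP[_]; lra.
have h1 : g p - e <= sup A by apply: ub_le_sup => //; exists (g p + e).
have h2 : sup A <= g p + e by apply: ge_sup => //; exists (- M).
by rewrite ler_norml; apply/andP; split; lra.
Qed.

Lemma limit_of_cauchy (D : set V) (f : V -> V) (x : V) : closure D x -> cauchy_at D f x ->
  exists l, limit_at D f x l.
Proof.
move=> cDx cf; have [k1 k10 H1] := cf 1 ltr01.
have [p0 Dp0 p0k] := (closure_nrmP _ _).1 cDx _ k10.
have bnd (g : V -> R) : (forall p q, `|g p - g q| <= nrm (f p - f q)) ->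
    exists k0 M : R, 0 < k0 /\ forall p, D p -> nrm (p - x) < k0 -> `|g p| <= M.
  move=> gf; exists k1, (`|g p0| + 1); split=> // p Dp pk.
  rewrite -[g p](subrK (g p0)) (le_trans (ler_normD _ _))// addrC lerD2l.
  by rewrite (le_trans (gf p p0))// ltW// H1.
have gre j p q : `|re (f p 0 j) - re (f q 0 j)| <= nrm (f p - f q).
  rewrite -reB (le_trans (re_le_nrm _))//.
  have -> : f p 0 j - f q 0 j = (f p - f q) 0 j by rewrite !mxE.
  exact: nrm_coord.
have gim j p q : `|im (f p 0 j) - im (f q 0 j)| <= nrm (f p - f q).
  rewrite -imB (le_trans (im_le_nrm _))//.
  have -> : f p 0 j - f q 0 j = (f p - f q) 0 j by rewrite !mxE.
  exact: nrm_coord.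
have [lr Hr] := choice (fun j => real_limit_of_cauchy cDx (bnd _ (gre j))).
have [li Hi] := choice (fun j => real_limit_of_cauchy cDx (bnd _ (gim j))).
exists (\row_j (lr j +i* li j : cplx R)) => e e0.
have e2 : 0 < e / 2 by rewrite divr_gt0.
have [k k0 Hk] := cf _ e2; exists k => // p Dp pk.
apply: nrm_le_coord => [|j]; first exact: ltW.
rewrite !mxE (le_trans (nrm_le_reim _))// reB imB [e]splitr lerD//.
  by apply: (Hr j _ k k0) => // a b Da Db ak bk; exact: le_lt_trans (gre j a b) (Hk _ _ Da Db ak bk).
by apply: (Hi j _ k k0) => // a b Da Db ak bk; exact: le_lt_trans (gim j a b) (Hk _ _ Da Db ak bk).
Qed.

(** At each point of [closure D] in [U] the extension is the limit along [D], which at points of [D]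
    is the value of [f]; the limits at two nearby points are compared through a common point of
    [D]. *)
Lemma continuous_extension (D : set V) (f : V -> V) (U : set V) (p : V) : open U -> U p ->
  (forall x, U x -> closure D x -> cauchy_at D f x) -> extends_continuously_near D f p.
Proof.
move=> oU Up cf.
have ex x : exists l, U x -> closure D x -> limit_at D f x l.
  have [[Ux cDx]|no] := pselect (U x /\ closure D x).
    by have [l Hl] := limit_of_cauchy cDx (cf x Ux cDx); exists l.
  by exists 0 => Ux cDx; case: no.
have [F HF] := choice ex; exists U, F; split => //.
  apply/subspace_continuousP => x [Ux cDx] A /nbhs_nrmP[e e0 eA].
  have e3 : 0 < e / 3 by rewrite divr_gt0.
  have [k k0 Hk] := HF x Ux cDx _ e3.
  have k2 : 0 < k / 2 by rewrite divr_gt0.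
  apply/nbhs_nrmP; exists (k / 2) => // y yk [Uy cDy]; apply: eA.
  have [l l0 Hl] := HF y Uy cDy _ e3.
  have m0 : 0 < Num.min l (k / 2) by rewrite lt_min l0.
  have [q Dq] := (closure_nrmP _ _).1 cDy _ m0; rewrite lt_min => /andP[ql qk].
  have h1 := Hl q Dq ql; have h2 : nrm (f q - F x) <= e / 3.
    by apply: Hk => //; apply: le_lt_trans (nrm_tri y _ _) _; rewrite [k]splitr ltrD.
  apply: le_lt_trans (nrm_tri (f q) _ _) _; rewrite nrmBC.
  apply: le_lt_trans (lerD h1 h2) _.
  by rewrite [ltRHS](_ : e = e / 3 + e / 3 + e / 3) ?ltrDl//; field.
move=> z Dz Uz; have cDz : closure D z by exact: subset_closure.
apply/eqP; rewrite -subr_eq0 -nrm_eq0; apply/eqP/le_anti; rewrite nrm_ge0 andbT.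
apply/ler_addgt0Pr => e e0; rewrite add0r nrmBC.
by have [k k0 Hk] := HF z Uz cDz e e0; apply: Hk => //; rewrite subrr nrm0.
Qed.

Lemma kobayashi_dist_local (D : set V) (x y : V) (r s : R) : 0 < r -> 0 < s ->
  (forall w, nrm (w - x) < 2 * r -> D w) -> nrm (y - x) < r -> nrm (y - x) <= s ->
  (kobayashi_dist D x y <= (3 * (s / r))%:E)%E.
Proof.
move=> r0 s0 ball yr ys.
have near v w : nrm v < r -> nrm (w - (x + v)) < r -> D w.
  move=> vr wr; apply: ball; have := nrm_tri (x + v) w x; rewrite addrAC subrr add0r => h.
  by apply: le_lt_trans h _; rewrite mulr_natl mulr2n ltrD.
have b0 : seg_bound D x (y - x) (s / r).
  apply: seg_bound_ball => // t /andP[t0 t1] w; apply: near.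
  by rewrite nrmZ nrm_ofreal ger0_norm// (le_lt_trans _ yr)// ler_piMl// nrm_ge0.
(* The last two segments of the broken line are degenerate and are given the same bound, whence the
   factor 3. *)
have b1 : seg_bound D (x + (y - x)) 0 (s / r).
  apply: seg_bound_ball => //; first by rewrite nrm0 ltW.
  by move=> t _ w; rewrite scaler0 addr0; exact: near.
have b2 : seg_bound D (x + (y - x) + 0) 0 (s / r) by rewrite addr0.
have := kobayashi_dist_polyline b0 b1 b2.
rewrite !addr0 addrC subrK; rewrite (_ : 3 * (s / r) = s / r + s / r + s / r)//; ring.
Qed.

Lemma bounded_nrm (D : set V) : bounded_set D -> exists2 M : R, 0 < M & forall z, D z -> nrm z <= M.
Proof.
move=> [M [Mr H]]; exists (1 + `|re M|); first by rewrite ltr_wpDr.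
move=> z Dz; rewrite -ofreal_le -normE; apply: (H _ _ z Dz).
have ME : M = ofreal (re M).
  by move: Mr; rewrite realE => /orP[/ge0_ofreal//|]; rewrite -oppr_ge0 => /ge0_ofreal h;
    apply: oppr_inj; rewrite h reN ofrealN.
by rewrite ME ofreal_lt re_ofreal (le_lt_trans (ler_norm _))// ltrDr.
Qed.
End Extension.

Lemma lt_of_half (R : realFieldType) (a r u : R) : 0 < u -> a < r -> r <= u / 2 -> a < u.
Proof. by move=> *; lra. Qed.

Lemma lt_add_halves (R : realFieldType) (a b r u : R) :
  a < r -> b < r -> r <= u / 2 -> a + b < u.
Proof. by move=> *; lra. Qed.

Lemma half_le_of_tri (R : realFieldType) (a b c : R) : c <= a + b -> a < c / 2 -> c / 2 <= b.
Proof. by move=> *; lra. Qed.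

Lemma compare_arith (R : realFieldType) (B x b y q t u A A' : R) :
  B <= 2^-1 * t + 2^-1 * u + A' -> t <= q - y -> - (2^-1 * x) - 2^-1 * b - A <= B ->
  y <= x + (2 * A + 2 * A' + b + q + u).
Proof. by move=> *; lra. Qed.

(** * Continuity of the isometry and comparison of the defining functions *)

Section Isometry.
Variables (R : realType) (n : nat).
Notation V := 'Cn[R]_n.

(** Locally in the open [D1] the Kobayashi distance is at most a multiple of the norm distance, and
    in the bounded [D2] it is at least one. *)
Lemma isometry_continuous (D1 D2 : set V) (f : V -> V) : open D1 -> bounded_set D2 ->
  kobayashi_isometry D1 D2 f -> forall x, D1 x -> forall e : R, 0 < e ->
  exists2 k : R, 0 < k & forall y, nrm (y - x) < k -> D1 y /\ nrm (f y - f x) < e.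
Proof.
move=> oD1 bD2 [bij iso] x Dx e e0.
have [M M0 DM] := bounded_nrm bD2.
have [r r0 Hr] := (open_nrmP _).1 oD1 x Dx.
have r2 : 0 < r / 2 by rewrite divr_gt0.
pose s := Num.min (r / 4) (e * r / (48 * M)).
have s0 : 0 < s by rewrite lt_min !divr_gt0// mulr_gt0.
have s1 : s <= r / 4 by rewrite ge_min lexx.
have s2 : s * (48 * M) <= e * r by rewrite -ler_pdivlMr ?mulr_gt0// ge_min lexx orbT.
clearbody s; exists s => // y ys.
have Dy : D1 y by apply: Hr; lra.
split=> //.
have ball w : nrm (w - x) < 2 * (r / 2) -> D1 w by rewrite mulrC divfK//; exact: Hr.
have ysr : nrm (y - x) < r / 2 by lra.
have := kobayashi_dist_local r2 s0 ball ysr (ltW ys); rewrite -iso// => h.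
have sr0 : 0 <= 3 * (s / (r / 2)) by rewrite mulr_ge0// divr_ge0// ltW.
rewrite nrmBC; apply: le_lt_trans (kobayashi_dist_euclid DM M0 sr0 h) _.
have -> : 4 * M * (3 * (s / (r / 2))) = s * (48 * M) / (2 * r) by field; rewrite gt_eqF.
by rewrite ltr_pdivrMr ?mulr_gt0//; have := mulr_gt0 e0 r0; lra.
Qed.

Lemma cluster_point (D : set V) (f : V -> V) (p0 q0 : V) (r : R) : in_cluster_set D f p0 q0 -> 0 < r ->
  exists b, [/\ D b, nrm (b - p0) < r & nrm (f b - q0) < r].
Proof.
move=> [u [Du up uq]] r0.
have n1 : nbhs p0 [set z | nrm (z - p0) < r] by apply/nbhs_nrmP; exists r.
have n2 : nbhs q0 [set z | nrm (z - q0) < r] by apply/nbhs_nrmP; exists r.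
have [N1 _ H1] := up _ n1; have [N2 _ H2] := uq _ n2.
exists (u (maxn N1 N2)); split; first exact: Du.
  exact: (H1 (maxn N1 N2) (leq_maxl _ _)).
exact: (H2 (maxn N1 N2) (leq_maxr _ _)).
Qed.

(* The lower bound for d(p, b) in D1 and the upper bound for d(f p, f b) in D2,
   b being a fixed point, agree by the isometry. *)
Lemma defining_functions_compare (D1 D2 : set V) (f : V -> V) (p0 q0 : V)
    rho1 (eta1 C1 c1 : R) rho2 (eta2 C2 c2 : R) :
  open D1 -> bounded_set D1 -> kobayashi_isometry D1 D2 f ->
  boundary D1 p0 -> boundary D2 q0 ->
  local_model D1 p0 rho1 eta1 C1 c1 -> local_model D2 q0 rho2 eta2 C2 c2 ->
  in_cluster_set D1 f p0 q0 ->
  exists r A : R, 0 < r /\ forall p, D1 p -> nrm (p - p0) < r -> nrm (f p - q0) < r ->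
    ln (- rho2 (f p)) <= ln (- rho1 p) + A.
Proof.
move=> oD1 bD1 [bij iso] bp bq lm1 lm2 clus.
have [M M0 DM] := bounded_nrm bD1.
have [rl rl0 low] := lower_bound lm1 bp DM M0.
have [ru [Au [K [ru0 K0 upp]]]] := upper_bound lm2 bq.
pose r := Num.min (Num.min rl (ru / 2)) (eta2 / 2).
have ru2 : 0 < ru / 2 by rewrite divr_gt0.
have e2 := lm_eta lm2.
have r0 : 0 < r by rewrite !lt_min rl0 ru2 divr_gt0.
have rP : [/\ r <= rl, r <= ru / 2 & r <= eta2 / 2] by rewrite !ge_min !lexx !orbT.
have [r1 r2 r3] := rP; clearbody r.
have [b [Db uj fj]] := cluster_point clus r0.
(* The point [b] of the open [D1] differs from the boundary point [p0], so points near [p0] are at a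
   definite distance from it, as the lower bound demands. *)
have bp0 : 0 < nrm (b - p0).
  rewrite nrm_gt0 subr_eq0; apply/eqP => bE; have [_] := bp; apply.
  by rewrite -bE; move: oD1; rewrite openE; apply.
have d0 : 0 < nrm (b - p0) / 2 by rewrite divr_gt0.
have [A HA] := low _ d0.
have C20 : 0 < C2 := lt_le_trans ltr01 (lm_C lm2).
pose Q := ru + C2 * eta2; have Q0 : 0 < Q by rewrite addr_gt0// mulr_gt0.
exists (Num.min r (nrm (b - p0) / 2)), (2 * A + 2 * Au + ln (- rho1 b) + ln Q + ln ((ru - rho2 (f b)) / - rho2 (f b))).
split; first by rewrite lt_min r0.
move=> p Dp; rewrite !lt_min => /andP[pr pb] /andP[fr _].
have Df z : D1 z -> D2 (f z) by move=> Dz; have [fn _ _] := bij; exact: fn.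
have pb' : nrm (b - p0) / 2 <= nrm (p - b).
  by apply: half_le_of_tri pb; rewrite (nrmBC p b) [leRHS]addrC; exact: nrm_tri.
have L := HA p b Dp Db (lt_le_trans pr r1) (lt_le_trans uj r1) pb'.
have fpb : nrm (f p - f b) <= ru.
  by apply: le_trans (nrm_tri q0 _ _) _; rewrite (nrmBC q0) ltW// (lt_add_halves fr fj r2).
have fr' : nrm (f p - q0) < ru := lt_of_half ru0 fr r2.
have fj' : nrm (f b - q0) < ru := lt_of_half ru0 fj r2.
(* At the fixed scale [s = ru] the numerator for [f p] is at most [Q] and the term for [f b] is a
   constant. *)
have [v0 [v1 [v2 [b0 [b1 [b2 [E [s0 s1 s2] _ bnd]]]]]]] :=
  upp (f p) (f b) ru (Df _ Dp) (Df _ Db) fr' fj' ru0 (lexx _) fpb.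
have U := kobayashi_dist_polyline s0 s1 s2; rewrite -E iso// in U.
have := le_trans L U; rewrite lee_fin.
have feta : nrm (f p - q0) < eta2 := lt_of_half e2 fr r3.
have qk : nrm (q0 - q0) < eta2 by rewrite subrr nrm0.
have rf : rho2 (f p) < 0 by apply/(lm_D lm2 feta); exact: Df.
have rQ : ru - rho2 (f p) <= Q.
  have := lm_lip lm2 qk feta; rewrite (lm_bd lm2 qk bq) subr0 ltr0_norm// => h.
  by rewrite lerD2l (le_trans h)// ler_wpM2l ?(ltW C20)// ltW.
have rp : 0 < ru - rho2 (f p) by rewrite subr_gt0 (lt_trans rf).
have lnQ : ln ((ru - rho2 (f p)) / - rho2 (f p)) <= ln Q - ln (- rho2 (f p)).
  by rewrite ln_div ?posrE ?oppr_gt0// lerD2r ler_ln ?posrE.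
move: bnd lnQ.
exact: compare_arith.
Qed.
End Isometry.

Lemma equicontinuous_arith (R : realFieldType) (B xp xq yp yq t u v w A A' A'' : R) :
  B <= 2^-1 * u + 2^-1 * v + A' -> t <= - A'' - A - A' - 1 -> yp <= xp + A'' -> yq <= xq + A'' ->
  u <= t - xp -> v <= t - xq -> - (2^-1 * yp) - 2^-1 * yq - A <= B -> False.
Proof. by move=> *; lra. Qed.

(** * Equicontinuity of the isometry where its images are near [q0] *)

Section Equicontinuity.
Variables (R : realType) (n : nat).
Notation V := 'Cn[R]_n.

(** Were [f p] and [f q] at distance at least [e], the two bounds and the comparison of defining
    functions would cancel all logarithms of [rho1] and [rho2] and leave
    [- Ac - Al - Au <= ln (2 k)], contrary to the choice of [k]. *)
Lemma isometry_equicontinuous (D1 D2 : set V) (f : V -> V) (p0 q0 : V)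
    rho1 (eta1 C1 c1 : R) rho2 (eta2 C2 c2 : R) :
  open D1 -> bounded_set D1 -> bounded_set D2 -> kobayashi_isometry D1 D2 f ->
  boundary D1 p0 -> boundary D2 q0 ->
  local_model D1 p0 rho1 eta1 C1 c1 -> local_model D2 q0 rho2 eta2 C2 c2 ->
  in_cluster_set D1 f p0 q0 ->
  exists2 r : R, 0 < r & forall e : R, 0 < e -> exists2 k : R, 0 < k & forall p q,
    D1 p -> D1 q -> nrm (p - p0) < r -> nrm (q - p0) < r -> nrm (f p - q0) < r -> nrm (f q - q0) < r ->
    nrm (p - q) < k -> - rho1 p < k -> - rho1 q < k -> nrm (f p - f q) < e.
Proof.
move=> oD1 bD1 bD2 isof bp bq lm1 lm2 clus; have [bij iso] := isof.
have [M M0 DM] := bounded_nrm bD2.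
have [rc [Ac [rc0 cmp]]] := defining_functions_compare oD1 bD1 isof bp bq lm1 lm2 clus.
have [rl rl0 low] := lower_bound lm2 bq DM M0.
have [ru [Au [K [ru0 K0 upp]]]] := upper_bound lm1 bp.
have e1 := lm_eta lm1.
pose r := Num.min (Num.min rc rl) (Num.min ru eta1).
have r0 : 0 < r by rewrite !lt_min rc0 rl0 ru0.
have rP : [/\ r <= rc, r <= rl, r <= ru & r <= eta1] by rewrite !ge_min !lexx !orbT.
have [r1 r2 r3 r4] := rP; clearbody r; exists r => // e e0.
have [Al HA] := low e e0.
pose k := Num.min ru (expR (- Ac - Al - Au - 1) / 2).
have k0 : 0 < k by rewrite lt_min ru0 divr_gt0 ?expR_gt0.
have kru : k <= ru by rewrite ge_min lexx.
have lnk : ln (2 * k) <= - Ac - Al - Au - 1.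
  rewrite -[leRHS](expRK) ler_ln ?posrE ?expR_gt0 ?mulr_gt0//.
  by rewrite mulrC -ler_pdivlMr// ge_min lexx orbT.
clearbody k; exists k => // p q Dp Dq pr qr fpr fqr pqk pk qk.
rewrite ltNge; apply/negP => efpq.
have Df z : D1 z -> D2 (f z) by move=> Dz; have [fn _ _] := bij; exact: fn.
have L := HA (f p) (f q) (Df _ Dp) (Df _ Dq) (lt_le_trans fpr r2) (lt_le_trans fqr r2) efpq.
have [v0 [v1 [v2 [b0 [b1 [b2 [E [s0 s1 s2] _ bnd]]]]]]] :=
  upp p q k Dp Dq (lt_le_trans pr r3) (lt_le_trans qr r3) k0 kru (ltW pqk).
have U := kobayashi_dist_polyline s0 s1 s2; rewrite -E -iso// in U.
have := le_trans L U; rewrite lee_fin.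
have cp := cmp p Dp (lt_le_trans pr r1) (lt_le_trans fpr r1).
have cq := cmp q Dq (lt_le_trans qr r1) (lt_le_trans fqr r1).
have lnb z : D1 z -> nrm (z - p0) < r -> - rho1 z < k ->
    ln ((k - rho1 z) / - rho1 z) <= ln (2 * k) - ln (- rho1 z).
  move=> Dz zr zk; have rz : rho1 z < 0 by apply/(lm_D lm1) => //; exact: lt_le_trans r4.
  have kz : 0 < k - rho1 z by rewrite subr_gt0 (lt_trans rz).
  rewrite ln_div ?posrE ?oppr_gt0// lerD2r ler_ln ?posrE ?mulr_gt0//.
  by rewrite mulr_natl mulr2n lerD2l ltW.
have bp' := lnb p Dp pr pk; have bq' := lnb q Dq qr qk.
move: bnd lnk cp cq bp' bq'.
exact: equicontinuous_arith.
Qed.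
End Equicontinuity.

Lemma three_quarters_lt (R : realFieldType) (r : R) : 0 < r -> r / 2 + r / 4 < r.
Proof. by move=> *; lra. Qed.

(** * Points near [p0] are mapped near [q0] *)

Section Image.
Variables (R : realType) (n : nat).
Notation V := 'Cn[R]_n.

(** On the segment the continuous function [|f - q0|] takes no value in [[a, b)], so it cannot rise
    from below [a] past this gap. *)
Lemma segment_stays (D : set V) (f : V -> V) (q0 x v : V) (a b : R) :
  (forall z, D z -> forall e : R, 0 < e -> exists2 k : R, 0 < k &
     forall y, nrm (y - z) < k -> D y /\ nrm (f y - f z) < e) ->
  0 < a -> a < b ->
  (forall t : R, 0 <= t <= 1 -> D (x + ofreal t *: v) /\
     (nrm (f (x + ofreal t *: v) - q0) < b -> nrm (f (x + ofreal t *: v) - q0) < a)) ->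
  nrm (f x - q0) < a -> nrm (f (x + v) - q0) < a.
Proof.
move=> cf a0 ab H fx.
have [D1' stay1] : D (x + ofreal 1 *: v) /\
  (nrm (f (x + ofreal 1 *: v) - q0) < b -> nrm (f (x + ofreal 1 *: v) - q0) < a).
  by apply: H; rewrite lexx ler01.
rewrite ofreal1 scale1r in stay1; rewrite ltNge; apply/negP => afx.
have bfx : b <= nrm (f (x + v) - q0).
  by rewrite leNgt; apply/negP => /stay1; rewrite ltNge afx.
pose m := (a + b) / 2; have am : a < m by rewrite /m; lra.
have mb : m < b by rewrite /m; lra.
have ch : continuous (fun t : R => nrm (f (x + ofreal (clamp01 t) *: v) - q0)).
  move=> t; apply/continuous_absP => e e0.
  have [Dt _] := H _ (clamp01_itv t); have [k k0 Hk] := cf _ Dt e e0.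
  have nv : 0 < 1 + nrm v by rewrite ltr_wpDr ?nrm_ge0.
  exists (k / (1 + nrm v)); first exact: divr_gt0.
  move=> s; rewrite ltr_pdivlMr// => st; rewrite (le_lt_trans (nrm_sub2 _ _))//.
  rewrite opprB addrA subrK; apply: (Hk _ _).2.
  rewrite opprD addrACA subrr add0r -scalerBl -ofrealB nrmZ nrm_ofreal.
  apply: le_lt_trans st; rewrite ler_pM ?nrm_ge0 ?clamp01_lip// lerDr ler01 //.
have [||t [tI ht _]] := first_exit ch (lt_trans a0 am).
- by rewrite clamp01_le0// scale0r addr0 (lt_trans fx).
- by rewrite clamp01_ge1// ofreal1 scale1r (le_trans (ltW mb)).
have [_ st] := H _ (clamp01_itv t).
by have := st; rewrite ht => /(_ mb); rewrite ltNge (ltW am).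
Qed.

(** The equicontinuity assumed here presupposes that images are within [r] of [q0]. A point [b] of
    the cluster sequence has its image within [r / 2], and along the path from [b] to [p] an image
    within [r] is then within [a = 3 r / 4]; the gap between [a] and [r] is never crossed. *)
Lemma image_near_cluster_point (D1 D2 : set V) (f : V -> V) (p0 q0 : V)
    rho1 (eta1 C1 c1 r : R) :
  open D1 -> bounded_set D2 -> kobayashi_isometry D1 D2 f -> boundary D1 p0 ->
  local_model D1 p0 rho1 eta1 C1 c1 -> in_cluster_set D1 f p0 q0 -> 0 < r ->
  (forall e : R, 0 < e -> exists2 k : R, 0 < k & forall p q,
    D1 p -> D1 q -> nrm (p - p0) < r -> nrm (q - p0) < r -> nrm (f p - q0) < r -> nrm (f q - q0) < r ->
    nrm (p - q) < k -> - rho1 p < k -> - rho1 q < k -> nrm (f p - f q) < e) ->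
  exists2 s : R, 0 < s & forall p, D1 p -> nrm (p - p0) < s -> nrm (f p - q0) < r.
Proof.
move=> oD1 bD2 isof bp lm1 clus r0 equi.
have cf := isometry_continuous oD1 bD2 isof.
have e1 := lm_eta lm1; have C10 : 0 < C1 := lt_le_trans ltr01 (lm_C lm1).
have r4 : 0 < r / 4 by rewrite divr_gt0.
have [k k0 Hk] := equi _ r4.
have [ru [Au [K [ru0 K0 upp]]]] := upper_bound lm1 bp.
(* Every point of the three segments, each of size at most [K (2 s)], is within [6 K s] of [b],
   hence within [L s] of [p0]. *)
pose L := 1 + 6 * K; have L0 : 0 < L by rewrite addr_gt0// mulr_gt0.
pose s := Num.min (Num.min (ru / 2) (r / L)) (Num.min (Num.min (k / C1) (k / 2) / L) (eta1 / L)).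
have s0 : 0 < s by rewrite !lt_min !divr_gt0// lt_min !divr_gt0.
have sP : [/\ 2 * s <= ru, L * s <= r, L * s <= eta1, C1 * (L * s) <= k & 2 * (L * s) <= k].
  have h1 : L * s <= Num.min (k / C1) (k / 2).
    by rewrite mulrC -ler_pdivlMr// !ge_min !lexx !orbT.
  split.
  - by rewrite mulrC -ler_pdivlMr// !ge_min lexx.
  - by rewrite mulrC -ler_pdivlMr// !ge_min lexx !orbT.
  - by rewrite mulrC -ler_pdivlMr// !ge_min lexx !orbT.
  - by rewrite mulrC -ler_pdivlMr// (le_trans h1)// ge_min lexx.
  - by rewrite mulrC -ler_pdivlMr// (le_trans h1)// ge_min lexx orbT.
have sLs : s <= L * s by rewrite ler_peMl ?(ltW s0)// lerDl mulr_ge0// ltW.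
have [s1 s2 s3 s4 s5] := sP; clearbody s; exists s => // p Dp ps.
have m0 : 0 < Num.min s (r / 2) by rewrite lt_min s0 divr_gt0.
have [b [Db]] := cluster_point clus m0; rewrite !lt_min => /andP[bs _] /andP[_ fb].
have s20 : 0 < 2 * s by rewrite mulr_gt0.
have half : s <= ru / 2 by rewrite ler_pdivlMr// mulrC.
have bru : nrm (b - p0) < ru := lt_of_half ru0 bs half.
have pru : nrm (p - p0) < ru := lt_of_half ru0 ps half.
have bp2 : nrm (b - p) <= 2 * s by rewrite (le_trans (nrm_tri p0 _ _))// mulr_natl mulr2n lerD// ?(nrmBC p0) ltW.
have [v0 [v1 [v2 [b0 [b1 [b2 [E [g0 g1 g2] [n0 n1 n2] _]]]]]]] := upp b p (2 * s) Db Dp bru pru s20 s1 bp2.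
pose a := r / 2 + r / 4; have a0 : 0 < a by rewrite addr_gt0// divr_gt0.
have ar : a < r by rewrite /a; exact: three_quarters_lt.
have pk : nrm (p0 - p0) < eta1 by rewrite subrr nrm0.
have small z : D1 z -> nrm (z - p0) < L * s -> - rho1 z < k.
  move=> Dz zL; have ze : nrm (z - p0) < eta1 := lt_le_trans zL s3.
  have := lm_lip lm1 pk ze; rewrite (lm_bd lm1 pk bp) subr0 => h.
  apply: le_lt_trans (ler_norm _) _; rewrite normrN; apply: le_lt_trans h _.
  by apply: lt_le_trans s4; rewrite ltr_pM2l.
have good z : D1 z -> nrm (z - b) <= 6 * K * s -> nrm (f z - q0) < r -> nrm (f z - q0) < a.
  move=> Dz zb fz.
  have bL : nrm (b - p0) < L * s by exact: lt_le_trans sLs.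
  have zL : nrm (z - p0) < L * s.
    by apply: le_lt_trans (nrm_tri b _ _) _; rewrite /L mulrDl mul1r addrC; exact: ltr_leD.
  have zb' : nrm (z - b) < k.
    by apply: lt_le_trans s5; rewrite (le_lt_trans (nrm_tri p0 _ _))// mulr_natl mulr2n (nrmBC p0) ltrD.
  have fbr : nrm (f b - q0) < r := lt_of_half r0 fb (lexx _).
  have h := Hk z b Dz Db (lt_le_trans zL s2) (lt_le_trans bL s2) fz fbr zb' (small z Dz zL) (small b Db bL).
  by apply: le_lt_trans (nrm_tri (f b) _ _) _; rewrite /a addrC; exact: ltrD.
have seg x v c : seg_bound D1 x v c -> (forall t : R, 0 <= t <= 1 -> nrm (x + ofreal t *: v - b) <= 6 * K * s) ->
    nrm (f x - q0) < a -> nrm (f (x + v) - q0) < a.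
  move=> [k' [K' [H _]]] near; apply: (segment_stays cf a0 ar) => t tI.
  have [_ _ _ Dt _] := H t tI; split=> //; exact: (good _ Dt (near t tI)).
have tv (t : R) (v : V) : 0 <= t <= 1 -> nrm v <= K * (2 * s) -> nrm (ofreal t *: v) <= 2 * K * s.
  move=> /andP[t0 t1] nv; rewrite nrmZ nrm_ofreal ger0_norm//.
  rewrite (_ : 2 * K * s = K * (2 * s)); last by ring.
  by apply: le_trans nv; rewrite ler_piMl ?nrm_ge0.
have KS : 0 <= 2 * K * s by rewrite !mulr_ge0// ltW.
have K6 : 6 * K * s = 2 * K * s + 2 * K * s + 2 * K * s by ring.
have w0 := tv 1 v0 _ n0; rewrite ofreal1 scale1r in w0.
have w1 := tv 1 v1 _ n1; rewrite ofreal1 scale1r in w1.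
have I1 : 0 <= (1 : R) <= 1 by rewrite ler01 lexx.
apply: lt_trans ar; rewrite E.
apply: (seg _ _ _ g2) => [t tI|].
  have -> : b + v0 + v1 + ofreal t *: v2 - b = v0 + v1 + ofreal t *: v2.
    by apply/rowP => j; rewrite !mxE; ring.
  rewrite K6 (le_trans (nrmD _ _))// lerD ?(tv t v2)// (le_trans (nrmD _ _))// lerD ?w0 ?w1//.
apply: (seg _ _ _ g1) => [t tI|].
  have -> : b + v0 + ofreal t *: v1 - b = v0 + ofreal t *: v1.
    by apply/rowP => j; rewrite !mxE; ring.
  by rewrite K6 -[leLHS]addr0 lerD// (le_trans (nrmD _ _))// lerD ?w0 ?(tv t v1).
apply: (seg _ _ _ g0) => [t tI|].
  have -> : b + ofreal t *: v0 - b = ofreal t *: v0 by apply/rowP => j; rewrite !mxE; ring.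
  by rewrite K6 -[leLHS]addr0 lerD// -[leLHS]addr0 lerD// (tv t v0).
by apply: (lt_trans fb); rewrite /a ltrDl.
Qed.
End Image.


Theorem theorem4p14 (R : realType) (n : nat) (D1 D2 : set 'Cn[R]_n)
    (f : 'Cn[R]_n -> 'Cn[R]_n) (p0 q0 : 'Cn[R]_n)
    (domD1 : is_domain D1) (domD2 : is_domain D2)
    (bndD1 : bounded_set D1) (bndD2 : bounded_set D2)
    (isof : kobayashi_isometry D1 D2 f)
    (bp0 : boundary D1 p0) (bq0 : boundary D2 q0)
    (spcD1 : C2_strongly_pseudoconvex_near D1 p0)
    (spcD2 : C2_strongly_pseudoconvex_near D2 q0)
    (clus : in_cluster_set D1 f p0 q0) :
  extends_continuously_near D1 f p0.
Proof.
have [oD1 _ _] := domD1.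
have [rho1 [eta1 [C1 [c1 lm1]]]] := spc_local_model bp0 spcD1.
have [rho2 [eta2 [C2 [c2 lm2]]]] := spc_local_model bq0 spcD2.
have [r r0 equi] := isometry_equicontinuous oD1 bndD1 bndD2 isof bp0 bq0 lm1 lm2 clus.
have [s s0 near] := image_near_cluster_point oD1 bndD2 isof bp0 lm1 clus r0 equi.
have e1 := lm_eta lm1; have C10 : 0 < C1 := lt_le_trans ltr01 (lm_C lm1).
pose m := Num.min (Num.min s r) eta1.
have m0 : 0 < m by rewrite !lt_min s0 r0.
have [ms mr me] : [/\ m <= s, m <= r & m <= eta1] by rewrite !ge_min !lexx !orbT.
clearbody m; have m2 : 0 < m / 2 by rewrite divr_gt0.
apply: (continuous_extension (U := [set z | nrm (z - p0) < m / 2])).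
- apply/open_nrmP => v vm; exists (m / 2 - nrm (v - p0)); first by rewrite subr_gt0.
  move=> u; rewrite ltrBrDr => uv; exact: le_lt_trans (nrm_tri v _ _) uv.
- by rewrite /= subrr nrm0.
(* At a point of [D1] the Cauchy condition is continuity of the isometry; the other points of the
   closure are boundary points, where equicontinuity applies. *)
move=> x xm cx e e0; have [Dx|nDx] := pselect (D1 x).
  have e2 : 0 < e / 2 by rewrite divr_gt0.
  have [k k0 Hk] := isometry_continuous oD1 bndD2 isof Dx e2.
  exists k => // p q _ _ px qx; have [[_ h1] [_ h2]] := (Hk p px, Hk q qx).
  by rewrite (le_lt_trans (nrm_tri (f x) _ _))// (nrmBC (f x)) [e]splitr ltrD.
have bx : boundary D1 x by split=> // /interior_subset.
have [k k0 Hk] := equi e e0.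
(* The three bounds keep the points within [m] of [p0], at mutual distance below [k], and, since
   [rho1 x = 0], at depth below [k]. *)
pose l := Num.min (m / 2) (Num.min (k / 2) (k / C1)).
have l0 : 0 < l by rewrite !lt_min m2 !divr_gt0.
have [lm lk lC] : [/\ l <= m / 2, l <= k / 2 & l <= k / C1] by rewrite !ge_min !lexx !orbT.
clearbody l; exists l => // p q Dp Dq px qx.
have close z : nrm (z - x) < l -> nrm (z - p0) < m.
  by move=> zx; rewrite (le_lt_trans (nrm_tri x _ _))// [m]splitr ltrD// (lt_le_trans zx).
have xe : nrm (x - p0) < eta1.
  by apply: lt_of_half e1 xm _; rewrite ler_pM2r ?invr_gt0.
have small z : nrm (z - x) < l -> - rho1 z < k.
  move=> zx; have := lm_lip lm1 xe (lt_le_trans (close z zx) me).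
  rewrite (lm_bd lm1 xe bx) subr0 => h; apply: le_lt_trans (ler_norm _) _.
  rewrite normrN; apply: le_lt_trans h _.
  by rewrite mulrC -ltr_pdivlMr// (lt_le_trans zx).
apply: Hk => //.
- exact: lt_le_trans (close p px) mr.
- exact: lt_le_trans (close q qx) mr.
- exact: near Dp (lt_le_trans (close p px) ms).
- exact: near Dq (lt_le_trans (close q qx) ms).
- by rewrite (le_lt_trans (nrm_tri x _ _))// (nrmBC x) [k]splitr ltrD// (lt_le_trans _ lk).
- exact: small.
- exact: small.
Qed.
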